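(* Let $\nu>0$, $\lambda_0>0$, $\lambda(t)=\sqrt{\lambda_0^2+4\nu t}$, and $N\ge1$. Let $\omega_0=\sum_{j=1}^N w_0^j$ with $\omega_0\in L^\infty(\mathbb{R}^2)$, and suppose that for every $j=1,\dots,N$, $$\mathcal{E}^j(0)=\int_{\mathbb{R}^2}\Phi_{\lambda_0}(x)^{-1}\,w_0^j(x)^2\,dx<\infty.$$ Let $\omega$ be the solution of the two-dimensional vorticity equation with initial datum $\omega_0$ and $\mathbf{u}$ its Biot–Savart velocity field, and for each $j$ let $w^j(x,t)$ be the solution of the linear advection–diffusion equation $$\partial_t w^j=\nu\Delta w^j-\mathbf{u}(x,t)\cdot\nabla w^j,\qquad w^j(x,0)=w_0^j(x).$$ Then for every $j$ and every $t>0$, $\mathcal{E}^j(t)=\int_{\mathbb{R}^2}\Phi_{\lambda(t)}(x)^{-1}w^j(x,t)^2\,dx<\infty$.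
   Context: $\Phi_\lambda(x)=\frac{1}{\pi\lambda^2}e^{-|x|^2/\lambda^2}$. The two-dimensional vorticity equation is $\partial_t\omega=\nu\Delta\omega-\mathbf{u}\cdot\nabla\omega$ on $\mathbb{R}^2$, with $\mathbf{u}(x,t)=\frac{1}{2\pi}\int_{\mathbb{R}^2}\frac{(x-y)^\perp}{|x-y|^2}\omega(y,t)\,dy$, $z^\perp=(-z_2,z_1)$. In the paper, $w^j(x,t)=\omega^j(x-x^j(t),t)$ is the $j$-th vortex component of the multi-vortex decomposition $\omega=\sum_j w^j$, and the total advecting field $\sum_\ell \mathbf{u}^\ell$ is the velocity $\mathbf{u}$ of the full solution. *)

(* Defs.v *)
From HB Require Import structures.
From mathcomp Require Import all_boot all_order all_algebra.
From mathcomp Require Import all_classical all_reals all_analysis.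
Set Implicit Arguments. Unset Strict Implicit. Unset Printing Implicit Defensive.
Import Order.TTheory GRing.Theory Num.Theory.
Import numFieldNormedType.Exports.
Local Open Scope classical_set_scope.
Local Open Scope ring_scope.

Section Defs.
Variable R : realType.

Definition leb2 := ((@lebesgue_measure R) \x (@lebesgue_measure R))%E.

Definition Phi (lam : R) (x : R * R) : R :=
  (pi * lam ^+ 2)^-1 * expR (- (x.1 ^+ 2 + x.2 ^+ 2) / lam ^+ 2).

Definition lam_t (nu lam0 t : R) : R := Num.sqrt (lam0 ^+ 2 + 4 * nu * t).

Definition wenergy (lam : R) (f : R * R -> R) : \bar R :=
  (\int[leb2]_x ((Phi lam x)^-1 * (f x) ^+ 2)%:E)%E.

Definition pd1 (f : R * R -> R -> R) (x : R * R) (t : R) : R :=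
  derive1 (fun s => f (s, x.2) t) x.1.
Definition pd2 (f : R * R -> R -> R) (x : R * R) (t : R) : R :=
  derive1 (fun s => f (x.1, s) t) x.2.
Definition pdt (f : R * R -> R -> R) (x : R * R) (t : R) : R :=
  derive1 (fun s => f x s) t.
Definition lap (f : R * R -> R -> R) (x : R * R) (t : R) : R :=
  pd1 (pd1 f) x t + pd2 (pd2 f) x t.

Definition classical21 (f : R * R -> R -> R) : Prop :=
  forall (x : R * R) (t : R), 0 < t ->
    [/\ derivable (fun s => f (s, x.2) t) x.1 1,
        derivable (fun s => f (x.1, s) t) x.2 1,
        derivable (fun s => pd1 f (s, x.2) t) x.1 1,
        derivable (fun s => pd2 f (x.1, s) t) x.2 1 &
        derivable (fun s => f x s) t 1] /\
     [/\ {for (x, t), continuous (fun p : (R * R) * R => f p.1 p.2)},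
         {for (x, t), continuous (fun p : (R * R) * R => pd1 f p.1 p.2)},
         {for (x, t), continuous (fun p : (R * R) * R => pd2 f p.1 p.2)},
         {for (x, t), continuous (fun p : (R * R) * R => lap f p.1 p.2)} &
         {for (x, t), continuous (fun p : (R * R) * R => pdt f p.1 p.2)}].

(* Biot-Savart law  u(x,t) = 1/(2 pi) int (x-y)^perp/|x-y|^2 om(y,t) dy,
   with z^perp = (-z2, z1). *)
Definition BS1 (om : R * R -> R -> R) (x : R * R) (t : R) : R :=
  (2 * pi)^-1 * Rintegral leb2 setT (fun y : R * R =>
     - (x.2 - y.2) / ((x.1 - y.1) ^+ 2 + (x.2 - y.2) ^+ 2) * om y t).
Definition BS2 (om : R * R -> R -> R) (x : R * R) (t : R) : R :=
  (2 * pi)^-1 * Rintegral leb2 setT (fun y : R * R =>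
     (x.1 - y.1) / ((x.1 - y.1) ^+ 2 + (x.2 - y.2) ^+ 2) * om y t).

Definition adv_diff_eq (nu : R) (u1 u2 f : R * R -> R -> R) : Prop :=
  forall (x : R * R) (t : R), 0 < t ->
    pdt f x t = nu * lap f x t - (u1 x t * pd1 f x t + u2 x t * pd2 f x t).

Definition vorticity_solution (nu : R) (om0 : R * R -> R)
    (om : R * R -> R -> R) : Prop :=
  [/\ classical21 om,
      adv_diff_eq nu (BS1 om) (BS2 om) om,
      (exists M : R, forall x t, 0 < t -> `|om x t| <= M),
      (forall t, 0 < t -> (\int[leb2]_x (`|om x t|)%:E < +oo)%E) &
      ((fun t => \int[leb2]_x (`|om x t - om0 x|)%:E)%E
         @ (0 : R)^'+ --> 0%E)].

Definition linear_solution (nu : R) (u1 u2 : R * R -> R -> R)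
    (w0 : R * R -> R) (w : R * R -> R -> R) : Prop :=
  [/\ classical21 w,
      adv_diff_eq nu u1 u2 w,
      (forall T, 0 < T -> exists C : R, forall t, 0 < t -> t <= T ->
        (\int[leb2]_x ((w x t) ^+ 2)%:E <= C%:E)%E) &
      ((fun t => \int[leb2]_x ((w x t - w0 x) ^+ 2)%:E)%E
         @ (0 : R)^'+ --> 0%E)].

End Defs.

(* Main.v *)
Require Import Defs.
From HB Require Import structures.
From mathcomp Require Import all_boot all_order all_algebra.
From mathcomp Require Import all_classical all_reals all_analysis.
From mathcomp Require Import measurable_realfun ring lra.
Set Implicit Arguments.
Unset Strict Implicit.
Unset Printing Implicit Defensive.
Import Order.TTheory GRing.Theory Num.Theory.
Import numFieldNormedType.Exports.
Local Open Scope classical_set_scope.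
Local Open Scope ring_scope.

(* The quantity y(t) = int eta w^2, where eta is a cut-off of the weight exp (|x|^2 / lam(t)^2), satisfies
   y' <= (|u|_oo^2 / nu) y + o(1): the diffusive terms absorb the gradient of the weight because
   d/dt lam^2 = 4 nu. Gronwall's inequality and Fatou's lemma conclude, provided that the Biot-Savart
   velocity u is bounded on (0, T].

   The latter is not among the hypotheses: u is bounded at each time by |om|_oo and |om|_1, but |om(t)|_1 is
   only known to be finite for each t. Write u = u_r + O(r |om|_oo), where u_r has the kernel mollified at
   scale r. Testing the equation with this kernel and using Serfati's identity
   om u . grad phi ~ (quadratic in u) x (second derivatives of phi), one finds that u_r changes by
   at most (t - s) O((1 + |u|_oo^2) / r) from s to t. With r proportional to |u|_oo, this shows that on any
   short interval where u is bounded at all, it at most doubles. Since |om(t)|_1 is lower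
   semicontinuous, Baire's argument gives local boundedness on (0, T], and convergence of om(t) to
   om_0 in L^1 gives boundedness near 0. *)

(** The equation holds only for t > 0 and w(t) tends to w_0 only in L^2. The Gaussian weight is
    therefore first replaced by a bounded one, of size at most exp(2 k), against which L^2
    convergence controls the energy at a small positive time. The radius L of the spatial cut-off is
    chosen after k: its error is O(1 / L), but with a constant exponential in k.

    In the energy estimate write eta = p^2. Completing the square leaves 2 nu w^2 |grad p|^2, which
    is half of what the time derivative of the Gaussian gains; Young's inequality spends the other
    half on the transport term, at the price |u|^2.

    Nothing is known on the decay of gradients, so every integration by parts is against a compactly
    supported function. The one that involves the Laplacian goes through a smooth approximate
    solution V of V - lap V = F - lap F and a maximum principle.

    For the velocity, once r is proportional to a bound X of |u|, the cost of a time step is linear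
    in X, so the admissible length of the step does not depend on X. This is why a merely finite
    bound improves itself. *)

Section PlaneIntegral.
Context {R : realType}.
Local Notation plane := (R * R)%type.
Implicit Types f g : plane -> R.

Lemma continuous_ballP {T : pseudoMetricType R} (f : T -> R) (x : T) :
  {for x, continuous f} <->
  forall e : R, 0 < e -> exists2 d : R, 0 < d & forall y, ball x d y -> `|f x - f y| < e.
Proof.
split=> [cf e e0|h].
  move/cvgrPdist_lt: cf => /(_ e e0)/nbhs_ballP[d /= d0 hd].
  by exists d.
apply/cvgrPdist_lt => e /h[d d0 hd].
by apply/nbhs_ballP; exists d.
Qed.

(** Measurability on the plane refers to the product sigma-algebra, so an open set is exhibited as
    the countable union of the boxes with rational centre and half-width 1 / (n + 1) that it
    contains. *)
Lemma open_measurable_plane (A : set plane) : open A -> measurable A.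
Proof.
move=> oA.
pose B (p q : rat) (n : nat) : set plane :=
  `](ratr p - n.+1%:R^-1), (ratr p + n.+1%:R^-1)[ `*`
  `](ratr q - n.+1%:R^-1), (ratr q + n.+1%:R^-1)[.
suff -> : A = \bigcup_p \bigcup_q \bigcup_n
    (if `[< B p q n `<=` A >] then B p q n else set0).
  apply: bigcupT_measurable_rat => p; apply: bigcupT_measurable_rat => q.
  apply: bigcupT_measurable => n; case: ifP => // _.
  by apply: measurableX; exact: measurable_itv.
apply/seteqP; split=> [x Ax|x [p _ [q _ [n _]]]]; last first.
  by case: ifPn => // /asboolP; apply.
have /nbhs_ballP[e /= e0 he] := open_nbhs_nbhs (conj oA Ax).
have [n _ hn] := near_infty_natSinv_lt (PosNum (divr_gt0 e0 (ltr0n R 2))).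
have := hn n (leqnn n); rewrite /= => {}hn.
set i := n.+1%:R^-1 in hn.
have i0 : 0 < i by rewrite invr_gt0 ltr0n.
have [p] : exists p, ratr p \in `]x.1, (x.1 + i)[.
  by apply: rat_in_itvoo; rewrite ltrDl.
have [q] : exists q, ratr q \in `]x.2, (x.2 + i)[.
  by apply: rat_in_itvoo; rewrite ltrDl.
rewrite !in_itv/= => /andP[q1 q2] /andP[p1 p2].
exists p => //; exists q => //; exists n => //.
rewrite asboolT.
  by rewrite /B; split; rewrite /= in_itv/=; apply/andP; split; rewrite -/i; lra.
move=> y [/=]; rewrite !in_itv/= -/i => /andP[y1 y2] /andP[y3 y4].
by apply: he; split; rewrite /ball/= ltr_norml; apply/andP; split; lra.
Qed.

Lemma continuous_measurable_plane f : continuous f -> measurable_fun setT f.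
Proof.
move=> cf; apply: (measurability _ (RGenOpens.measurableE R)).
move=> _ [_ [a [b ->] <-]]; rewrite setTI; apply: open_measurable_plane.
by move/continuousP : cf; apply; exact: interval_open.
Qed.

(** A real-valued integral, with junk value 0 when the integral is infinite; linearity and
    monotonicity below therefore carry [L1] hypotheses. *)
Definition Int f : R := Rintegral (@leb2 R) setT f.
Definition L1 f := (@leb2 R).-integrable setT (EFin \o f).

Lemma L1_measurable f : L1 f -> measurable_fun setT f.
Proof. by move=> /measurable_int/measurable_EFinP. Qed.

Lemma L1P f : measurable_fun setT f ->
  (\int[@leb2 R]_x (`|f x|)%:E < +oo)%E -> L1 f.
Proof.
by move=> mf h; apply/integrableP; split => //; exact/measurable_EFinP.
Qed.

Lemma eq_Int f g : (forall x, f x = g x) -> Int f = Int g.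
Proof. by move=> fg; congr Int; apply/funext. Qed.

Lemma eq_L1 f g : (forall x, f x = g x) -> L1 f -> L1 g.
Proof. by move=> /funext ->. Qed.

Lemma L1D f g : L1 f -> L1 g -> L1 (fun x => f x + g x).
Proof. by move=> hf hg; have := integrableD measurableT hf hg. Qed.

Lemma L1N f : L1 f -> L1 (fun x => - f x).
Proof. by move=> hf; have := integrableN hf. Qed.

Lemma L1B f g : L1 f -> L1 g -> L1 (fun x => f x - g x).
Proof. by move=> hf /L1N; exact: L1D. Qed.

Lemma L1Z c f : L1 f -> L1 (fun x => c * f x).
Proof. by move=> hf; have := integrableZl measurableT c hf. Qed.

Lemma L1_abs f : L1 f -> L1 (fun x => `|f x|).
Proof. exact: integrable_norm. Qed.

Lemma L1_0 : L1 (fun=> 0).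
Proof. exact: integrable0. Qed.

Lemma L1_le f g : measurable_fun setT f -> (forall x, `|f x| <= g x) -> L1 g -> L1 f.
Proof.
move=> mf fg hg; apply: (le_integrable measurableT _ _ hg).
  exact/measurable_EFinP.
by move=> x _; rewrite /= lee_fin (le_trans (fg x))// ler_norm.
Qed.

Lemma L1M c f g : L1 f -> measurable_fun setT g -> (forall x, `|g x| <= c) ->
  L1 (fun x => g x * f x).
Proof.
move=> hf mg gc; apply: (@L1_le _ (fun x => c * `|f x|)).
- by apply: measurable_funM => //; exact: L1_measurable.
- by move=> x; rewrite normrM ler_wpM2r.
- exact/L1Z/L1_abs.
Qed.

Lemma IntD f g : L1 f -> L1 g -> Int (fun x => f x + g x) = Int f + Int g.
Proof. by move=> hf hg; rewrite /Int RintegralD. Qed.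

Lemma IntZ c f : L1 f -> Int (fun x => c * f x) = c * Int f.
Proof. by move=> hf; rewrite /Int RintegralZl. Qed.

Lemma IntB f g : L1 f -> L1 g -> Int (fun x => f x - g x) = Int f - Int g.
Proof. by move=> hf hg; rewrite /Int RintegralB. Qed.

Lemma Int0 : Int (fun=> 0) = 0.
Proof. by rewrite /Int Rintegral_cst// mul0r. Qed.

Lemma Int_le f g : L1 f -> L1 g -> (forall x, f x <= g x) -> Int f <= Int g.
Proof. by move=> hf hg fg; rewrite /Int le_Rintegral. Qed.

Lemma Int_ge0 f : (forall x, 0 <= f x) -> 0 <= Int f.
Proof. by move=> f0; exact: Rintegral_ge0. Qed.

Lemma Int_abs f : L1 f -> `|Int f| <= Int (fun x => `|f x|).
Proof. by move=> hf; exact: le_normr_Rintegral. Qed.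

Lemma Int_abs_le f g : measurable_fun setT f -> L1 g ->
  (forall x, `|f x| <= g x) -> `|Int f| <= Int g.
Proof.
move=> mf hg fg; have hf := L1_le mf fg hg.
by rewrite (le_trans (Int_abs hf))// Int_le//; exact: L1_abs.
Qed.

Lemma Int_EFin f : L1 f -> ((Int f)%:E = \int[@leb2 R]_x (f x)%:E)%E.
Proof. by move=> hf; rewrite /Int fineK//; exact: integrable_fin_num. Qed.

Lemma Int_fine_le f (c : R) : (forall x, 0 <= f x) -> measurable_fun setT f ->
  (\int[@leb2 R]_x (f x)%:E <= c%:E)%E -> L1 f /\ Int f <= c.
Proof.
move=> f0 mf h.
have hf : L1 f.
  apply: L1P => //; apply: le_lt_trans (ltry c); apply: le_trans h.
  by under eq_integral do rewrite ger0_norm//.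
by split=> //; rewrite -lee_fin Int_EFin.
Qed.

(** Supports are measured by squares rather than discs: a square is a product of intervals, which
    gives its measure and its compactness. *)
Definition inbox (L : R) (x : plane) := (`|x.1| <= L) && (`|x.2| <= L).
Definition supp L f := forall x, ~~ inbox L x -> f x = 0.

Lemma supp_widen L L' f : L <= L' -> supp L f -> supp L' f.
Proof.
move=> LL' sf x; rewrite negb_and -!ltNge => xL'; apply: sf.
by rewrite negb_and -!ltNge; case/orP: xL' => h; apply/orP; [left|right]; lra.
Qed.

Lemma measurable_inbox L : measurable [set x : plane | inbox L x].
Proof.
rewrite [X in measurable X](_ : _ = `[- L, L] `*` `[- L, L]).
  by apply: measurableX; exact: measurable_itv.
apply/seteqP; split => x; rewrite /= /inbox !in_itv/= !ler_norml.
  by move=> /andP[-> ->].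
by move=> [-> ->].
Qed.

Lemma leb2_inbox L : (@leb2 R [set x : plane | inbox L x] < +oo)%E.
Proof.
rewrite [X in (leb2 X < _)%E](_ : _ = `[- L, L] `*` `[- L, L]); last first.
  apply/seteqP; split => x; rewrite /= /inbox !in_itv/= !ler_norml.
    by move=> /andP[-> ->].
  by move=> [-> ->].
rewrite /leb2 product_measure1E; [|exact: measurable_itv..].
rewrite /= !lebesgue_measure_itv/=; case: ifP => _; last by rewrite mul0e ltry.
by rewrite -EFinD -EFinM ltry.
Qed.

Lemma L1_box M L f : measurable_fun setT f -> (forall x, `|f x| <= M) ->
  supp L f -> L1 f.
Proof.
move=> mf fM sf; have mB := measurable_inbox L.
have : (@leb2 R).-integrable [set x : plane | inbox L x] (EFin \o f).
  apply: measurable_bounded_integrable => //.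
  - exact: leb2_inbox.
  - exact: measurable_funS mf.
  - by exists M; split; [exact: num_real|move=> y My x _ /=; rewrite (le_trans (fM x))// ltW].
rewrite integrable_mkcond//; apply: eq_integrable => // x _.
rewrite /patch; case: ifPn => // /negP h; rewrite /= sf//.
by apply/negP => h'; apply: h; rewrite inE.
Qed.

Lemma compact_inbox L : compact [set x : plane | inbox L x].
Proof.
rewrite [X in compact X](_ : _ = `[- L, L] `*` `[- L, L]).
  by apply: compact_setX; exact: segment_compact.
apply/seteqP; split => x; rewrite /= /inbox !in_itv/= !ler_norml.
  by move=> /andP[-> ->].
by move=> [-> ->].
Qed.

Lemma compact_bounded_fun {T : topologicalType} (A : set T) (f : T -> R) :
  compact A -> {within A, continuous f} -> exists2 M : R, 0 <= M & forall x, A x -> `|f x| <= M.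
Proof.
move=> cA cf.
have cfA := continuous_compact cf cA.
have [M [_ hM]] := compact_bounded cfA.
exists (`|M| + 1); first by rewrite addr_ge0.
move=> x Ax; apply: hM; last by exists x.
by rewrite (le_lt_trans (ler_norm M))// ltrDl.
Qed.

Lemma continuous_box_bounded f L : continuous f ->
  exists2 M : R, 0 <= M & forall x, inbox L x -> `|f x| <= M.
Proof.
move=> cf.
have h := @continuous_subspaceT _ _ [set x : plane | inbox L x] f cf.
by have [M M0 hM] := compact_bounded_fun (@compact_inbox L) h; exists M.
Qed.

Lemma continuous_supp_bounded f L : continuous f -> supp L f ->
  exists2 M : R, 0 <= M & forall x, `|f x| <= M.
Proof.
move=> /(continuous_box_bounded L)[M M0 hM] sf; exists M => // x.
by have [/hM//|/sf->] := boolP (inbox L x); rewrite normr0.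
Qed.

Lemma L1_supp f L : continuous f -> supp L f -> L1 f.
Proof.
move=> cf sf; have [M _ hM] := continuous_supp_bounded cf sf.
by apply: (@L1_box M L) => //; exact: continuous_measurable_plane.
Qed.

End PlaneIntegral.

(** * Partial derivatives, continuity and integration by parts on the plane *)

Section PlaneCalculus.
Context {R : realType}.
Local Notation plane := (R * R)%type.
Implicit Types (f g : plane -> R) (i : bool).

(** Directions are booleans, [false] for the first coordinate and [true] for the second. [D i f g]
    is purely pointwise: [g] is the derivative of [f] along each line, with no regularity
    attached. *)
Definition slice i (x : plane) (s : R) : plane := if i then (x.1, s) else (s, x.2).
Definition coord i (x : plane) : R := if i then x.2 else x.1.
Definition D i f g := forall x : plane,
  is_derive (coord i x) (1 : R) (fun s => f (slice i x s)) (g x).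

Lemma slice_coord i x : slice i x (coord i x) = x.
Proof. by case: i x => -[]. Qed.

Lemma eq_D i f f' g g' : f =1 f' -> g =1 g' -> D i f g -> D i f' g'.
Proof. by move=> /funext <- /funext <-. Qed.

Lemma is_deriveM_val (F G : R -> R) (x dF dG : R) :
  is_derive x (1 : R) F dF -> is_derive x (1 : R) G dG ->
  is_derive x (1 : R) (fun s => F s * G s) (dF * G x + F x * dG).
Proof.
move=> hF hG; have h := is_deriveM hF hG.
by apply: (is_derive_eq h); rewrite /GRing.scale/=; ring.
Qed.

Lemma is_deriveD_val (F G : R -> R) (x dF dG : R) :
  is_derive x (1 : R) F dF -> is_derive x (1 : R) G dG ->
  is_derive x (1 : R) (fun s => F s + G s) (dF + dG).
Proof. by move=> hF hG; have h := is_deriveD hF hG. Qed.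

Lemma is_derive_comp_val (F G : R -> R) (x dF dG : R) :
  is_derive x (1 : R) F dF -> is_derive (F x) (1 : R) G dG ->
  is_derive x (1 : R) (fun s => G (F s)) (dG * dF).
Proof.
move=> hF hG; exact: is_derive1_comp.
Qed.

Lemma DM i f g f' g' : D i f f' -> D i g g' ->
  D i (fun x => f x * g x) (fun x => f' x * g x + f x * g' x).
Proof.
move=> hf hg x; have := is_deriveM_val (hf x) (hg x).
by rewrite slice_coord.
Qed.

Lemma DD i f g f' g' : D i f f' -> D i g g' ->
  D i (fun x => f x + g x) (fun x => f' x + g' x).
Proof. by move=> hf hg x; exact: is_deriveD_val (hf x) (hg x). Qed.

Lemma Dcst i c : D i (fun=> c) (fun=> 0).
Proof. by move=> x; exact: is_derive_cst. Qed.

Lemma DZ i c f f' : D i f f' -> D i (fun x => c * f x) (fun x => c * f' x).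
Proof.
move=> hf; have h := DM (Dcst i c) hf; apply: eq_D h => // x.
by rewrite mul0r add0r.
Qed.

Lemma DN i f f' : D i f f' -> D i (fun x => - f x) (fun x => - f' x).
Proof. by move=> /(@DZ _ (-1)); apply: eq_D => x; rewrite mulN1r. Qed.

Lemma DB i f g f' g' : D i f f' -> D i g g' ->
  D i (fun x => f x - g x) (fun x => f' x - g' x).
Proof. by move=> hf /DN; exact: DD. Qed.

Lemma Dcomp i (phi phi' : R -> R) f f' :
  (forall y, is_derive y (1 : R) phi (phi' y)) -> D i f f' ->
  D i (fun x => phi (f x)) (fun x => phi' (f x) * f' x).
Proof.
move=> hphi hf x; apply: is_derive_comp_val (hf x) _.
by rewrite slice_coord.
Qed.

Lemma Dcoord i j : D i (coord j) (fun=> (i == j)%:R).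
Proof.
by move=> x; case: i j => -[]; rewrite /=; [exact: is_derive_id|exact: is_derive_cst
  |exact: is_derive_cst|exact: is_derive_id].
Qed.

Lemma Dfst : D false fst (fun=> 1). Proof. exact: Dcoord false false. Qed.
Lemma Dsnd : D true snd (fun=> 1). Proof. exact: Dcoord true true. Qed.
Lemma Dfst0 : D true fst (fun=> 0). Proof. exact: Dcoord true false. Qed.
Lemma Dsnd0 : D false snd (fun=> 0). Proof. exact: Dcoord false true. Qed.

Lemma DV i f f' : (forall x, f x != 0) -> D i f f' ->
  D i (fun x => (f x)^-1) (fun x => - ((f x) ^- 2) * f' x).
Proof.
move=> f0 hf x.
have h : f (slice i x (coord i x)) != 0 by [].
have := is_deriveV h (hf x) => H; apply: (is_derive_eq H).
by rewrite slice_coord.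
Qed.

Lemma is_derive_near (F G : R -> R) (x d : R) :
  (\forall y \near x, F y = G y) -> is_derive x (1 : R) F d -> is_derive x (1 : R) G d.
Proof.
move=> FG hF; have FG' : {near x, F =1 G} by [].
split; first exact: near_eq_derivable FG' _.
by rewrite -(near_eq_derive _ FG')//; have [_ ->] := hF.
Qed.

(** Some coordinate [j] exceeds [L] in absolute value. If [j = i] this stays so nearby, and
    otherwise the line does not change it; in both cases [f] vanishes along the line near the
    point. *)
Lemma D_supp i f g L : D i f g -> supp L f -> supp L g.
Proof.
move=> h sf x xL.
suff H : \forall s \near coord i x, (fun=> 0) s = f (slice i x s).
  have h0 := is_derive_near H (is_derive_cst (0:R) (coord i x) (1:R)).
  by have [_ <-] := h x; have [_ <-] := h0.
have [j xj] : exists j, L < `|coord j x|.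
  move: xL; rewrite negb_and -!ltNge => /orP[h1|h2]; [by exists false|by exists true].
have hs s : L < `|coord j (slice i x s)| -> 0 = f (slice i x s).
  move=> hL; rewrite sf// negb_and -!ltNge.
  by case: {xj} j hL => /= ->; rewrite ?orbT.
have [ij|ij] := eqVneq i j.
  have : L < `|coord i x| by rewrite ij.
  move=> xi; have : \forall s \near coord i x, L < `|s|.
    have : (fun s : R => `|s|) s @[s --> coord i x] --> `|coord i x| by apply: norm_continuous.
    by move=> /(cvgr_gt _) /(_ _ xi).
  apply: filterS => s sL; apply: hs.
  by case: (i) ij sL {xi h xj} => <-.
apply: filterE => s; apply: hs.
by case: (i) ij xj {h} => /=; case: (j).
Qed.

Lemma ctsD {T : topologicalType} (f g : T -> R) :
  continuous f -> continuous g -> continuous (fun x => f x + g x).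
Proof. by move=> cf cg x; apply: cvgD; [exact: cf|exact: cg]. Qed.

Lemma ctsM {T : topologicalType} (f g : T -> R) :
  continuous f -> continuous g -> continuous (fun x => f x * g x).
Proof. by move=> cf cg x; apply: cvgM; [exact: cf|exact: cg]. Qed.

Lemma ctsN {T : topologicalType} (f : T -> R) :
  continuous f -> continuous (fun x => - f x).
Proof. by move=> cf x; apply: cvgN; exact: cf. Qed.

Lemma ctsB {T : topologicalType} (f g : T -> R) :
  continuous f -> continuous g -> continuous (fun x => f x - g x).
Proof. by move=> cf /ctsN; exact: ctsD. Qed.

Lemma ctsC {T : topologicalType} (c : R) : continuous (fun _ : T => c).
Proof. by move=> x; exact: cvg_cst. Qed.

Lemma ctsV {T : topologicalType} (f : T -> R) :
  (forall x, f x != 0) -> continuous f -> continuous (fun x => (f x)^-1).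
Proof. by move=> f0 cf x; apply: cvgV; [exact: f0|exact: cf]. Qed.

Lemma ctsX {T : topologicalType} (f : T -> R) n :
  continuous f -> continuous (fun x => f x ^+ n).
Proof.
move=> cf; elim: n => [|n IH]; first by under eq_fun do rewrite expr0; exact: ctsC.
by under eq_fun do rewrite exprS; exact: ctsM.
Qed.

Lemma cts_comp {T U : topologicalType} (f : T -> U) (g : U -> R) :
  continuous f -> continuous g -> continuous (fun x => g (f x)).
Proof. by move=> cf cg x; apply: continuous_comp; [exact: cf|exact: cg]. Qed.

Lemma cts_pair {T U V : topologicalType} (f : T -> U) (g : T -> V) :
  continuous f -> continuous g -> continuous (fun x => (f x, g x)).
Proof. by move=> cf cg x; apply: cvg_pair; [exact: cf|exact: cg]. Qed.

Lemma cts_fst {T U : topologicalType} : continuous (@fst T U).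
Proof. by move=> x; exact: cvg_fst. Qed.

Lemma cts_snd {T U : topologicalType} : continuous (@snd T U).
Proof. by move=> x; exact: cvg_snd. Qed.

Lemma cts_id {T : topologicalType} : continuous (fun x : T => x).
Proof. by move=> x; exact: cvg_id. Qed.

Lemma cts_coord i : continuous (coord i).
Proof. by case: i; [exact: cts_snd|exact: cts_fst]. Qed.

Lemma cts_slice i x : continuous (slice i x).
Proof.
by case: i; apply: cts_pair; (exact: cts_id || exact: (fun y => @cvg_cst _ _ _ _ _)).
Qed.

Lemma cts_slice_comp i x f : continuous f -> continuous (fun s => f (slice i x s)).
Proof. by move=> cf; apply: (@cts_comp _ _ (slice i x) f) => //; exact: cts_slice. Qed.

Lemma cts_fst_comp (F : R -> R) : continuous F -> continuous (fun x : plane => F x.1).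
Proof. by move=> cF; apply: (@cts_comp _ _ (@fst R R) F) => //; exact: cts_fst. Qed.

Lemma cts_snd_comp (F : R -> R) : continuous F -> continuous (fun x : plane => F x.2).
Proof. by move=> cF; apply: (@cts_comp _ _ (@snd R R) F) => //; exact: cts_snd. Qed.

Lemma derive_continuous (F F' : R -> R) :
  (forall x, is_derive x (1 : R) F (F' x)) -> continuous F.
Proof.
move=> h x; apply/differentiable_continuous/derivable1_diffP.
by have [] := h x.
Qed.

Lemma compact_integral_derive (F F' : R -> R) (L : R) :
  (forall x, is_derive x (1 : R) F (F' x)) -> continuous F' ->
  (forall x, L < `|x| -> F x = 0) ->
  (\int[@lebesgue_measure R]_x (F' x)%:E = 0)%E.
Proof.
move=> dF cF' sF.
have sF' x : L < `|x| -> F' x = 0.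
  move=> xL; have H : \forall y \near x, (fun=> 0) y = F y.
    have : \forall s \near x, L < `|s|.
      have : (fun s : R => `|s|) s @[s --> x] --> `|x| by apply: norm_continuous.
      by move=> /(cvgr_gt _) /(_ _ xL).
    by apply: filterS => y /sF.
  have h0 := is_derive_near H (is_derive_cst (0:R) x (1:R)).
  by have [_ <-] := dF x; have [_ <-] := h0.
(* [L] may be negative; [K] is positive and larger than [L], so [F] vanishes at both ends of the
   interval. *)
pose K := `|L| + 1.
have LK : L < K by rewrite (le_lt_trans (ler_norm L))// ltrDl.
have K0 : 0 < K by rewrite ltr_wpDl.
have -> : (\int[@lebesgue_measure R]_x (F' x)%:E =
    \int[@lebesgue_measure R]_(x in `[(- K)%R, K]) (F' x)%:E)%E.
  rewrite [RHS]integral_mkcond; apply: eq_integral => x _.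
  rewrite /patch; case: ifPn => //; rewrite notin_setE/= in_itv/= => /negP h.
  rewrite sF'// (lt_le_trans LK)//.
  rewrite leNgt; apply/negP => xK; move/negP: h; apply.
  by rewrite -ler_norml ltW.
rewrite (@continuous_FTC2 _ F' F).
- rewrite !sF ?sube0// ?normrN (lt_le_trans LK)// ler_norm//.
- by rewrite gtrN.
- by apply: continuous_subspaceT => x; exact: cF'.
- split.
  + by move=> x _; have [] := dF x.
  + by apply: cvg_at_right_filter; exact: (derive_continuous dF).
  + by apply: cvg_at_left_filter; exact: (derive_continuous dF).
- by move=> x _; rewrite derive1E; have [_ ->] := dF x.
Qed.

(** Fubini's theorem is used in the order that integrates first in the differentiated variable,
    where the inner integral is already 0. *)
Lemma Int_D i f g L : continuous f -> continuous g -> supp L f -> D i f g -> Int g = 0.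
Proof.
move=> cf cg sf dfg.
have sg := D_supp dfg sf.
have ig : (@leb2 R).-integrable setT (EFin \o g) := L1_supp cg sg.
rewrite /Int /Rintegral.
suff -> : (\int[@leb2 R]_x (g x)%:E = 0)%E by [].
case: i dfg => dfg.
  rewrite /leb2 -(integral12_prod_meas1 ig) /fubini_F/=.
  apply: integral0_eq => x _.
  apply: (@compact_integral_derive (fun s => f (x, s)) (fun s : R => g (x, s)) L).
  - by move=> y; have := dfg (x, y).
  - refine (@cts_slice_comp true (x, 0) g cg).
  - by move=> y yL; apply: sf; rewrite negb_and -!ltNge yL orbT.
rewrite /leb2 -(integral21_prod_meas1 ig) /fubini_G/=.
apply: integral0_eq => y _.
apply: (@compact_integral_derive (fun s => f (s, y)) (fun s : R => g (s, y)) L).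
- by move=> x; have := dfg (x, y).
- refine (@cts_slice_comp false (0, y) g cg).
- by move=> x xL; apply: sf; rewrite negb_and -!ltNge xL.
Qed.

Lemma suppMl f g L : supp L f -> supp L (fun x => f x * g x).
Proof. by move=> sf x /sf ->; rewrite mul0r. Qed.

Lemma suppMr f g L : supp L g -> supp L (fun x => f x * g x).
Proof. by move=> sf x /sf ->; rewrite mulr0. Qed.

Lemma suppD f g L : supp L f -> supp L g -> supp L (fun x => f x + g x).
Proof. by move=> sf sg x xL; rewrite sf// sg// addr0. Qed.

Lemma suppZ c f L : supp L f -> supp L (fun x => c * f x).
Proof. by move=> sf x xL; rewrite sf// mulr0. Qed.

Lemma Int_parts i f f' g g' L : continuous f -> continuous f' -> continuous g ->
  continuous g' -> supp L g -> D i f f' -> D i g g' ->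
  Int (fun x => f x * g' x) = - Int (fun x => f' x * g x).
Proof.
move=> cf cf' cg cg' sg df dg.
have h := Int_D (ctsM cf cg) (ctsD (ctsM cf' cg) (ctsM cf cg')) (suppMr f sg) (DM df dg).
apply/eqP; rewrite -addr_eq0 addrC -IntD; first by rewrite h.
- by apply: (@L1_supp _ _ L); [exact: ctsM|exact: suppMr].
- by apply: (@L1_supp _ _ L); [exact: ctsM|apply: suppMr; exact: D_supp dg sg].
Qed.

End PlaneCalculus.

Ltac cts_with tac := repeat first
  [ match goal with
    | |- continuous (fun x => (@?f x + @?g x)%R) => apply: ctsD
    | |- continuous (fun x => (- @?f x)%R) => apply: ctsN
    | |- continuous (fun x => (@?f x * @?g x)%R) => apply: ctsM
    | |- continuous (fun x => (@?f x ^+ ?n)%R) => apply: ctsX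
    | |- continuous ( *%R _) => apply: ctsM
    | |- continuous (+%R _) => apply: ctsD
    | |- continuous (-%R) => apply: ctsN
    | |- continuous (fun _ => ?c) => exact: ctsC
    | |- continuous (fun x => x) => exact: cts_id
    | |- continuous (fun x => x.1) => exact: cts_fst
    | |- continuous (fun x => x.2) => exact: cts_snd
    | |- continuous (fun x => ?f x.1) => apply: cts_fst_comp
    | |- continuous (fun x => ?f x.2) => apply: cts_snd_comp
    end
  | tac | assumption
  | exact: ctsC | exact: cts_id | exact: cts_fst | exact: cts_snd ].
Ltac cts := cts_with fail.

(** * Mean value arguments, truncated powers and an arctangent integral on the line *)

Section OneVariable.
Context {R : realType}.
Implicit Types F G : R -> R.

Lemma mean_value F F' a b : a < b -> (forall x, is_derive x (1 : R) F (F' x)) ->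
  exists2 c, a < c < b & F b - F a = F' c * (b - a).
Proof.
move=> ab dF; have cF := derive_continuous dF.
have [] := @MVT R F F' a b ab (fun x _ => dF x).
  by apply: continuous_subspaceT => x; exact: cF.
by move=> c; rewrite in_itv/= => cab h; exists c.
Qed.

Lemma is_derive_shift_val F (d x c : R) :
  is_derive (x + c) (1 : R) F d -> is_derive x (1 : R) (fun y => F (y + c)) d.
Proof.
move=> dF.
have h : is_derive x (1 : R) (fun y => y + c) 1.
  by have := is_deriveD_val (is_derive_id x (1:R)) (is_derive_cst c x (1:R)); rewrite addr0.
by have := is_derive_comp_val h dF; rewrite mulr1.
Qed.

(** The mean value theorem is applied to [F (y + h) - F y] between [x - h] and [x], then to [F']
    over an interval of length [h]. *)
Lemma second_difference F F' F'' x h : 0 < h ->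
  (forall y, is_derive y (1 : R) F (F' y)) -> (forall y, is_derive y (1 : R) F' (F'' y)) ->
  exists2 c, `|c - x| < h & F (x + h) + F (x - h) - 2 * F x = h ^+ 2 * F'' c.
Proof.
move=> h0 dF dF'.
have dG y : is_derive y (1 : R) (fun y => F (y + h) - F y) (F' (y + h) - F' y).
  have := is_deriveB (is_derive_shift_val (dF (y + h))) (dF y); exact.
have [|c /andP[c1 c2]] := mean_value (a := x - h) (b := x) _ dG; first by lra.
rewrite subrK => E.
have [|k /andP[k1 k2] E'] := mean_value (a := c) (b := c + h) _ dF'; first by lra.
exists k; first by rewrite ltr_norml; apply/andP; split; lra.
rewrite (_ : F (x + h) + F (x - h) - 2 * F x = F (x + h) - F x - (F x - F (x - h))); last by ring.
by rewrite E E'; ring.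
Qed.

Lemma second_derivative_max F F' (a c : R) :
  (forall y, is_derive y (1 : R) F (F' y)) -> is_derive c (1 : R) F' a ->
  (forall y, F y <= F c) -> a <= 0.
Proof.
move=> dF dF' Fc.
have F'c : F' c = 0.
  have h := @derive1_at_max R F (c - 1) (c + 1) c.
  have [_ <-] := dF c.
  have [_ ->//] : is_derive c (1 : R) F (0 : R).
  apply: h; [lra| by move=> y _; have [] := dF y| |by move=> t _].
  by rewrite in_itv/=; apply/andP; split; lra.
rewrite leNgt; apply/negP => a0.
have [dF'c ea] := dF'.
have : h^-1 *: (F' (h *: (1:R) + c) - F' c) @[h --> 0^'] --> a.
  by rewrite -ea; exact: dF'c.
move=> /(cvgr_gt _) /(_ _ a0).
rewrite near_withinE => /nbhs_ballP[e /= e0 he].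
have ce : c < c + e / 2 by rewrite ltrDl divr_gt0.
have [k /andP[k1 k2] E] := mean_value ce dF.
have := Fc (c + e / 2); rewrite leNgt => /negP; apply.
rewrite -subr_gt0 E; apply: mulr_gt0; last by rewrite addrAC subrr add0r divr_gt0.
have := he (k - c).
rewrite /ball/= sub0r normrN gtr0_norm ?subr_gt0// => /(_ _)/= h.
have : 0 < (k - c)^-1 *: (F' ((k - c) *: (1:R) + c) - F' c).
  by apply: h; rewrite ?subr_eq0 ?gt_eqF//; lra.
rewrite F'c subr0 {1}/GRing.scale/= [(k - c) *: 1]mulr1 subrK.
by rewrite pmulr_rgt0// invr_gt0 subr_gt0.
Qed.

(** Handles the junction point 0 of the truncated powers. *)
Lemma is_derive_quadratic0 F C :
  (forall h, `|h| < 1 -> `|F h| <= C * h ^+ 2) -> is_derive (0 : R) (1 : R) F 0.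
Proof.
move=> hF.
have F0 : F 0 = 0.
  apply/eqP; rewrite -normr_le0 (le_trans (hF 0 _))// ?normr0//.
  by rewrite expr0n mulr0.
have C0 : 0 <= C.
  have := hF (1 / 2); rewrite ger0_norm; last lra.
  move=> /(_ ltac:(lra)) /(le_trans (normr_ge0 _)).
  by rewrite pmulr_lge0// exprn_gt0//; lra.
have H : h^-1 *: (F (h *: (1:R) + 0) - F 0) @[h --> 0^'] --> (0:R).
  apply/cvgrPdist_lt => e e0; rewrite near_withinE.
  have d0 : 0 < Num.min 1 (e / (C + 1)) by rewrite lt_min ltr01 divr_gt0// ltr_wpDl.
  apply/nbhs_ballP; exists (Num.min 1 (e / (C + 1))) => //= h.
  rewrite /ball/= sub0r normrN lt_min => /andP[h1 h2] hn0.
  rewrite sub0r normrN F0 subr0 addr0 [h *: 1]mulr1 normrM normfV.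
  rewrite -(ltr_pM2l (_ : 0 < `|h|)) ?normr_gt0// mulrA divff ?normr_eq0// mul1r.
  apply: le_lt_trans (hF _ h1) _.
  rewrite -real_normK ?num_real// expr2 mulrCA ltr_pM2l ?normr_gt0//.
  move: h2; rewrite ltr_pdivlMr ?ltr_wpDl//; apply: le_lt_trans.
  by rewrite mulrC ler_wpM2l// lerDl.
split; first by apply/cvg_ex; exists 0.
exact/cvg_lim.
Qed.

Lemma is_derive_exp n (s : R) :
  is_derive s (1 : R) (fun y => y ^+ n.+1) (n.+1%:R * s ^+ n).
Proof.
elim: n => [|n IH].
  by rewrite mulr1; have := is_derive_id s (1 : R); congr (is_derive _ _ _ _).
have := is_deriveM_val (is_derive_id s (1 : R)) IH.
rewrite (_ : (fun _ => _ * _) = (fun y : R => y ^+ n.+2)); last first.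
  by apply/funext => y; rewrite -exprS.
by move/is_derive_eq; apply; rewrite mul1r -[n.+2%:R]natr1 !exprS; ring.
Qed.

Lemma is_derive_inv F (x d : R) : F x != 0 -> is_derive x (1 : R) F d ->
  is_derive x (1 : R) (fun y => (F y)^-1) (- (F x) ^- 2 * d).
Proof. by move=> F0 dF; have := is_deriveV F0 dF. Qed.

(** The truncated power of spline theory. It is the source of all cut-offs and bumps below; each
    differentiation lowers [n] by one. *)
Definition pospow n (s : R) : R := Num.max s 0 ^+ n.

Lemma pospow_ge0 n s : 0 <= pospow n s.
Proof. by rewrite exprn_ge0// le_max lexx orbT. Qed.

Lemma pospowE n s : 0 <= s -> pospow n s = s ^+ n.
Proof. by move=> s0; rewrite /pospow max_l. Qed.

Lemma pospow0 n s : s <= 0 -> pospow n.+1 s = 0.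
Proof. by move=> s0; rewrite /pospow max_r// expr0n. Qed.

Lemma continuous_pospow n : continuous (pospow n).
Proof.
apply: ctsX; rewrite (_ : (fun s : R => Num.max s 0) = fun s => (s + `|s|) / 2).
  by move=> x; apply: cvgM; [apply: cvgD; [exact: cvg_id|exact: norm_continuous]|exact: cvg_cst].
apply/funext => s; rewrite maxC; case: (leP 0 s) => s0.
  by rewrite ger0_norm//; lra.
by rewrite ltr0_norm//; lra.
Qed.

Lemma is_derive_pospow n s :
  is_derive s (1 : R) (pospow n.+2) (n.+2%:R * pospow n.+1 s).
Proof.
have [s0|s0|->] := ltgtP s 0.
- rewrite pospow0 ?ltW// mulr0; apply: is_derive_near (is_derive_cst (0:R) s (1:R)).
  have := lt_nbhsl s0; apply: filterS => y y0; rewrite pospow0 ?ltW//.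
- rewrite pospowE ?ltW//.
  apply: is_derive_near (is_derive_exp n.+1 s).
  by have := lt_nbhsr s0; apply: filterS => y y0; rewrite pospowE// ltW.
- rewrite pospow0// mulr0; apply: (@is_derive_quadratic0 _ 1) => h h1.
  have [h0|h0] := leP 0 h; last first.
    by rewrite (pospow0 _ (ltW h0)) normr0 mul1r sqr_ge0.
  rewrite pospowE// mul1r normrX -[h ^+ 2]ger0_norm ?sqr_ge0// normrX.
  by rewrite ler_wiXn2l// ltW.
Qed.

(** An antiderivative is atan((y - c) / a) / a, whose total variation is pi / a; the line is
    exhausted by the intervals [-n, n]. *)
Lemma integral_inv_sq (c a : R) : 0 < a ->
  (\int[@lebesgue_measure R]_y (((y - c) ^+ 2 + a ^+ 2)^-1)%:E <= (pi / a)%:E)%E.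
Proof.
move=> a0.
pose f (y : R) := ((y - c) ^+ 2 + a ^+ 2)^-1.
have p0 y : 0 < (y - c) ^+ 2 + a ^+ 2 by rewrite ltr_wpDl ?sqr_ge0// exprn_gt0.
have cf : continuous f.
  apply: ctsV => [y|]; first by rewrite gt_eqF.
  by apply: ctsD; [apply: ctsX; apply: ctsB; [exact: cts_id|exact: ctsC]|exact: ctsC].
pose F (y : R) := a^-1 * atan ((y + - c) * a^-1).
have dF y : is_derive y (1 : R) F (f y).
  have h1 : is_derive y (1 : R) (fun y => (y + - c) * a^-1) a^-1.
    have h : is_derive (y + - c) (1 : R) (fun y => y * a^-1) a^-1.
      have := is_deriveM_val (is_derive_id (y + - c) (1:R)) (is_derive_cst a^-1 (y + - c) (1:R)).
      by rewrite mul1r mulr0 addr0.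
    exact: is_derive_shift_val h.
  have h2 := is_derive_comp_val h1 (is_derive1_atan ((y + - c) * a^-1)).
  have := is_deriveM_val (is_derive_cst a^-1 y (1:R)) h2.
  rewrite mul0r add0r; move/is_derive_eq; apply; rewrite /=.
  rewrite /f; have := p0 y; move: (y - c) => z z0.
  by field; rewrite gt_eqF//= ?gt_eqF// addrC gt_eqF.
pose I (n : nat) : set R := [set` `[(- n%:R)%R, n%:R]].
have cI : nondecreasing_seq I.
  move=> m n mn; apply/subsetPset => x; rewrite /I/= !in_itv/= => /andP[x1 x2].
  have : (m%:R : R) <= n%:R by rewrite ler_nat.
  by move=> h; apply/andP; split; lra.
have UI : \bigcup_n I n = setT.
  apply/seteqP; split=> // x _.
  exists (Num.trunc `|x|).+1 => //; rewrite /I/= in_itv/= -ler_norml.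
  by rewrite ltW// truncnS_gt.
rewrite -UI.
have := @ge0_nondecreasing_set_cvg_integral _ (measurableTypeR R) R I (fun y => (f y)%:E) (@lebesgue_measure R) cI.
have mI n : measurable (I n) by exact: measurable_itv.
have mf n : measurable_fun (I n) (fun y => (f y)%:E).
  by apply/measurable_EFinP; apply: measurable_funTS; exact: continuous_measurable_fun.
have f0 n x : I n x -> (0 <= (f x)%:E)%E by move=> _; rewrite lee_fin invr_ge0 ltW.
move=> /(_ mI mf f0) h.
rewrite -(cvg_lim _ h)//.
apply: lime_le; first by apply/cvg_ex; eexists; exact: h.
apply: nearW => n.
(* For [n = 0] the interval is a single point, where the fundamental theorem of calculus does not
   apply. *)
have [->|n0] := eqVneq n 0%N.
  rewrite /I oppr0 set_itv1 integral_set1 lee_fin.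
  by rewrite divr_ge0 ?ltW// pi_gt0.
have n0' : (0 : R) < n%:R by rewrite ltr0n lt0n.
rewrite /I (@continuous_FTC2 _ f F).
- rewrite -EFinB lee_fin /F -mulrBr mulrC ler_pM2r ?invr_gt0//.
  have := atan_ltpi2 ((n%:R + - c) * a^-1); have := atan_gtNpi2 ((- n%:R + - c) * a^-1).
  by lra.
- by rewrite gtrN.
- by apply: continuous_subspaceT => x; exact: cf.
- split.
  + by move=> x _; have [] := dF x.
  + by apply: cvg_at_right_filter; exact: (derive_continuous dF).
  + by apply: cvg_at_left_filter; exact: (derive_continuous dF).
- by move=> x _; rewrite derive1E; have [_ ->] := dF x.
Qed.

End OneVariable.

Section UniformContinuity.
Context {R : realType}.
Local Notation plane := (R * R)%type.

Lemma supp_uniform_continuous (f : plane -> R) L : continuous f -> supp L f ->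
  forall e : R, 0 < e -> exists2 d : R, 0 < d & forall x y, ball x d y -> `|f x - f y| < e.
Proof.
move=> cf sf e e0.
(* The margin 1 exceeds the distance 1 / 2 imposed below: if [x] is outside the larger box, both
   points are outside the support. *)
have K := @compact_inbox R (L + 1).
move/compact_near_coveringP : K => /(_ R (0 : R)^'+ (fun d x => forall y, ball x d y -> `|f x - f y| < e)).
move=> /(_ _) [].
  move=> x _.
  have [d d0 hd] := (continuous_ballP f x).1 (cf x) (e / 2) (divr_gt0 e0 (ltr0n R 2)).
  have d20 : 0 < d / 2 by rewrite divr_gt0.
  exists (ball x (d / 2), [set r : R | r < d / 2]).
    split => /=; first by apply/nbhs_ballP; exists (d / 2).
    exact: nbhs_right_lt.
  move=> [x' r] [/= xx' rd] y x'y.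
  have h1 := hd x' (le_ball _ xx'); have h2 := hd y.
  have h3 : `|f x - f x'| < e / 2 by apply: h1; lra.
  have h4 : `|f x - f y| < e / 2.
    apply: h2; rewrite [d](splitr d); apply: (ball_triangle xx').
    by apply: le_ball x'y; exact: ltW.
  rewrite (_ : f x' - f y = (f x' - f x) + (f x - f y)); last by ring.
  rewrite (le_lt_trans (ler_normD _ _))// [e](splitr e) ltrD// distrC//.
move=> r /= r0 hr.
have d0 : 0 < Num.min (r / 2) (1 / 2) by rewrite lt_min !divr_gt0.
exists (Num.min (r / 2) (1 / 2)) => // x y xy.
have [xL|xL] := boolP (inbox (L + 1) x).
  apply: (hr (Num.min (r / 2) (1 / 2))) xL y xy => //.
  rewrite /ball_/= sub0r normrN gtr0_norm// gt_min; apply/orP; left; lra.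
have {d0}[] : ball x (1 / 2) y by apply: le_ball xy; rewrite ge_min lexx orbT.
rewrite /ball/= !ltr_norml => /andP[a1 a2] /andP[a3 a4].
have L1 : L < `|x.1| - 1/2 \/ L < `|x.2| - 1 / 2.
  by move: xL; rewrite negb_and -!ltNge => /orP[]h; [left|right]; lra.
have t1 : `|x.1| - 1/2 <= `|y.1| by case: (ger0P x.1); case: (ger0P y.1); lra.
have t2 : `|x.2| - 1/2 <= `|y.2| by case: (ger0P x.2); case: (ger0P y.2); lra.
have [ox oy] : ~~ inbox L x /\ ~~ inbox L y.
  rewrite !negb_and -!ltNge; case: L1 => h; split; apply/orP;
  solve [left; lra|right; lra].
by rewrite !sf// subrr ?normr0// oppr_lt0 e0.
Qed.

End UniformContinuity.

(** * Integration by parts for a pointwise Laplacian *)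

Section CompactlySupportedC2.
Context {R : realType}.
Local Notation plane := (R * R)%type.
Implicit Types (V W U Z : plane -> R) (i j : bool).

(** Pairs a compactly supported C^2 function [V] with its Laplacian [W], so that shifts and linear
    combinations carry their Laplacian along. The approximations built below are produced by these
    two operations alone. *)
Definition C2c L V W := exists V' V'' : bool -> plane -> R,
  [/\ continuous V, supp L V, (forall i, continuous (V' i) /\ continuous (V'' i)),
      (forall i, D i V (V' i) /\ D i (V' i) (V'' i)) &
      forall x, W x = V'' false x + V'' true x].

Definition shiftc i (h : R) (x : plane) := slice i x (coord i x + h).

Lemma cts_shiftc i h : continuous (shiftc i h).
Proof.
case: i; apply: cts_pair.
- exact: cts_fst.
- by rewrite /coord; cts.
- by rewrite /coord; cts.
- exact: cts_snd.
Qed.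

Lemma D_shiftc i j h V V' : D i V V' -> D i (V \o shiftc j h) (V' \o shiftc j h).
Proof.
move=> dV x; have := dV (shiftc j h x); case: i j {dV} => -[] /= h'.
- exact: (@is_derive_shift_val _ (fun s => V (x.1, s))).
- exact: h'.
- exact: h'.
- exact: (@is_derive_shift_val _ (fun s => V (s, x.2))).
Qed.

Lemma supp_shiftc j h L V : supp L V -> supp (L + `|h|) (V \o shiftc j h).
Proof.
move=> sV x xL; apply: sV; move: xL; rewrite !negb_and -!ltNge.
have hh z : `|z| - `|h| <= `|z + h|.
  by have := lerB_normD z h.
case: j => /= /orP[] H; apply/orP.
- by left; rewrite (le_lt_trans _ H)// lerDl.
- by right; rewrite (lt_le_trans _ (hh _))// ltrBrDr.
- by left; rewrite (lt_le_trans _ (hh _))// ltrBrDr.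
- by right; rewrite (le_lt_trans _ H)// lerDl.
Qed.

Lemma C2c_shiftc j h L V W : C2c L V W ->
  C2c (L + `|h|) (V \o shiftc j h) (W \o shiftc j h).
Proof.
move=> [V' [V'' [cV sV cV' dV WE]]].
exists (fun i => V' i \o shiftc j h), (fun i => V'' i \o shiftc j h).
have c (F : plane -> R) : continuous F -> continuous (F \o shiftc j h).
  by move=> cF; apply: (@cts_comp _ _ _ (shiftc j h) F) => //; exact: cts_shiftc.
split.
- exact: c.
- exact: supp_shiftc.
- by move=> i; have [c1 c2] := cV' i; split; exact: c.
- by move=> i; have [d1 d2] := dV i; split; exact: D_shiftc.
- by move=> x; exact: WE.
Qed.

Lemma C2c_lin L c d V W U Z : C2c L V W -> C2c L U Z ->
  C2c L (fun x => c * V x + d * U x) (fun x => c * W x + d * Z x).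
Proof.
move=> [V' [V'' [cV sV cV' dV WE]]] [U' [U'' [cU sU cU' dU ZE]]].
exists (fun i x => c * V' i x + d * U' i x), (fun i x => c * V'' i x + d * U'' i x).
have cl (F G : plane -> R) : continuous F -> continuous G ->
    continuous (fun x : plane => c * F x + d * G x) by move=> cF cG; cts.
split.
- exact: cl.
- by apply: suppD; exact: suppZ.
- by move=> i; have [c1 c2] := cV' i; have [c3 c4] := cU' i; split; exact: cl.
- by move=> i; have [d1 d2] := dV i; have [d3 d4] := dU i; split; apply: DD; exact: DZ.
- by move=> x; rewrite WE ZE; ring.
Qed.

Lemma C2c_widen L L' V W : L <= L' -> C2c L V W -> C2c L' V W.
Proof.
move=> LL' [V' [V'' [cV sV cV' dV WE]]]; exists V', V''; split=> //.
exact: supp_widen LL' sV.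
Qed.

Lemma C2c0 L : C2c L (fun=> 0) (fun=> 0).
Proof.
exists (fun _ _ => 0), (fun _ _ => 0); split => //.
- exact: ctsC.
- by split; exact: ctsC.
- by split; exact: Dcst.
- by move=> x; rewrite addr0.
Qed.

Lemma C2c_sum L n (V : nat -> plane -> R) : (forall k, exists W, C2c L (V k) W) ->
  exists W, C2c L (fun x => \sum_(k < n) V k x) W.
Proof.
move=> h; elim: n => [|n [W IH]].
  by exists (fun=> 0); under eq_fun do rewrite big_ord0; exact: C2c0.
have [Z hZ] := h n; exists (fun x => 1 * W x + 1 * Z x).
under eq_fun do rewrite big_ord_recr /= -[X in X + _]mul1r -[X in _ + X]mul1r.
exact: C2c_lin.
Qed.

Lemma C2c_lap L V W : C2c L V W -> [/\ continuous V, supp L V, continuous W, supp L W & Int W = 0].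
Proof.
move=> [V' [V'' [cV sV cV' dV WE]]].
have sV' i : supp L (V' i) by apply: D_supp (dV i).1 sV.
have sV'' i : supp L (V'' i) by apply: D_supp (dV i).2 (sV' i).
have -> : W = fun x => V'' false x + V'' true x by apply/funext.
split=> //.
- by apply: ctsD; exact: (cV' _).2.
- by apply: suppD.
- rewrite IntD; [|exact: (L1_supp (cV' _).2 (sV'' _))..].
  by rewrite !(Int_D (cV' _).1 (cV' _).2 (sV' _) (dV _).2) addr0.
Qed.

Lemma C2c_tensor L (f f' f'' g g' g'' : R -> R) :
  (forall s, is_derive s (1 : R) f (f' s)) -> (forall s, is_derive s (1 : R) f' (f'' s)) ->
  continuous f'' ->
  (forall s, is_derive s (1 : R) g (g' s)) -> (forall s, is_derive s (1 : R) g' (g'' s)) ->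
  continuous g'' ->
  (forall s, L < `|s| -> f s = 0) -> (forall s, L < `|s| -> g s = 0) ->
  exists W, C2c L (fun x => f x.1 * g x.2) W.
Proof.
move=> df df' cf'' dg dg' cg'' sf sg.
have cf := derive_continuous df; have cf' := derive_continuous df'.
have cg := derive_continuous dg; have cg' := derive_continuous dg'.
exists (fun x => f'' x.1 * g x.2 + f x.1 * g'' x.2).
exists (fun i x => if i then f x.1 * g' x.2 else f' x.1 * g x.2).
exists (fun i x => if i then f x.1 * g'' x.2 else f'' x.1 * g x.2).
have c (F G : R -> R) : continuous F -> continuous G ->
  continuous (fun x : plane => F x.1 * G x.2) by move=> cF cG; cts.
have d1 (F F' G : R -> R) : (forall s, is_derive s (1 : R) F (F' s)) ->
    D false (fun x : plane => F x.1 * G x.2) (fun x => F' x.1 * G x.2).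
  move=> dF x.
  have := is_deriveM_val (dF x.1) (is_derive_cst (G x.2) x.1 (1:R)).
  by rewrite mulr0 addr0.
have d2 (F G G' : R -> R) : (forall s, is_derive s (1 : R) G (G' s)) ->
    D true (fun x : plane => F x.1 * G x.2) (fun x => F x.1 * G' x.2).
  move=> dG x.
  have := is_deriveM_val (is_derive_cst (F x.1) x.2 (1:R)) (dG x.2).
  by rewrite mul0r add0r.
split.
- exact: c.
- move=> x; rewrite negb_and -!ltNge => /orP[/sf ->|/sg ->]; by rewrite ?mul0r ?mulr0.
- by case; split; exact: c.
- by case; split; [exact: d2|exact: d2|exact: d1|exact: d1].
- by move=> x.
Qed.

Lemma is_derive_affine (F F' : R -> R) (b c y : R) :
  (forall z, is_derive z (1 : R) F (F' z)) ->
  is_derive y (1 : R) (fun z => F (b * z + c)) (b * F' (b * y + c)).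
Proof.
move=> dF.
have h1 : is_derive y (1 : R) (fun z => b * z + c) b.
  have := is_deriveD_val (is_deriveM_val (is_derive_cst b y (1:R)) (is_derive_id y (1:R)))
    (is_derive_cst c y (1:R)).
  by rewrite mul0r add0r mulr1 addr0.
by have := is_derive_comp_val h1 (dF _); rewrite mulrC.
Qed.

(* [step 3 / 6] is the integrated quadratic B-spline, a nondecreasing C^2 step from 0 to 1 on [0, 3]. *)
Definition step n (s : R) : R :=
  pospow n s - 3 * pospow n (1 * s + -1) + 3 * pospow n (1 * s + -2) - pospow n (1 * s + -3).

Lemma is_derive_step n s : is_derive s (1 : R) (step n.+2) (n.+2%:R * step n.+1 s).
Proof.
have h c : is_derive s (1 : R) (fun z => pospow n.+2 (1 * z + c)) (n.+2%:R * pospow n.+1 (1 * s + c)).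
  have := is_derive_affine 1 c s (fun z => is_derive_pospow n z); by rewrite mul1r.
have h3 c : is_derive s (1 : R) (fun z => 3 * pospow n.+2 (1 * z + c)) (3 * (n.+2%:R * pospow n.+1 (1 * s + c))).
  have := is_deriveM_val (is_derive_cst (3:R) s (1:R)) (h c); by rewrite mul0r add0r.
have := is_deriveB (is_deriveD (is_deriveB (is_derive_pospow n s) (h3 (-1))) (h3 (-2))) (h (-3)).
by move/is_derive_eq; apply; rewrite /step; ring.
Qed.

Lemma continuous_step n : continuous (step n).
Proof.
have c d : continuous (fun s : R => pospow n (1 * s + d)).
  apply: (@cts_comp _ _ _ (fun s : R => 1 * s + d) (pospow n)); last exact: continuous_pospow.
  by cts.
by rewrite /step; cts_with ltac:(first [exact: c|exact: continuous_pospow]).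
Qed.

Lemma step3_le0 s : s <= 0 -> step 3 s = 0.
Proof. by move=> s0; rewrite /step !pospow0 ?mulr0 ?subr0 ?addr0 ?subrr//; lra. Qed.

Lemma step3_ge3 s : 3 <= s -> step 3 s = 6.
Proof. by move=> s0; rewrite /step !pospowE; [ring|lra..]. Qed.

Lemma step2_ge0 s : 0 <= step 2 s.
Proof.
rewrite /step mul1r.
have [s0|s0] := leP s 0; first by rewrite !pospow0 ?mulr0 ?subr0 ?addr0 ?subrr//; lra.
rewrite (pospowE _ (ltW s0)).
have [s1|s1] := leP s 1; first by rewrite !pospow0 ?mulr0 ?subr0 ?addr0 ?subrr ?sqr_ge0//; lra.
rewrite (_ : pospow 2 (s + -1) = (s + -1) ^+ 2); last by rewrite pospowE//; lra.
have [s2|s2] := leP s 2.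
  by rewrite !pospow0; [nra|lra..].
rewrite (_ : pospow 2 (s + -2) = (s + -2) ^+ 2); last by rewrite pospowE//; lra.
have [s3|s3] := leP s 3.
  by rewrite !pospow0; [nra|lra..].
by rewrite pospowE; [nra|lra].
Qed.

Lemma step3_homo s t : s <= t -> step 3 s <= step 3 t.
Proof.
rewrite le_eqVlt => /predU1P[->//|st].
have [c _ h] := mean_value st (is_derive_step 1).
rewrite -subr_ge0 h mulr_ge0//; last by rewrite subr_ge0 ltW.
by rewrite mulr_ge0// step2_ge0.
Qed.

(** [bump 3] is six times the cubic B-spline on [0, 4]. As a difference of consecutive steps, its
    integer translates telescope to the constant 6: a C^2 partition of unity up to that factor. *)
Definition bump n (s : R) : R := step n (1 * s + 0) - step n (1 * s + -1).

Lemma is_derive_bump n s : is_derive s (1 : R) (bump n.+2) (n.+2%:R * bump n.+1 s).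
Proof.
have h c : is_derive s (1 : R) (fun z => step n.+2 (1 * z + c)) (n.+2%:R * step n.+1 (1 * s + c)).
  have := is_derive_affine 1 c s (is_derive_step n); by rewrite mul1r.
have := is_deriveB (h 0) (h (-1)).
by move/is_derive_eq; apply; rewrite /bump; ring.
Qed.

Lemma continuous_bump n : continuous (bump n).
Proof.
have c d : continuous (fun s : R => step n (1 * s + d)).
  apply: (@cts_comp _ _ _ (fun s : R => 1 * s + d) (step n)); last exact: continuous_step.
  by cts.
by rewrite /bump; cts_with ltac:(exact: c).
Qed.

Lemma bump_ge0 s : 0 <= bump 3 s.
Proof. by rewrite subr_ge0 step3_homo//; lra. Qed.

Lemma bump_supp s : s <= 0 \/ 4 <= s -> bump 3 s = 0.
Proof.
case=> h; first by rewrite /bump !step3_le0 ?subrr//; lra.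
by rewrite /bump !step3_ge3 ?subrr//; lra.
Qed.

Lemma sum_bump (n : nat) (t : R) : 3 - n%:R <= t -> t <= n%:R ->
  \sum_(k < n.*2) bump 3 (t + n%:R - k%:R) = 6.
Proof.
move=> t1 t2.
rewrite -(big_mkord xpredT (fun k => bump 3 (t + n%:R - k%:R))).
rewrite (eq_bigr (fun k => - (step 3 (t + n%:R - k.+1%:R) - step 3 (t + n%:R - k%:R)))); last first.
  move=> k _; rewrite /bump !mul1r addr0 [RHS]opprB.
  by congr (step 3 _ - step 3 _); rewrite -natr1; ring.
rewrite sumrN (telescope_sumr (fun k => step 3 (t + n%:R - k%:R)))//.
rewrite subr0 [step 3 (t + n%:R)]step3_ge3; last lra.
by rewrite step3_le0 ?sub0r ?opprK// -muln2 natrM; lra.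
Qed.

(** [V] blends the samples of [H] on a grid of mesh [r] with products of bumps. The factor 36 = 6 *
    6 normalises the partition of unity, and the error is at most the oscillation of [H] over one
    bump. *)
Lemma C2c_approx (H : plane -> R) L e : continuous H -> supp L H -> 0 < e -> 0 < L ->
  exists V W, C2c (L + 1) V W /\ forall x, `|H x - V x| <= e.
Proof.
move=> cH sH e0 L0.
have [d d0 hd] := supp_uniform_continuous cH sH e0.
(* A bump has width [4 * r]. This has to stay below the modulus of continuity [d] and below 1, by
   which the support may grow. *)
pose r := Num.min d 1 / 5.
have m0 : 0 < Num.min d 1 by rewrite lt_min d0 ltr01.
have r0 : 0 < r by rewrite divr_gt0.
have r1 : 4 * r < 1.
  have : Num.min d 1 <= 1 by rewrite ge_min lexx orbT.
  by rewrite /r; lra.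
have rd : 4 * r < d.
  have : Num.min d 1 <= d by rewrite ge_min lexx.
  by rewrite /r; lra.
(* Large enough for [sum_bump] to apply at every point of the box [L + 1]; the 3 is the width over
   which a step rises. *)
pose n := (Num.trunc ((L + 1) / r + 3)).+1.
have hn : (L + 1) / r + 3 < n%:R.
  by rewrite truncnS_gt.
pose gp (k : nat) : R := r * (k%:R - n%:R).
pose b (k : nat) (s : R) : R := bump 3 (r^-1 * s + (n%:R - k%:R)).
have b0 k s : 0 <= b k s by exact: bump_ge0.
have bs k s : ~ (gp k < s < gp k + 4 * r) -> b k s = 0.
  move=> h; apply: bump_supp.
  have [h1|h1] := leP s (gp k).
    left; rewrite -(ler_pM2l r0) mulr0 mulrDr mulrA divff ?gt_eqF// mul1r.
    by move: h1; rewrite /gp; lra.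
  right; rewrite -(ler_pM2l r0) [X in _ <= X]mulrDr mulrA divff ?gt_eqF// mul1r.
  rewrite leNgt; apply/negP => h2; apply: h; rewrite h1/= /gp; lra.
have sb s : `|s| <= L + 1 -> \sum_(k < n.*2) b k s = 6.
  rewrite ler_norml => /andP[s1 s2].
  rewrite -(@sum_bump n (r^-1 * s)).
  - by apply: eq_bigr => k _; rewrite /b addrA.
  - rewrite -(ler_pM2l r0) mulrA divff ?gt_eqF// mul1r.
    move: hn; rewrite -(ltr_pM2l r0) mulrDr mulrCA divff ?gt_eqF//; lra.
  - rewrite -(ler_pM2l r0) mulrA divff ?gt_eqF// mul1r.
    move: hn; rewrite -(ltr_pM2l r0) mulrDr mulrCA divff ?gt_eqF//; lra.
have dist k s : b k s != 0 -> `|s - gp k| < 4 * r.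
  move=> h; rewrite ltr_norml; have [//|] := pselect (gp k < s < gp k + 4 * r).
    by move=> /andP[h1 h2]; apply/andP; split; lra.
  by move=> /bs h'; rewrite h' eqxx in h.
pose V x := \sum_(k < n.*2) \sum_(l < n.*2)
   (H (gp k, gp l) / 36) * (b k x.1 * b l x.2).
pose T k l (x : plane) := (H (gp k, gp l) / 36) * (b k x.1 * b l x.2).
have farT k l x : ~~ inbox (L + 1) x -> T k l x = 0.
  move=> xL; rewrite /T.
  have [->|/dist h1] := eqVneq (b k x.1) 0; first by rewrite mul0r mulr0.
  have [->|/dist h2] := eqVneq (b l x.2) 0; first by rewrite !mulr0.
  rewrite sH ?mul0r// negb_and -!ltNge /=.
  move: xL; rewrite negb_and -!ltNge => /orP[]h; apply/orP; [left|right].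
    by have := lerB_dist x.1 (gp k); lra.
  by have := lerB_dist x.2 (gp l); lra.
have hT k l : exists W, C2c (L + 1) (T k l) W.
  have C m : continuous (fun s : R => r^-1 * (3%:R * (r^-1 * (2%:R * bump 1 (r^-1 * s + (n%:R - m%:R)))))).
    have C1 : continuous (fun s : R => bump 1 (r^-1 * s + (n%:R - m%:R))).
      apply: (@cts_comp _ _ _ (fun s : R => r^-1 * s + (n%:R - m%:R)) (bump 1)); last exact: continuous_bump.
      by cts.
    by apply: ctsM; [exact: ctsC|apply: ctsM; [exact: ctsC|apply: ctsM; [exact: ctsC|apply: ctsM; [exact: ctsC|exact: C1]]]].
  have d1 m s : is_derive s (1 : R) (b m) (r^-1 * (3%:R * bump 2 (r^-1 * s + (n%:R - m%:R)))).
    exact: (is_derive_affine _ _ _ (is_derive_bump 1)).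
  have d2 m s : is_derive s (1 : R) (fun s => r^-1 * (3%:R * bump 2 (r^-1 * s + (n%:R - m%:R))))
      (r^-1 * (3%:R * (r^-1 * (2%:R * bump 1 (r^-1 * s + (n%:R - m%:R)))))).
    have h0 := is_derive_affine r^-1 (n%:R - m%:R) s (is_derive_bump 0).
    have h1 := is_deriveM_val (is_derive_cst (3%:R : R) s (1:R)) h0.
    have h2 := is_deriveM_val (is_derive_cst (r^-1 : R) s (1:R)) h1.
    by move: h2; rewrite !mul0r !add0r.
  (* A node outside the box [L] carries the sample 0, and a bump at a node inside reaches less than
     1 beyond it. *)
  have [] := pselect (inbox L (gp k, gp l)); last first.
    move=> /negP hL; exists (fun=> 0).
    rewrite (_ : T k l = fun=> 0); first exact: C2c0.
    by apply/funext => x; rewrite /T sH// !mul0r.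
  move=> /andP[/= g1 g2].
  have sm m s : `|gp m| <= L -> L + 1 < `|s| -> b m s = 0.
    move=> h1 h2; have [//|/dist h] := eqVneq (b m s) 0.
    by have := lerB_dist s (gp m); lra.
  have [W hW] := C2c_tensor (d1 k) (d2 k) (C k) (d1 l) (d2 l) (C l)
    (fun s => sm k s g1) (fun s => sm l s g2).
  exists (fun x => (H (gp k, gp l) / 36) * W x + 0 * W x).
  have := C2c_lin (H (gp k, gp l) / 36) 0 hW hW.
  congr (C2c _ _ _); apply/funext => x; by rewrite mul0r addr0.
have [W hW] : exists W, C2c (L + 1) V W.
  apply: (@C2c_sum _ _ (fun k x => \sum_(l < n.*2) T k l x)) => k.
  exact: C2c_sum.
exists V, W; split => // x.
have [xL|xL] := boolP (inbox (L + 1) x); last first.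
  rewrite sH; last first.
    apply: contra xL; rewrite /inbox => /andP[h1 h2]; apply/andP; split; lra.
  rewrite /V big1 ?subrr ?normr0 ?ltW// => k _.
  by rewrite big1// => l _; exact: farT.
have /andP[x1 x2] := xL.
(* [H x] and [e] are both expanded in the partition of unity, which reduces the estimate to one term
   at a time. *)
have HE : H x = \sum_(k < n.*2) \sum_(l < n.*2) (H x / 36) * (b k x.1 * b l x.2).
  under eq_bigr do (rewrite -mulr_sumr; under eq_bigr do idtac; rewrite -mulr_sumr sb//).
  rewrite -mulr_sumr -mulr_suml sb//; lra.
have EE : e = \sum_(k < n.*2) \sum_(l < n.*2) (e / 36) * (b k x.1 * b l x.2).
  under eq_bigr do (rewrite -mulr_sumr; under eq_bigr do idtac; rewrite -mulr_sumr sb//).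
  rewrite -mulr_sumr -mulr_suml sb//; lra.
rewrite HE /V -sumrB [leRHS]EE (le_trans (ler_norm_sum _ _ _))//; apply: ler_sum => k _.
rewrite -sumrB (le_trans (ler_norm_sum _ _ _))//; apply: ler_sum => l _.
rewrite -!mulrBl !normrM [`|36^-1|]ger0_norm ?invr_ge0// !(ger0_norm (b0 _ _)).
have [->|/dist h1] := eqVneq (b k x.1) 0; first by rewrite !(mul0r, mulr0).
have [->|/dist h2] := eqVneq (b l x.2) 0; first by rewrite !(mul0r, mulr0).
rewrite ler_wpM2r// ?mulr_ge0// ler_wpM2r// ?invr_ge0// ltW//.
by apply: hd; split; rewrite /ball/=; apply: lt_trans rd.
Qed.

End CompactlySupportedC2.

Section PointwiseLaplacian.
Context {R : realType}.
Local Notation plane := (R * R)%type.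
Implicit Types (V W F G : plane -> R) (i j : bool).

Lemma tonelli_le (f : plane -> R) (F : R -> R) (c : R) :
  measurable_fun setT f -> (forall x, 0 <= f x) -> measurable_fun setT F ->
  (forall y, \int[@lebesgue_measure R]_x (f (x, y))%:E <= (F y)%:E)%E ->
  (\int[@lebesgue_measure R]_y (F y)%:E <= c%:E)%E -> L1 f /\ Int f <= c.
Proof.
move=> mf f0 mF fF Fc; apply: Int_fine_le => //.
have mf' : measurable_fun setT (fun x : plane => (f x)%:E) by exact/measurable_EFinP.
have f0' x : (0 <= (f x)%:E)%E by rewrite lee_fin.
have -> : (\int[@leb2 R]_x (f x)%:E = \int[@lebesgue_measure R]_y
    fubini_G (@lebesgue_measure R) (fun x : plane => (f x)%:E) y)%E.
  rewrite /leb2; exact: (@fubini_tonelli2 _ _ _ _ R (@lebesgue_measure R) (@lebesgue_measure R) (fun x : plane => (f x)%:E) mf' f0').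
apply: le_trans Fc.
apply: ge0_le_integral => //.
- by move=> y _; exact: integral_ge0.
- exact: (@measurable_fun_fubini_tonelli_G _ _ _ _ R (@lebesgue_measure R) (fun x : plane => (f x)%:E) mf' f0').
- exact/measurable_EFinP.
- by move=> y _; exact: fF.
Qed.

(** Sum over the four neighbours at distance [h]: [(nb h V - 4 V) / h ^ 2] is the five-point
    Laplacian, acting on functions of the whole plane rather than on a grid. *)
Definition nb h V (x : plane) :=
  V (shiftc false h x) + V (shiftc false (- h) x) + V (shiftc true h x) + V (shiftc true (- h) x).

Lemma C2c_nb h L V W : 0 <= h -> C2c L V W -> C2c (L + h) (nb h V) (nb h W).
Proof.
move=> h0 cV.
have c i (s : R) : `|s| = h -> C2c (L + h) (V \o shiftc i s) (W \o shiftc i s).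
  by move=> <-; exact: C2c_shiftc.
have c1 := c false h (ger0_norm h0); have c2 := c true h (ger0_norm h0).
have c3 : C2c (L + h) (V \o shiftc false (- h)) (W \o shiftc false (- h)).
  by apply: c; rewrite normrN ger0_norm.
have c4 : C2c (L + h) (V \o shiftc true (- h)) (W \o shiftc true (- h)).
  by apply: c; rewrite normrN ger0_norm.
have := C2c_lin 1 1 (C2c_lin 1 1 (C2c_lin 1 1 c1 c3) c2) c4.
by congr (C2c _ _ _); apply/funext => x; rewrite /nb /= !mul1r.
Qed.

Lemma nb_le h V W (x : plane) : (forall y, V y <= W y) -> nb h V x <= nb h W x.
Proof. by move=> VW; rewrite !lerD. Qed.

Lemma C2c_consistent L V W e : C2c L V W -> 0 < e ->
  exists2 h, 0 < h <= 1 & forall x, `|W x - (nb h V x - 4 * V x) / h ^+ 2| <= e.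
Proof.
move=> [V' [V'' [cV sV cV' dV WE]]] e0.
have sV'' i : supp L (V'' i) by apply: D_supp (dV i).2 (D_supp (dV i).1 sV).
have e2 : 0 < e / 2 by rewrite divr_gt0.
have [d1 d10 hd1] := supp_uniform_continuous (cV' false).2 (sV'' false) e2.
have [d2 d20 hd2] := supp_uniform_continuous (cV' true).2 (sV'' true) e2.
pose h := Num.min 1 (Num.min d1 d2).
have h0 : 0 < h by rewrite !lt_min ltr01 d10 d20.
exists h; first by rewrite h0 ge_min lexx.
move=> x.
have hd1' : h <= d1 by rewrite !ge_min lexx !orbT.
have hd2' : h <= d2 by rewrite !ge_min lexx !orbT.
have [a ax Ea] := @second_difference R (fun s => V (s, x.2)) (fun s => V' false (s, x.2))
  (fun s => V'' false (s, x.2)) x.1 h h0 (fun y => (dV false).1 (y, x.2)) (fun y => (dV false).2 (y, x.2)).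
have [b bx Eb] := @second_difference R (fun s => V (x.1, s)) (fun s => V' true (x.1, s))
  (fun s => V'' true (x.1, s)) x.2 h h0 (fun y => (dV true).1 (x.1, y)) (fun y => (dV true).2 (x.1, y)).
have -> : (nb h V x - 4 * V x) / h ^+ 2 = V'' false (a, x.2) + V'' true (x.1, b).
  rewrite (_ : nb h V x - 4 * V x = h ^+ 2 * (V'' false (a, x.2) + V'' true (x.1, b))).
    by rewrite mulrC mulKf// expf_neq0// gt_eqF.
  rewrite mulrDr -Ea -Eb -surjective_pairing /nb /shiftc /=; ring.
rewrite WE (_ : _ - _ = (V'' false x - V'' false (a, x.2)) + (V'' true x - V'' true (x.1, b))); last by ring.
rewrite (le_trans (ler_normD _ _))// [e]splitr lerD// ltW//.
  apply: hd1; split; rewrite /ball/= ?subrr ?normr0//; rewrite distrC; exact: lt_le_trans hd1'.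
apply: hd2; split; rewrite /ball/= ?subrr ?normr0//; rewrite distrC; exact: lt_le_trans hd2'.
Qed.

(** [wt] is positive, integrable and satisfies [wt - lap wt >= wt / 2], also for the five-point
    Laplacian with step at most 1. The constant 49 is large enough to make the curvature of [wt1] at
    most a quarter of its size, and it is the square of 7, so the arctangent integral gives its
    mass. *)
Definition wt1 (s : R) : R := (s ^+ 2 + 49)^-1.
Definition wt (x : plane) : R := wt1 x.1 * wt1 x.2.

Lemma wt1_den (s : R) : 0 < s ^+ 2 + 49.
Proof. by rewrite ltr_wpDl// sqr_ge0. Qed.

Lemma wt1_gt0 s : 0 < wt1 s.
Proof. by rewrite invr_gt0 wt1_den. Qed.

Lemma wt_gt0 x : 0 < wt x.
Proof. by rewrite mulr_gt0// wt1_gt0. Qed.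

Lemma wt1_difference h s : 0 < h <= 1 ->
  wt1 (s + h) + wt1 (s - h) <= (2 + h ^+ 2 / 4) * wt1 s.
Proof.
move=> /andP[h0 h1]; rewrite /wt1.
have p := wt1_den s; have q1 := wt1_den (s + h); have q2 := wt1_den (s - h).
rewrite -(ler_pM2r p) -mulrA mulVf ?gt_eqF// mulr1.
rewrite -(ler_pM2r (mulr_gt0 q1 q2)).
rewrite [leLHS](_ : _ = (s ^+ 2 + 49) * ((s - h) ^+ 2 + 49 + ((s + h) ^+ 2 + 49))); last first.
  by field; rewrite !gt_eqF.
have u0 : 0 <= h ^+ 2 by rewrite sqr_ge0.
have u1 : h ^+ 2 <= 1 by rewrite expr_le1// ltW.
rewrite -subr_ge0 [X in 0 <= X](_ : _ = h ^+ 2 * ((s ^+ 2 + 49) ^+ 2 / 4 - 6 * (s ^+ 2 + 49)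
  - h ^+ 2 * (s ^+ 2 + 49) / 2 + 392 + 51 * h ^+ 2 + (h ^+ 2) ^+ 2 / 4)); last by field.
apply: mulr_ge0; first exact: u0.
move: (h ^+ 2) u0 u1 (s ^+ 2 + 49) p => u u0 u1 A A0.
have : u * A <= A by rewrite ler_piMl// ltW.
have := sqr_ge0 (A - 13); have := sqr_ge0 u.
by rewrite !expr2; nra.
Qed.

Lemma wt_nb h x : 0 < h <= 1 -> nb h wt x <= (4 + h ^+ 2 / 2) * wt x.
Proof.
move=> h1; rewrite /nb /wt /shiftc /=.
have := wt1_difference x.1 h1; have := wt1_difference x.2 h1.
move: (wt1_gt0 x.1) (wt1_gt0 x.2); move: (wt1 (x.1 + h)) (wt1 (x.1 - h)) (wt1 (x.2 + h)) (wt1 (x.2 - h)) (wt1 x.1) (wt1 x.2) => a b c d p q p0 q0 H1 H2.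
have := ler_wpM2r (ltW q0) H2; have := ler_wpM2l (ltW p0) H1.
by rewrite !mulrDl !mulrDr; lra.
Qed.

(* A classical solution only has a continuous Laplacian: the separate second derivatives need be neither
   continuous nor integrable, so [Int_lap0] below cannot be obtained by integrating by parts twice. *)
Definition lapP F G := exists F' F'' : bool -> plane -> R,
  (forall i, D i F (F' i) /\ D i (F' i) (F'' i)) /\ forall x, G x = F'' false x + F'' true x.

Lemma C2c_lapP L V W : C2c L V W -> lapP V W.
Proof. by move=> [V' [V'' [cV sV cV' dV WE]]]; exists V', V''. Qed.

Lemma lapP_lin c d V W F G : lapP V W -> lapP F G ->
  lapP (fun x => c * V x + d * F x) (fun x => c * W x + d * G x).
Proof.
move=> [V' [V'' [dV WE]]] [U' [U'' [dU ZE]]].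
exists (fun i x => c * V' i x + d * U' i x), (fun i x => c * V'' i x + d * U'' i x).
split=> [i|x]; last by rewrite WE ZE; ring.
by have [d1 d2] := dV i; have [d3 d4] := dU i; split; apply: DD; exact: DZ.
Qed.

Lemma is_derive_wt1 s : is_derive s (1 : R) wt1 (- (2 * s) * wt1 s ^+ 2).
Proof.
have h : is_derive s (1:R) (fun s : R => s ^+ 2 + 49) (2 * s).
  have := is_deriveD_val (is_derive_exp 1 s) (is_derive_cst (49:R) s (1:R)).
  by rewrite addr0 expr1.
have n0 : s ^+ 2 + 49 != 0 by rewrite gt_eqF// wt1_den.
have H := is_derive_inv (F := fun s : R => s ^+ 2 + 49) n0 h.
apply: (is_derive_eq H); rewrite /wt1 -exprVn; ring.
Qed.

Lemma is_derive_wt1' s : is_derive s (1 : R) (fun s => - (2 * s) * wt1 s ^+ 2)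
  (- 2 * wt1 s ^+ 2 + 8 * s ^+ 2 * wt1 s ^+ 3).
Proof.
have h1 : is_derive s (1:R) (fun s : R => - (2 * s)) (- 2).
  have := is_deriveN (is_deriveM_val (is_derive_cst (2:R) s (1:R)) (is_derive_id s (1:R))).
  by rewrite mul0r add0r mulr1.
have := is_deriveM_val h1 (is_derive_comp_val (is_derive_wt1 s) (is_derive_exp 1 (wt1 s))).
by move/is_derive_eq; apply; ring.
Qed.

Lemma continuous_wt1 : continuous wt1.
Proof. exact: (derive_continuous is_derive_wt1). Qed.

Lemma continuous_wt : continuous wt.
Proof. by rewrite /wt; cts_with ltac:(exact: continuous_wt1). Qed.

Lemma wt1''_le s : - 2 * wt1 s ^+ 2 + 8 * s ^+ 2 * wt1 s ^+ 3 <= wt1 s / 4.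
Proof.
rewrite /wt1 -subr_ge0; have p := wt1_den s.
rewrite [X in 0 <= X](_ : _ = ((s ^+ 2 + 49) ^+ 2 / 4 - 6 * (s ^+ 2 + 49) + 392) * wt1 s ^+ 3).
  apply: mulr_ge0; last by rewrite exprn_ge0// ltW// wt1_gt0.
  by have := sqr_ge0 (s ^+ 2 + 49 - 12); rewrite !expr2; nra.
by rewrite /wt1; field; rewrite gt_eqF.
Qed.

Lemma lapP_wt : exists2 W, lapP wt W & forall x, W x <= wt x / 2.
Proof.
pose k s : R := - 2 * wt1 s ^+ 2 + 8 * s ^+ 2 * wt1 s ^+ 3.
pose k' s : R := - (2 * s) * wt1 s ^+ 2.
exists (fun x => k x.1 * wt1 x.2 + wt1 x.1 * k x.2).
  exists (fun i x => if i then wt1 x.1 * k' x.2 else k' x.1 * wt1 x.2),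
    (fun i x => if i then wt1 x.1 * k x.2 else k x.1 * wt1 x.2).
  split=> // i; split => x; case: i => /=.
  - have := is_deriveM_val (is_derive_cst (wt1 x.1) x.2 (1:R)) (is_derive_wt1 x.2).
    by rewrite mul0r add0r.
  - have := is_deriveM_val (is_derive_wt1 x.1) (is_derive_cst (wt1 x.2) x.1 (1:R)).
    by rewrite mulr0 addr0.
  - have := is_deriveM_val (is_derive_cst (wt1 x.1) x.2 (1:R)) (is_derive_wt1' x.2).
    by rewrite mul0r add0r.
  - have := is_deriveM_val (is_derive_wt1' x.1) (is_derive_cst (wt1 x.2) x.1 (1:R)).
    by rewrite mulr0 addr0.
move=> x; rewrite /wt.
have := ler_wpM2r (ltW (wt1_gt0 x.2)) (wt1''_le x.1).
have := ler_wpM2l (ltW (wt1_gt0 x.1)) (wt1''_le x.2).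
by rewrite -/(k _) -/(k _); lra.
Qed.

Lemma L1_wt : L1 wt.
Proof.
have w0 := wt1_gt0.
have wtI : (\int[@lebesgue_measure R]_x (wt1 x)%:E <= (pi / 7)%:E)%E.
  have h7 : (0 : R) < 7 by [].
  apply: le_trans (integral_inv_sq 0 h7); rewrite le_eqVlt; apply/orP; left; apply/eqP.
  by apply: eq_integral => y _; rewrite subr0 /wt1; congr (_^-1)%:E; ring.
have E c : (\int[@lebesgue_measure R]_x (wt1 x * wt1 c)%:E <= (pi / 7 * wt1 c)%:E)%E.
  under eq_integral do rewrite EFinM.
  rewrite ge0_integralZr//.
  - rewrite [X in (_ <= X)%E]EFinM; apply: lee_wpmul2r; first by rewrite lee_fin ltW.
    exact: wtI.
  - apply/measurable_EFinP; apply: continuous_measurable_fun; exact: continuous_wt1.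
  - by move=> x _; rewrite lee_fin ltW.
  - by rewrite lee_fin ltW.
have [] // := @tonelli_le wt (fun y => pi / 7 * wt1 y) (pi / 7 * (pi / 7)).
- by apply: continuous_measurable_plane; exact: continuous_wt.
- by move=> x; rewrite ltW// wt_gt0.
- by apply: continuous_measurable_fun; cts_with ltac:(exact: continuous_wt1).
- have p0 : 0 <= pi / 7 :> R by rewrite divr_ge0// ltW// pi_gt0.
  under eq_integral do rewrite EFinM.
  rewrite ge0_integralZl//.
  - rewrite [X in (_ <= X)%E]EFinM; apply: lee_wpmul2l; first by rewrite lee_fin.
    exact: wtI.
  - apply/measurable_EFinP; apply: continuous_measurable_fun; exact: continuous_wt1.
  - by move=> x _; rewrite lee_fin ltW.
Qed.

(** At a positive maximum the second derivative along each axis is at most 0, hence [Z <= 0 < E]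
    there, against [E - Z <= 0]. Pointwise second derivatives are all that this argument sees. *)
Lemma max_principle L E Z : continuous E -> lapP E Z ->
  (forall x, ~~ inbox L x -> E x <= 0) -> (forall x, E x - Z x <= 0) ->
  forall x, E x <= 0.
Proof.
move=> cE [E' [E'' [dE ZE]]] sE hE x; rewrite leNgt; apply/negP => Ex.
have xL : inbox L x by apply/negPn/negP => /sE; rewrite leNgt Ex.
have h := @continuous_subspaceT _ _ [set x : plane | inbox L x] E cE.
have ne : [set x : plane | inbox L x] !=set0 by exists x.
have [c cL cmax] := @compact_EVT_max _ R E _ ne (@compact_inbox R L) h.
have Ec : 0 < E c by apply: lt_le_trans Ex _; apply: cmax; rewrite inE.
have gmax y : E y <= E c.
  have [yL|/sE] := boolP (inbox L y); first by apply: cmax; rewrite inE.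
  by move=> /le_trans; apply; exact: ltW.
have e1 : E'' false c <= 0.
  apply: (@second_derivative_max R (fun s => E (s, c.2)) (fun s => E' false (s, c.2)) _ c.1).
  - by move=> y; exact: ((dE false).1 (y, c.2)).
  - exact: ((dE false).2 c).
  - by move=> y; rewrite -surjective_pairing.
have e2 : E'' true c <= 0.
  apply: (@second_derivative_max R (fun s => E (c.1, s)) (fun s => E' true (c.1, s)) _ c.2).
  - by move=> y; exact: ((dE true).1 (c.1, y)).
  - exact: ((dE true).2 c).
  - by move=> y; rewrite -surjective_pairing.
by have := hE c; rewrite ZE; lra.
Qed.

(** [2 * e * wt] is a barrier, because [wt - lap wt >= wt / 2] makes its image under 1 - lap at
    least [e * wt]. *)
Lemma resolvent_compare L F G V W e : 0 <= e -> continuous F -> supp L F -> lapP F G ->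
  continuous V -> supp L V -> lapP V W ->
  (forall x, F x - G x - (V x - W x) <= e * wt x) -> forall x, F x - V x <= 2 * e * wt x.
Proof.
move=> e0 cF sF lF cV sV lV h x.
have [Z lZ hZ] := lapP_wt.
have l1 := lapP_lin 1 (-1) lF lV.
have l2 := lapP_lin 1 (- (2 * e)) l1 lZ.
have H : 1 * (1 * F x + -1 * V x) + - (2 * e) * wt x <= 0; last by lra.
apply: (max_principle (L := L) _ l2).
- by cts_with ltac:(exact: continuous_wt).
- move=> y yL; rewrite (sF _ yL) (sV _ yL).
  by have := mulr_ge0 e0 (ltW (wt_gt0 y)); lra.
- move=> y; have := h y; have := ler_wpM2l e0 (hZ y); lra.
Qed.

(* The resolvent equation V - lap V = H is solved approximately by the Jacobi iteration
   for the five-point Laplacian, started from a C^2 approximation of H; the weight wt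
   makes the iteration a contraction with an integrable error. *)
Lemma resolvent_approx L H e : 0 < L -> continuous H -> supp L H -> 0 < e ->
  exists L' V W, C2c L' V W /\ forall x, `|H x - (V x - W x)| <= e * wt x.
Proof.
move=> L0 cH sH e0.
(* A lower bound of [wt] on the box [L + 2], which contains the supports of [H], of its
   approximation and of the neighbour sums of the latter. It turns uniform errors into errors
   relative to [wt]. *)
pose c0 := ((L + 2) ^+ 2 + 49)^-1 ^+ 2.
have c00 : 0 < c0 by rewrite exprn_gt0// invr_gt0 wt1_den.
have wtc x : inbox (L + 2) x -> c0 <= wt x.
  move=> /andP[x1 x2]; rewrite /c0 expr2 /wt.
  have h s : `|s| <= L + 2 -> ((L + 2) ^+ 2 + 49)^-1 <= wt1 s.
    move=> sL; rewrite /wt1 lef_pV2 ?posrE ?wt1_den// lerD2r -(real_normK (num_real s)).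
    by rewrite ler_pXn2r// nnegrE//; lra.
  by apply: ler_pM; [rewrite invr_ge0 ltW// wt1_den|rewrite invr_ge0 ltW// wt1_den|exact: h|exact: h].
have pw c x : 0 <= c -> 0 <= c * wt x by move=> h; rewrite mulr_ge0// ltW// wt_gt0.
pose e1 := e / 4 * c0.
have e10 : 0 < e1 by rewrite /e1 mulr_gt0// divr_gt0.
have [U [Z [cU hU]]] := C2c_approx cH sH e10 L0.
have [h /andP[h0 h1] hh] := C2c_consistent cU e10.
have h01 : 0 < h <= 1 by rewrite h0.
have [contU sU _ sZ _] := C2c_lap cU.
have [_ sN _ _ _] := C2c_lap (C2c_nb (ltW h0) cU).
have le_wt (f : plane -> R) : (forall x, `|f x| <= e1) -> supp (L + 2) f -> forall x, `|f x| <= e / 4 * wt x.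
  move=> fe sf x; have [xL|xL] := boolP (inbox (L + 2) x).
    by rewrite (le_trans (fe x))// /e1 ler_wpM2l ?wtc// divr_ge0// ltW.
  by rewrite sf// normr0 pw// divr_ge0// ltW.
have HU : forall x, `|H x - U x| <= e / 4 * wt x.
  apply: le_wt => // x xL; rewrite (supp_widen _ sH xL) ?(supp_widen _ sU xL) ?subrr//; lra.
have hZ : forall x, `|Z x - (nb h U x - 4 * U x) / h ^+ 2| <= e / 4 * wt x.
  apply: le_wt => // x xL.
  rewrite (supp_widen _ sZ xL) ?(supp_widen _ sU xL) ?(supp_widen _ sN xL) ?mulr0 ?subr0 ?mul0r//; lra.
have [C C0 hC] : exists2 C, 0 <= C & forall x, `|U x| <= C * wt x.
  have [M M0 hM] := continuous_supp_bounded contU sU.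
  exists (M / c0); first by rewrite divr_ge0// ltW.
  move=> x; have [xL|xL] := boolP (inbox (L + 2) x).
    rewrite (le_trans (hM x))// -[leLHS]mulr1 -mulrA ler_wpM2l// mulrC ler_pdivlMr// mul1r.
    exact: wtc.
  have -> : U x = 0 by apply: (supp_widen _ sU xL); lra.
  by rewrite normr0 pw// divr_ge0// ltW.
have hp : 0 < h ^+ 2 by rewrite exprn_gt0.
pose a := 4 / h ^+ 2.
have a0 : 0 < a by rewrite divr_gt0.
(* In the norm weighted by [wt], [nb h / h ^ 2] has norm at most [a + 1 / 2] by [wt_nb]; the
   zeroth-order term of the resolvent contributes the 1 in [1 + a], hence [q < 1]. *)
pose q := (a + 2^-1) / (1 + a).
have a1 : 0 < 1 + a by rewrite addr_gt0.
have q0 : 0 <= q by rewrite divr_ge0//; lra.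
have q1 : q < 1 by rewrite ltr_pdivrMr// mul1r; lra.
have nb4 V B : (forall x, `|V x| <= B * wt x) -> 0 <= B ->
    forall x, `|nb h V x / h ^+ 2| <= (a + 2^-1) * (B * wt x).
  move=> VB B0 x; rewrite normrM [`|(h ^+ 2)^-1|]gtr0_norm ?invr_gt0// ler_pdivrMr//.
  have -> : (a + 2^-1) * (B * wt x) * h ^+ 2 = B * ((4 + h ^+ 2 / 2) * wt x).
    by rewrite /a; field; rewrite gt_eqF.
  apply: le_trans (ler_wpM2l B0 (wt_nb x h01)).
  have -> : B * nb h wt x = nb h (fun y => B * wt y) x by rewrite /nb; ring.
  rewrite ler_norml -(_ : nb h (fun y => - (B * wt y)) x = - nb h (fun y => B * wt y) x); last by rewrite /nb; ring.
  by rewrite !nb_le// => y; have := VB y; rewrite ler_norml => /andP[].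
(* The residual of the discrete resolvent equation with right-hand side [U]. *)
pose Res V x := U x - V x + (nb h V x - 4 * V x) / h ^+ 2.
have step k : exists L' V W, [/\ C2c L' V W,
    forall x, `|W x - (nb h V x - 4 * V x) / h ^+ 2| <= e / 2 * wt x &
    forall x, `|Res V x| <= C * q ^+ k * wt x].
  elim: k => [|k [L' [V [W [cV hV rV]]]]].
    exists L, (fun=> 0), (fun=> 0); split.
    - exact: C2c0.
    - by move=> x; rewrite /nb !addr0 !mulr0 subrr mul0r subrr normr0 pw// divr_ge0// ltW.
    - by move=> x; rewrite /Res /nb !addr0 !mulr0 !subr0 mul0r addr0 expr0 mulr1.
  pose L1 := Num.max (L + 1) (L' + h).
  have cU1 : C2c L1 U Z by apply: C2c_widen cU; rewrite le_max lexx.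
  have cV1 : C2c L1 (nb h V) (nb h W) by apply: C2c_widen (C2c_nb (ltW h0) cV); rewrite le_max lexx orbT.
  (* One Jacobi step: [(1 + a) V' = U + nb h V / h ^ 2]. The new residual is [nb h] of the old one,
     divided by [h ^ 2] and by [1 + a]. *)
  have cV' := C2c_lin (1 + a)^-1 ((1 + a)^-1 / h ^+ 2) cU1 cV1.
  set V' := (fun x => _) in cV'; set W' := (fun x => _) in cV'.
  exists L1, V', W'; split=> // x.
  (* The tolerance [e / 2] on the consistency error reproduces itself: e / 4 + (a + 1 / 2) e / 2 =
     (1 + a) e / 2. *)
  - have -> : W' x - (nb h V' x - 4 * V' x) / h ^+ 2 = (1 + a)^-1 *
        ((Z x - (nb h U x - 4 * U x) / h ^+ 2) +
         nb h (fun y => W y - (nb h V y - 4 * V y) / h ^+ 2) x / h ^+ 2).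
      rewrite /W' /V' /nb; ring.
    rewrite normrM gtr0_norm ?invr_gt0// mulrC ler_pdivrMr//.
    apply: le_trans (ler_normD _ _) _.
    have := nb4 _ _ hV ltac:(by rewrite divr_ge0// ltW) x.
    have := hZ x; have := wt_gt0 x; move: (wt x) => w w0; lra.
  - have -> : Res V' x = (1 + a)^-1 * (nb h (fun y => Res V y) x / h ^+ 2).
      have E y : Res V y = (1 + a) * (V' y - V y).
        rewrite /Res /V'.
        by rewrite /a; field; rewrite /= gt_eqF//= gt_eqF//; move: a1; rewrite -(pmulr_lgt0 _ hp) /a mulrDl mul1r divfK ?gt_eqF.
      have -> : nb h [eta Res V] x = (1 + a) * (nb h V' x - nb h V x) by rewrite /nb !E; ring.
      rewrite mulrA mulKf ?gt_eqF// /Res.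
      have -> : U x = (1 + a) * V' x - nb h V x / h ^+ 2.
        by rewrite /V' mulrDr !mulrA divff ?gt_eqF// !mul1r; ring.
      by rewrite /a; ring.
    rewrite normrM gtr0_norm ?invr_gt0// mulrC ler_pdivrMr//.
    apply: le_trans (nb4 _ (C * q ^+ k) rV _ x) _; first by rewrite mulr_ge0// exprn_ge0.
    rewrite exprS le_eqVlt; apply/orP; left; apply/eqP.
    by rewrite /q; field; rewrite gt_eqF.
have [k hk] : exists k, C * q ^+ k <= e / 4.
  have : (fun k => C * q ^+ k) @ \oo --> C * 0.
    by apply: cvgMr; apply: cvg_expr; rewrite ger0_norm.
  rewrite mulr0 => /(cvgr_le _) /(_ (e / 4) ltac:(by rewrite divr_gt0)) [k _ hk].
  by exists k; apply: (hk k) => /=.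
have [L' [V [W [cV hV rV]]]] := step k.
exists L', V, W; split => // x.
have -> : H x - (V x - W x) = (H x - U x) + Res V x + (W x - (nb h V x - 4 * V x) / h ^+ 2).
  by rewrite /Res; ring.
apply: le_trans (ler_normD _ _) _; apply: le_trans (lerD (ler_normD _ _) (lexx _)) _.
have := rV x; have := hV x; have := HU x; have := ler_wpM2r (ltW (wt_gt0 x)) hk.
lra.
Qed.

(** Approximate [F - G] by [V - W] with [V] of class C^2 and [W] its Laplacian, so that [Int W = 0].
    Comparison bounds [F - V] by [2 * e * wt], the residual is at most [e * wt], and the difference
    of the two has integral [Int G]. *)
Lemma Int_lap0 L F G : continuous F -> supp L F -> continuous G -> lapP F G -> Int G = 0.
Proof.
move=> cF sF cG lF.
pose K := Num.max L 1.
have K0 : 0 < K by rewrite lt_max ltr01 orbT.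
have sFK : supp K F by apply: supp_widen sF; rewrite le_max lexx.
have sGK : supp K G.
  have [F' [F'' [dF GE]]] := lF => x xL; rewrite GE.
  by rewrite !(D_supp (dF _).2 (D_supp (dF _).1 sFK) xL) addr0.
pose I := Int wt.
have I0 : 0 <= I by apply: Int_ge0 => x; rewrite ltW// wt_gt0.
suff H e : 0 < e -> `|Int G| <= 3 * e * I.
  apply/eqP; rewrite -normr_le0; apply/ler_addgt0Pr => e e0; rewrite add0r.
  have p : 0 < I + 1 by rewrite ltr_wpDl.
  apply: le_trans (H (e / (3 * (I + 1))) _) _; first by rewrite divr_gt0// mulr_gt0.
  rewrite (_ : 3 * _ * I = e * (I / (I + 1))); last by field; rewrite gt_eqF.
  rewrite -[leRHS]mulr1 ler_pM2l// ler_pdivrMr// mul1r; lra.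
move=> e0.
have cH : continuous (fun x => F x - G x) by cts.
have sH : supp K (fun x => F x - G x) by move=> x xL; rewrite sFK// sGK// subrr.
have [L' [V [W [cV hV]]]] := resolvent_approx K0 cH sH e0.
have [contV sV contW sW IW] := C2c_lap cV.
pose K' := Num.max K L'.
have sF' : supp K' F by apply: supp_widen sFK; rewrite le_max lexx.
have sG' : supp K' G by apply: supp_widen sGK; rewrite le_max lexx.
have sV' : supp K' V by apply: supp_widen sV; rewrite le_max lexx orbT.
have sW' : supp K' W by apply: supp_widen sW; rewrite le_max lexx orbT.
have lV := C2c_lapP cV.
have FV x : `|F x - V x| <= 2 * e * wt x.
  rewrite ler_norml lerNl opprB; apply/andP; split.
    apply: (resolvent_compare (ltW e0) contV sV' lV cF sF' lF) => y.
    by have := hV y; rewrite ler_norml => /andP[]; lra.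
  apply: (resolvent_compare (ltW e0) cF sF' lF contV sV' lV) => y.
  by have := hV y; rewrite ler_norml => /andP[]; lra.
have iF := L1_supp cF sF'; have iG := L1_supp cG sG'.
have iV := L1_supp contV sV'; have iW := L1_supp contW sW'.
have b1 : `|Int F - Int V| <= 2 * e * I.
  rewrite -IntB// -(IntZ _ L1_wt); apply: Int_abs_le => //.
  - by apply: continuous_measurable_plane; cts.
  - exact/L1Z/L1_wt.
have b2 : `|Int F - Int G - Int V| <= e * I.
  rewrite -[Int V]subr0 -IW -!IntB//; [|exact: L1B|exact: L1B].
  rewrite -(IntZ _ L1_wt); apply: Int_abs_le => //.
  - by apply: continuous_measurable_plane; cts.
  - exact/L1Z/L1_wt.
rewrite (_ : Int G = (Int F - Int V) - (Int F - Int G - Int V)); last by ring.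
by apply: le_trans (ler_normB _ _) _; lra.
Qed.

(** [Int_lap0] for [eta * f] kills the sum of the three terms of the product rule. A first-order
    integration by parts, legitimate because the gradient of [f] is continuous, relates the gradient
    term to the one with the Laplacian of [eta]. *)
Lemma Int_lap_parts L (f g : plane -> R) (f' f'' : bool -> plane -> R)
    (eta : plane -> R) (eta' eta'' : bool -> plane -> R) :
  continuous f -> (forall i, continuous (f' i)) -> continuous g ->
  (forall i, D i f (f' i) /\ D i (f' i) (f'' i)) -> (forall x, g x = f'' false x + f'' true x) ->
  continuous eta -> supp L eta -> (forall i, continuous (eta' i)) -> (forall i, continuous (eta'' i)) ->
  (forall i, D i eta (eta' i) /\ D i (eta' i) (eta'' i)) ->
  Int (fun x => eta x * g x) = Int (fun x => f x * (eta'' false x + eta'' true x)) /\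
  Int (fun x => eta x * g x) =
    - Int (fun x => eta' false x * f' false x + eta' true x * f' true x).
Proof.
move=> cf cf' cg df gE ce se ce' ce'' de.
have se' i : supp L (eta' i) := D_supp (de i).1 se.
have se'' i : supp L (eta'' i) := D_supp (de i).2 (se' i).
have lF : lapP (fun x => eta x * f x) (fun x => eta x * g x +
    2 * (eta' false x * f' false x + eta' true x * f' true x) + f x * (eta'' false x + eta'' true x)).
  exists (fun i x => eta' i x * f x + eta x * f' i x).
  exists (fun i x => (eta'' i x * f x + eta' i x * f' i x) + (eta' i x * f' i x + eta x * f'' i x)).
  split=> [i|x]; last by rewrite gE; ring.
  split; first exact: DM (de i).1 (df i).1.
  by apply: DD; apply: DM; [exact: (de i).2|exact: (df i).1|exact: (de i).1|exact: (df i).2].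
have c1 : continuous (fun x => eta x * g x) by cts.
have c2 : continuous (fun x => eta' false x * f' false x + eta' true x * f' true x).
  by cts_with ltac:(first [exact: ce'|exact: cf']).
have c3 : continuous (fun x => f x * (eta'' false x + eta'' true x)).
  by cts_with ltac:(exact: ce'').
have s1 : supp L (fun x => eta x * g x) by exact: suppMl.
have s2 : supp L (fun x => eta' false x * f' false x + eta' true x * f' true x).
  by apply: suppD; exact: suppMl.
have s3 : supp L (fun x => f x * (eta'' false x + eta'' true x)).
  by apply: suppMr; exact: suppD.
have i1 := L1_supp c1 s1; have i2 := L1_supp c2 s2; have i3 := L1_supp c3 s3.
have E0 : Int (fun x => f x * (eta'' false x + eta'' true x)) =
    - Int (fun x => eta' false x * f' false x + eta' true x * f' true x).
  have p i := Int_parts cf (cf' i) (ce' i) (ce'' i) (se' i) (df i).1 (de i).2.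
  have c4 i : L1 (fun x => f x * eta'' i x).
    by apply: (@L1_supp _ _ L); [cts; exact: ce''|exact: suppMr].
  have c5 i : L1 (fun x => eta' i x * f' i x).
    by apply: (@L1_supp _ _ L); [cts; [exact: ce'|exact: cf']|exact: suppMl].
  under eq_Int => x do rewrite mulrDr.
  rewrite (IntD (c4 false) (c4 true)) (IntD (c5 false) (c5 true)) !p opprD.
  by congr (- _ + - _); apply: eq_Int => x; rewrite mulrC.
have := Int_lap0 _ _ _ lF.
move=> /(_ L) h.
have {}h : Int (fun x => eta x * g x + 2 * (eta' false x * f' false x + eta' true x * f' true x) +
  f x * (eta'' false x + eta'' true x)) = 0.
  apply: h; [by cts|exact: suppMl|].
  by apply: ctsD => //; apply: ctsD => //; apply: ctsM => //; exact: ctsC.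
move: h; rewrite IntD//; last by apply: L1D => //; exact: L1Z.
rewrite IntD//; last exact: L1Z.
rewrite IntZ// E0; split; lra.
Qed.

End PointwiseLaplacian.

(** * Limits and derivatives under the integral sign; convolutions *)

Section LimitsOfIntegrals.
Context {R : realType}.
Local Notation plane := (R * R)%type.
Implicit Types (f g : plane -> R) (i j : bool).

Lemma Int_dominated (f_ : nat -> plane -> R) f g :
  (forall n, measurable_fun setT (f_ n)) -> L1 g -> (forall n x, `|f_ n x| <= g x) ->
  (forall x, f_ ^~ x @ \oo --> f x) -> L1 f /\ (fun n => Int (f_ n)) @ \oo --> Int f.
Proof.
move=> mf gi fg cf.
have mlim : measurable_fun setT f.
  exact: (measurable_fun_cvg mf (fun x _ => cf x)).
have cE x : (fun n => (f_ n x)%:E) @ \oo --> (f x)%:E.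
  by apply: cvg_EFin; [exact: nearW|exact: cf].
have [|||||h1 h2 h3] := @dominated_convergence _ _ _ (@leb2 R) setT measurableT
  (fun n x => (f_ n x)%:E) (fun x => (f x)%:E) (EFin \o g).
- by move=> n; apply/measurable_EFinP; exact: (mf n).
- exact/measurable_EFinP.
- by apply: aeW => x _; exact: cE.
- exact: gi.
- by apply: aeW => x n _; rewrite lee_fin fg.
split; first exact: h1.
have i n : L1 (f_ n) by exact: L1_le (mf n) (fg n) gi.
apply: fine_cvg; rewrite fineK; last exact: integrable_fin_num.
exact: h3.
Qed.

Lemma Int_fatou (f_ : nat -> plane -> R) f (c : R) :
  (forall n, measurable_fun setT (f_ n)) -> (forall n x, 0 <= f_ n x) ->
  (forall n, L1 (f_ n)) -> (forall n, Int (f_ n) <= c) ->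
  (forall x, f_ ^~ x @ \oo --> f x) -> L1 f /\ Int f <= c.
Proof.
move=> mf f0 fi fc cf.
have mlim : measurable_fun setT f.
  exact: (measurable_fun_cvg mf (fun x _ => cf x)).
have lim0 x : 0 <= f x.
  rewrite -(cvg_lim _ (cf x))//; apply: limr_ge; last exact: nearW.
  by apply/cvg_ex; eexists; exact: cf.
have cE x : (fun n => (f_ n x)%:E) @ \oo --> (f x)%:E.
  by apply: cvg_EFin; [exact: nearW|exact: cf].
apply: Int_fine_le => //.
have := @fatou _ _ R (@leb2 R) setT measurableT (fun n x => (f_ n x)%:E)
  (fun n => measurableT_comp (@EFin_measurable _ _) (mf n)) (fun n x _ => f0 n x).
under eq_integral => x _.
  rewrite (cvg_limn_einf_sup (l := (f x)%:E) _).1; last exact: cE.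
  over.
move=> /le_trans; apply.
have -> : (fun n => \int[@leb2 R]_x (f_ n x)%:E)%E = (fun n => (Int (f_ n))%:E).
  by apply/funext => n; rewrite Int_EFin.
rewrite limn_einf_lim; apply: lime_le; first exact: is_cvg_einfs.
apply: nearW => n; apply: le_trans (ereal_inf_lbound _) _; first by exists n => //=.
by rewrite lee_fin.
Qed.

(** Dominated convergence speaks of sequences: a failure of continuity is turned into a sequence
    tending to [x0] along which the integrals stay away from the limit. *)
Lemma continuous_Int {T : pseudoMetricType R} (f : T -> plane -> R) g (x0 : T) r : 0 < r ->
  (forall x, ball x0 r x -> measurable_fun setT (f x)) ->
  (forall x y, ball x0 r x -> `|f x y| <= g y) -> L1 g ->
  (forall y, {for x0, continuous (f ^~ y)}) ->
  {for x0, continuous (fun x => Int (f x))}.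
Proof.
move=> r0 mf fg gi cf; apply/continuous_ballP => e e0.
apply: contrapT => H.
have {}H (n : nat) : exists y, ball x0 (Num.min r n.+1%:R^-1) y /\ ~ (`|Int (f x0) - Int (f y)| < e).
  apply: contrapT => H'; apply: H; exists (Num.min r n.+1%:R^-1).
    by rewrite lt_min r0 invr_gt0 ltr0n.
  by move=> y xy; apply: contrapT => H''; apply: H'; exists y.
have [y_ hy] := choice H.
have yr n : ball x0 r (y_ n) by apply: le_ball (hy n).1; rewrite ge_min lexx.
have cy : y_ @ \oo --> x0.
  apply/cvg_ballP => d d0.
  have [N _ hN] := near_infty_natSinv_lt (PosNum d0).
  exists N => // n /hN/= nd.
  by apply: le_ball (hy n).1; rewrite ge_min (ltW nd) orbT.
have [_] := @Int_dominated (fun n => f (y_ n)) (f x0) g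
   (fun n => mf _ (yr n)) gi (fun n x => fg _ x (yr n)) (fun y => cvg_comp _ _ cy (cf y)).
move/cvgrPdist_lt => /(_ e e0)[N _ /(_ N (leqnn N))].
exact: (hy N).2.
Qed.

Lemma is_derive_Int (f f' : R -> plane -> R) g a r : 0 < r ->
  (forall s, `|s - a| < r -> L1 (f s)) ->
  (forall s y, `|s - a| < r -> is_derive s (1 : R) (f ^~ y) (f' s y)) ->
  (forall s y, `|s - a| < r -> `|f' s y| <= g y) -> L1 g ->
  is_derive a (1 : R) (fun s => Int (f s)) (Int (f' a)).
Proof.
move=> r0 fi df fg gi.
have I s : s \in `](a - r), (a + r)[ -> `|s - a| < r.
  by rewrite in_itv/= ltr_norml => /andP[h1 h2]; apply/andP; split; lra.
have I' s : `](a - r), (a + r)[%classic s -> `|s - a| < r by move=> h; apply: I; rewrite inE in h *.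
have Ia : `](a - r), (a + r)[%classic a by rewrite /= in_itv/=; apply/andP; split; lra.
have pE s y : `|s - a| < r -> partial1of2 f s y = f' s y.
  by move=> sr; rewrite partial1of2E; have [_ ->] := df s y sr.
have g0 y : 0 <= g y by apply: le_trans (fg a y _); rewrite ?subrr ?normr0.
have H1 s : `](a - r), (a + r)[%classic s -> (@leb2 R).-integrable setT (EFin \o f s).
  by move=> /I'; exact: fi.
have H2 s y : `](a - r), (a + r)[%classic s -> setT y -> derivable (f ^~ y) s 1.
  by move=> /I' h _; have [] := df s y h.
have H3 s y : `](a - r), (a + r)[%classic s -> setT y -> `|partial1of2 f s y| <= g y.
  by move=> /I' h _; rewrite pE// fg.
have C := @cvg_differentiation_under_integral R _ _ (@leb2 R) f setT measurableT a _ _ Ia H1 H2 g g0 gi H3.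
have E : \int[@leb2 R]_y partial1of2 f a y = Int (f' a).
  by apply: eq_Int => y; rewrite pE// subrr normr0.
have C' : h^-1 *: (Int (f (h *: (1:R) + a)) - Int (f a)) @[h --> 0^'] --> Int (f' a).
  rewrite -E (_ : (fun h : R => h^-1 *: (Int (f (h *: (1:R) + a)) - Int (f a))) =
    fun h : R => h^-1 *: (Int (f (h + a)) - Int (f a))) //.
  by apply/funext => h; rewrite [h *: 1]mulr1.
split; first by apply/cvg_ex; exists (Int (f' a)).
exact/cvg_lim.
Qed.

Definition conv (k f : plane -> R) (x : plane) : R := Int (fun y => k (x - y) * f y).

Lemma measurable_kernel (k : plane -> R) (x : plane) : measurable_fun setT k ->
  measurable_fun setT (fun y : plane => k (x - y)).
Proof.
move=> mk; apply: (measurableT_comp mk).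
rewrite (_ : (fun y => x - y) = fun y : plane => (x.1 - y.1, x.2 - y.2)); last by apply/funext => -[].
by apply: measurable_fun_pair; apply: measurable_funB.
Qed.

Lemma L1_conv (k f : plane -> R) c (x : plane) : L1 f -> measurable_fun setT k ->
  (forall z, `|k z| <= c) -> L1 (fun y => k (x - y) * f y).
Proof. by move=> fi mk kc; apply: (L1M (c := c)) => //; exact: measurable_kernel. Qed.

Lemma continuous_conv (k f : plane -> R) c : L1 f -> continuous k ->
  (forall z, `|k z| <= c) -> continuous (conv k f).
Proof.
move=> fi ck kc x; apply: (@continuous_Int _ (fun x y => k (x - y) * f y) (fun y => c * `|f y|) x 1) => //.
- move=> z _; apply: measurable_funM; last exact: L1_measurable.
  refine (measurable_kernel z (continuous_measurable_plane ck)).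
- by move=> z y _; rewrite normrM ler_wpM2r.
- exact/L1Z/L1_abs.
- move=> y; apply: cvgM; last exact: cvg_cst.
  by apply: continuous_comp; [apply: cvgB; [exact: cvg_id|exact: cvg_cst]|exact: ck].
Qed.

Lemma D_conv i (k k' f : plane -> R) c : L1 f -> measurable_fun setT k ->
  (forall z, `|k z| <= c) -> (forall z, `|k' z| <= c) -> D i k k' ->
  D i (conv k f) (conv k' f).
Proof.
move=> fi mk kc kc' dk x.
have sE s y : slice i x s - y = slice i (x - y) (s - coord i y) by case: (i); case: y.
have -> : conv k' f x = Int ((fun s y => k' (slice i x s - y) * f y) (coord i x)).
  by apply: eq_Int => y; rewrite slice_coord.
apply: (@is_derive_Int (fun s y => k (slice i x s - y) * f y) (fun s y => k' (slice i x s - y) * f y) (fun y => c * `|f y|) (coord i x) 1) => //.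
- by move=> s _; exact: L1_conv fi mk kc.
- move=> s y _.
  have h : is_derive s (1:R) (fun s => k (slice i x s - y)) (k' (slice i x s - y)).
    have := dk (slice i x s - y).
    have -> : coord i (slice i x s - y) = s + - coord i y by case: (i); case: (y).
    move=> h; have := is_derive_shift_val h.
    congr (is_derive _ _ _ _); apply/funext => t.
    by congr k; case: (i); case: (y).
  have := is_deriveM_val h (is_derive_cst (f y) s (1:R)).
  by rewrite mulr0 addr0.
- by move=> s y _; rewrite normrM ler_wpM2r.
- exact/L1Z/L1_abs.
Qed.

Lemma convB (k l f : plane -> R) x : L1 (fun y => k (x - y) * f y) -> L1 (fun y => l (x - y) * f y) ->
  conv (fun z => k z - l z) f x = conv k f x - conv l f x.
Proof.
move=> ki li; rewrite /conv -IntB//; apply: eq_Int => y; ring.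
Qed.

End LimitsOfIntegrals.

(** * The Biot-Savart velocity at a fixed time *)

Section BiotSavartKernel.
Context {R : realType}.
Local Notation plane := (R * R)%type.
Implicit Types (f g : plane -> R) (i j : bool) (z x : plane).

Definition kap (r : R) z : R := (z.1 ^+ 2 + z.2 ^+ 2 + r ^+ 2)^-1.

(* The Biot-Savart kernel regularised at scale [r]; at [r = 0] it is the singular kernel,
   with the junk value [0] at the origin. *)
Definition K (r : R) i z : R := if i then z.1 * kap r z else - z.2 * kap r z.

Definition K' (r : R) i j z : R :=
  match i, j with
  | false, false => 2 * z.1 * z.2 * kap r z ^+ 2
  | false, true => - kap r z + 2 * z.2 ^+ 2 * kap r z ^+ 2
  | true, false => kap r z - 2 * z.1 ^+ 2 * kap r z ^+ 2
  | true, true => - (2 * z.1 * z.2 * kap r z ^+ 2)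
  end.

Lemma den_gt0 r z : 0 < r -> 0 < z.1 ^+ 2 + z.2 ^+ 2 + r ^+ 2.
Proof. by move=> r0; rewrite ltr_wpDl ?exprn_gt0// addr_ge0 ?sqr_ge0. Qed.

Lemma kap_gt0 r z : 0 < r -> 0 < kap r z.
Proof. by move=> r0; rewrite invr_gt0 den_gt0. Qed.

Lemma continuous_den r : continuous (fun z : plane => z.1 ^+ 2 + z.2 ^+ 2 + r ^+ 2).
Proof. by cts. Qed.

Lemma continuous_kap r : 0 < r -> continuous (kap r).
Proof.
by move=> r0; apply: ctsV; [move=> z; rewrite gt_eqF// den_gt0|exact: continuous_den].
Qed.

Lemma continuous_K r i : 0 < r -> continuous (K r i).
Proof. by move=> r0; case: i; rewrite /K; cts_with ltac:(exact: continuous_kap). Qed.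

Lemma continuous_K' r i j : 0 < r -> continuous (K' r i j).
Proof. by move=> r0; case: i; case: j; rewrite /K'; cts_with ltac:(exact: continuous_kap). Qed.

Lemma D_den r j : D j (fun z : plane => z.1 ^+ 2 + z.2 ^+ 2 + r ^+ 2) (fun z => 2 * coord j z).
Proof.
have h : D j (fun z : plane => z.1 * z.1 + z.2 * z.2 + r ^+ 2)
    (fun z => ((if j then 0 else 1) * z.1 + z.1 * (if j then 0 else 1) +
      ((if j then 1 else 0) * z.2 + z.2 * (if j then 1 else 0))) + 0).
  apply: DD; last exact: Dcst.
  case: j; apply: DD; apply: DM; (exact: Dfst0 || exact: Dsnd || exact: Dfst || exact: Dsnd0).
by apply: eq_D h => z; rewrite ?expr2//; case: j => /=; ring.
Qed.

Lemma D_kap r j : 0 < r -> D j (kap r) (fun z => - (2 * coord j z) * kap r z ^+ 2).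
Proof.
move=> r0; have h := DV (fun z => lt0r_neq0 (den_gt0 z r0)) (D_den r j).
by apply: eq_D h => // z; rewrite /kap -exprVn; ring.
Qed.

Lemma D_K r i j : 0 < r -> D j (K r i) (K' r i j).
Proof.
move=> r0; have hk := D_kap j r0.
case: i; case: j hk => hk.
- by apply: eq_D (DM Dfst0 hk) => // z; rewrite /K'/=; ring.
- by apply: eq_D (DM Dfst hk) => // z; rewrite /K'/=; ring.
- by apply: eq_D (DM (DN Dsnd) hk) => // z; rewrite /K'/=; ring.
- by apply: eq_D (DM (DN Dsnd0) hk) => // z; rewrite /K'/=; ring.
Qed.

Lemma div_K r z : K' r false false z + K' r true true z = 0.
Proof. by rewrite /K'; ring. Qed.

(** The curl of the regularised kernel, an approximate identity at scale [r]. Its mass is 2 pi, but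
    only the bounds 8 / 9 and 2 pi^2 are established below. *)
Definition poi (r : R) z : R := 2 * r ^+ 2 * kap r z ^+ 2.

Lemma curl_K r z : 0 < r -> K' r true false z - K' r false true z = poi r z.
Proof.
move=> r0; rewrite /K' /poi.
have : (z.1 ^+ 2 + z.2 ^+ 2 + r ^+ 2) * kap r z = 1 by rewrite divff// gt_eqF// den_gt0.
move: (kap r z) => k h.
apply/eqP; rewrite -subr_eq0; apply/eqP.
transitivity (2 * k * (1 - (z.1 ^+ 2 + z.2 ^+ 2 + r ^+ 2) * k)); first by ring.
by rewrite h subrr mulr0.
Qed.

Lemma coord_kap r z i j : 0 < r -> `|coord i z * coord j z| * kap r z <= 1.
Proof.
move=> r0; rewrite ler_pdivrMr ?den_gt0// mul1r normrM.
have h i' : coord i' z ^+ 2 <= z.1 ^+ 2 + z.2 ^+ 2.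
  by case: i' => /=; rewrite ?lerDl ?lerDr sqr_ge0.
have := h i; have := h j; rewrite -(real_normK (num_real (coord i z))) -(real_normK (num_real (coord j z))).
have := sqr_ge0 (`|coord i z| - `|coord j z|); have := sqr_ge0 r.
by rewrite !expr2; nra.
Qed.

Lemma kap_le r z : 0 < r -> kap r z <= (r ^+ 2)^-1.
Proof.
move=> r0; rewrite lef_pV2 ?posrE ?den_gt0 ?exprn_gt0//.
by rewrite lerDr addr_ge0 ?sqr_ge0.
Qed.

Lemma K_le r i z : 0 < r -> `|K r i z| <= r^-1.
Proof.
move=> r0.
have h j : `|coord j z| * kap r z <= r^-1.
  rewrite ler_pdivrMr ?den_gt0// mulrC ler_pdivlMr//.
  have hj : coord j z ^+ 2 <= z.1 ^+ 2 + z.2 ^+ 2.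
    by case: j => /=; rewrite ?lerDl ?lerDr sqr_ge0.
  move: hj; rewrite -(real_normK (num_real (coord j z))).
  have := sqr_ge0 (`|coord j z| - r); have := sqr_ge0 r; have := sqr_ge0 `|coord j z|.
  by rewrite !expr2; nra.
case: i; rewrite /K normrM ?normrN [`|kap _ _|]gtr0_norm ?kap_gt0//.
  exact: (h false).
exact: (h true).
Qed.

Lemma K'_le r i j z : 0 < r -> `|K' r i j z| <= 3 * (r ^+ 2)^-1.
Proof.
move=> r0.
have k0 := kap_gt0 z r0; have k1 := kap_le z r0.
have q a b : `|coord a z * coord b z * kap r z ^+ 2| <= kap r z.
  rewrite normrM [`|kap r z ^+ 2|]gtr0_norm ?exprn_gt0// expr2 mulrA.
  by rewrite -[leRHS]mul1r ler_pM2r// coord_kap.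
have := q true true; have := q false false; have := q false true; rewrite !ler_norml /=.
move=> /andP[a1 a2] /andP[b1 b2] /andP[c1 c2].
by case: i; case: j; rewrite /K' !expr2 in a1 a2 b1 b2 c1 c2 k1 *; apply/andP; split; lra.
Qed.

(** A majorant of |z| / (|z|^2 + r^2)^2 that can be integrated without polar coordinates:
    integrating in the first variable gives pi / (z_2^2 + r^2), and then in the second pi^2 / r. *)
Definition hr (r : R) z : R := kap r z * (Num.sqrt (z.2 ^+ 2 + r ^+ 2))^-1.

Lemma hr_den r z : 0 < r -> 0 < z.2 ^+ 2 + r ^+ 2.
Proof. by move=> r0; rewrite ltr_wpDl ?exprn_gt0// sqr_ge0. Qed.

Lemma hr_ge0 r z : 0 < r -> 0 <= hr r z.
Proof. by move=> r0; apply: mulr_ge0; [exact/ltW/kap_gt0|rewrite invr_ge0 sqrtr_ge0]. Qed.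

Lemma continuous_hr r : 0 < r -> continuous (hr r).
Proof.
move=> r0; apply: ctsM; first exact: continuous_kap.
apply: ctsV; first by move=> z; rewrite gt_eqF// sqrtr_gt0 hr_den.
apply: (@cts_comp _ _ _ (fun z : plane => z.2 ^+ 2 + r ^+ 2) Num.sqrt); last exact: sqrt_continuous.
by cts.
Qed.

Lemma coord_hr r j z : 0 < r -> `|coord j z| * kap r z ^+ 2 <= hr r z.
Proof.
move=> r0; rewrite expr2 mulrCA /hr ler_pM2l ?kap_gt0//.
have s0 : 0 < Num.sqrt (z.2 ^+ 2 + r ^+ 2) by rewrite sqrtr_gt0 hr_den.
rewrite ler_pdivrMr ?den_gt0// mulrC ler_pdivlMr//.
have := sqr_sqrtr (ltW (hr_den z r0)).
move: (Num.sqrt _) s0 => s s0 E.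
have hj : coord j z ^+ 2 <= z.1 ^+ 2 + z.2 ^+ 2.
  by case: j => /=; rewrite ?lerDl ?lerDr sqr_ge0.
move: hj; rewrite -(real_normK (num_real (coord j z))).
have := sqr_ge0 (`|coord j z| - s); have := sqr_ge0 z.1.
by rewrite !expr2 in E *; nra.
Qed.

Lemma r_hr r z : 0 < r -> r * kap r z ^+ 2 <= hr r z.
Proof.
move=> r0; rewrite expr2 mulrCA /hr ler_pM2l ?kap_gt0//.
have s0 : 0 < Num.sqrt (z.2 ^+ 2 + r ^+ 2) by rewrite sqrtr_gt0 hr_den.
rewrite ler_pdivrMr ?den_gt0// mulrC ler_pdivlMr//.
have := sqr_sqrtr (ltW (hr_den z r0)).
move: (Num.sqrt _) s0 => s s0 E.
have := sqr_ge0 (r - s); have := sqr_ge0 z.1; have := sqr_ge0 z.2.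
by rewrite !expr2 in E *; nra.
Qed.

Lemma Int_hr r x : 0 < r -> L1 (fun y : plane => hr r (x - y)) /\
  Int (fun y : plane => hr r (x - y)) <= pi ^+ 2 / r.
Proof.
move=> r0.
pose s (y2 : R) := Num.sqrt ((x.2 - y2) ^+ 2 + r ^+ 2).
have p y2 : 0 < (x.2 - y2) ^+ 2 + r ^+ 2 := hr_den (0, x.2 - y2) r0.
have s0 y2 : 0 < s y2 by rewrite sqrtr_gt0 p.
pose F (y2 : R) := pi * ((x.2 - y2) ^+ 2 + r ^+ 2)^-1.
have cF : continuous F.
  apply: ctsM; first exact: ctsC.
  by apply: ctsV; [move=> y; rewrite gt_eqF|cts].
apply: (@tonelli_le _ _ F).
- exact: (measurable_kernel x (continuous_measurable_plane (continuous_hr r0))).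
- by move=> y; exact: hr_ge0.
- exact: continuous_measurable_fun.
- move=> y2.
  have -> : (\int[@lebesgue_measure R]_x0 (hr r (x - (x0, y2)))%:E =
      \int[@lebesgue_measure R]_x0 ((s y2)^-1%:E * (((x0 - x.1) ^+ 2 + s y2 ^+ 2)^-1)%:E))%E.
    apply: eq_integral => x0 _; rewrite -EFinM mulrC; congr ((_ * _)%:E).
    rewrite /kap /= /s (sqr_sqrtr (ltW (p y2))); congr (_^-1).
    by rewrite addrA; congr (_ + _ + _); rewrite -sqrrN opprB.
  rewrite ge0_integralZl//.
  + apply: (@le_trans _ _ ((s y2)^-1%:E * (pi / s y2)%:E)%E).
      apply: lee_wpmul2l; first by rewrite lee_fin invr_ge0 ltW.
      exact: integral_inv_sq.
    by rewrite -EFinM lee_fin mulrCA -invfM -expr2 /s (sqr_sqrtr (ltW (p y2))).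
  + apply/measurable_EFinP; apply: continuous_measurable_fun.
    apply: ctsV => [z|]; first by rewrite gt_eqF// ltr_wpDl ?sqr_ge0// exprn_gt0.
    by cts.
  + by move=> z _; rewrite lee_fin invr_ge0 addr_ge0// sqr_ge0.
  + by rewrite lee_fin invr_ge0 ltW.
- under eq_integral do rewrite EFinM.
  rewrite ge0_integralZl//.
  + rewrite expr2 -mulrA [X in (_ <= X)%E]EFinM; apply: lee_wpmul2l; first by rewrite lee_fin pi_ge0.
    have h := integral_inv_sq x.2 r0; apply: le_trans h.
    rewrite le_eqVlt; apply/orP; left; apply/eqP; apply: eq_integral => y _.
    by rewrite -sqrrN opprB.
  + apply/measurable_EFinP; apply: continuous_measurable_fun.
    by apply: ctsV => [z|]; [rewrite gt_eqF|cts].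
  + by move=> z _; rewrite lee_fin invr_ge0 ltW.
  + by rewrite lee_fin pi_ge0.
Qed.

Lemma KE r i z : K r i z = (if i then 1 else -1) * coord (~~ i) z * kap r z.
Proof. by case: i; rewrite /K /= ?mul1r ?mulN1r. Qed.

Lemma K_half r i z : 0 < r -> `|K r i z - K (r / 2) i z| <= 3 * r ^+ 2 * hr r z.
Proof.
move=> r0; have r20 : 0 < r / 2 by rewrite divr_gt0.
rewrite !KE -mulrBr !normrM (_ : `|if i then _ else _| = 1); last by case: i; rewrite ?normrN normr1.
rewrite mul1r.
apply: (@le_trans _ _ (3 * r ^+ 2 * (`|coord (~~ i) z| * kap r z ^+ 2))); last first.
  by rewrite ler_wpM2l ?coord_hr// mulr_ge0// sqr_ge0.
rewrite mulrCA ler_wpM2l//.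
have d := den_gt0 z r0; have d2 := den_gt0 z r20.
rewrite (_ : kap r z - kap (r / 2) z = - (3 / 4 * r ^+ 2 * (kap r z * kap (r / 2) z))); last first.
  rewrite /kap; field.
  apply/andP; split; apply: lt0r_neq0; last exact: d.
  by move: d2; rewrite expr_div_n /=; lra.
have k0 := kap_gt0 z r0; have k20 := kap_gt0 z r20.
rewrite normrN ger0_norm; last by rewrite !mulr_ge0 ?sqr_ge0 ?ltW.
have : kap (r / 2) z <= 4 * kap r z.
  rewrite /kap -[4]invrK -invfM lef_pV2 ?posrE ?mulr_gt0//.
  rewrite expr_div_n; have := sqr_ge0 z.1; have := sqr_ge0 z.2; lra.
move=> h; have := ler_wpM2l (ltW k0) h.
move=> h'; have := ler_wpM2l (_ : 0 <= 3 / 4 * r ^+ 2) h'.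
have r2 : 0 <= 3 / 4 * r ^+ 2 by rewrite mulr_ge0 ?sqr_ge0//; lra.
by move=> /(_ r2); rewrite expr2; lra.
Qed.

Lemma cvg_K (s : nat -> R) i z : s @ \oo --> 0 -> (fun n => K (s n) i z) @ \oo --> K 0 i z.
Proof.
move=> s0; have [z0|z0] := eqVneq (z.1 ^+ 2 + z.2 ^+ 2) 0.
  have {z0} : coord (~~ i) z = 0.
    move/eqP: z0; rewrite paddr_eq0 ?sqr_ge0// !sqrf_eq0 => /andP[/eqP h1 /eqP h2].
    by case: i.
  move=> z0; under eq_fun do rewrite KE z0 mulr0 mul0r.
  by rewrite KE z0 mulr0 mul0r; exact: cvg_cst.
under eq_fun do rewrite KE; rewrite KE.
apply: cvgM; first exact: cvg_cst.
apply: cvgV; first by rewrite expr0n addr0.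
apply: cvgD; first exact: cvg_cst.
exact: (cvgM s0 s0).
Qed.

Lemma measurable_K0 i : measurable_fun setT (K 0 i).
Proof.
apply: (@measurable_fun_cvg _ _ R setT (fun n => K n.+1%:R^-1 i)).
  by move=> n; apply: continuous_measurable_plane; apply: continuous_K; rewrite invr_gt0.
by move=> z _; apply: cvg_K; exact: cvg_harmonic.
Qed.

(** Telescoping over the scales r / 2^n: by [K_half], passing from a scale s to s / 2 costs 3 pi^2
    s, and the geometric series sums to 6 pi^2 r. Fatou's lemma reaches the singular kernel. *)
Lemma K_near r i x : 0 < r -> L1 (fun y : plane => `|K r i (x - y) - K 0 i (x - y)|) /\
  Int (fun y : plane => `|K r i (x - y) - K 0 i (x - y)|) <= 6 * pi ^+ 2 * r.
Proof.
move=> r0; pose s (n : nat) := r / 2 ^+ n.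
have s0 n : 0 < s n by rewrite divr_gt0// exprn_gt0.
pose f_ n (y : plane) := `|K r i (x - y) - K (s n) i (x - y)|.
have mK t : 0 < t -> measurable_fun setT (fun y : plane => K t i (x - y)).
  by move=> t0; apply: (measurable_kernel x); apply: continuous_measurable_plane; exact: continuous_K.
have mf n : measurable_fun setT (f_ n).
  by apply: measurableT_comp => //; apply: measurable_funB; exact: mK.
have st n : L1 (fun y : plane => `|K (s n) i (x - y) - K (s n.+1) i (x - y)|) /\
    Int (fun y : plane => `|K (s n) i (x - y) - K (s n.+1) i (x - y)|) <= 3 * pi ^+ 2 * s n.
  have sE : s n.+1 = s n / 2 by rewrite /s exprSr invfM mulrA.
  have [h1 h2] := Int_hr x (s0 n).
  have b y : `| `|K (s n) i (x - y) - K (s n.+1) i (x - y)| | <= 3 * s n ^+ 2 * hr (s n) (x - y).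
    by rewrite normr_id sE K_half.
  have m : measurable_fun setT (fun y : plane => `|K (s n) i (x - y) - K (s n.+1) i (x - y)|).
    by apply: measurableT_comp => //; apply: measurable_funB; exact: mK.
  have l := L1_le m b (L1Z (3 * s n ^+ 2) h1).
  split=> //; apply: le_trans (Int_le l (L1Z (3 * s n ^+ 2) h1) _) _.
    by move=> y; rewrite (le_trans _ (b y))// ler_norm.
  rewrite IntZ//; apply: le_trans (ler_wpM2l _ h2) _; first by rewrite mulr_ge0// sqr_ge0.
  rewrite le_eqVlt; apply/orP; left; apply/eqP; field; rewrite gt_eqF//.
have fn n : L1 (f_ n) /\ Int (f_ n) <= 6 * pi ^+ 2 * (r - s n).
  elim: n => [|n [l1 l2]].
    have -> : f_ 0%N = fun=> 0.
      by apply/funext => y; rewrite /f_ /s expr0 divr1 subrr normr0.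
    by split; [exact: L1_0|rewrite Int0 /s expr0 divr1 subrr mulr0].
  have [h1 h2] := st n.
  have b y : `|f_ n.+1 y| <= f_ n y + `|K (s n) i (x - y) - K (s n.+1) i (x - y)|.
    rewrite normr_id (le_trans _ (ler_normD _ _))//.
    by rewrite addrA subrK.
  have l := L1_le (mf n.+1) b (L1D l1 h1).
  split=> //; apply: le_trans (Int_le l (L1D l1 h1) _) _.
    by move=> y; rewrite (le_trans _ (b y))// ler_norm.
  have sE : s n.+1 = s n / 2 by rewrite /s exprSr invfM mulrA.
  by rewrite IntD// [X in r - X]sE; lra.
apply: (@Int_fatou _ f_) => //.
- by move=> n y; exact: normr_ge0.
- by move=> n; have [] := fn n.
- move=> n; have [_ h] := fn n; apply: (le_trans h).
  apply: ler_wpM2l; first by rewrite mulr_ge0// sqr_ge0.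
  by rewrite lerBlDr lerDl ltW.
- move=> y; apply: cvg_norm; apply: cvgB; first exact: cvg_cst.
  apply: cvg_K; rewrite -(mulr0 r); apply: cvgMr.
  have -> : (fun n => (2 ^+ n)^-1) = (fun n => (2^-1 : R) ^+ n).
    by apply/funext => n; rewrite exprVn.
  by apply: cvg_expr; rewrite ger0_norm; lra.
Qed.

Lemma poi_ge0 r z : 0 <= poi r z.
Proof. by rewrite /poi; apply: mulr_ge0; [apply: mulr_ge0 => //; exact: sqr_ge0|exact: sqr_ge0]. Qed.

Lemma continuous_poi r : 0 < r -> continuous (poi r).
Proof. by move=> r0; rewrite /poi; cts_with ltac:(exact: continuous_kap). Qed.

Lemma poi_le r z : 0 < r -> poi r z <= 2 * (r ^+ 2)^-1.
Proof.
move=> r0; rewrite /poi -mulrA ler_pM2l//.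
have k0 := kap_gt0 z r0; have k1 := kap_le z r0.
have : kap r z ^+ 2 <= ((r ^+ 2)^-1) ^+ 2 by rewrite !(expr2 (kap r z)) [leRHS]expr2; apply: ler_pM => //; exact: ltW.
move=> h; apply: le_trans (ler_wpM2l (sqr_ge0 r) h) _.
rewrite le_eqVlt; apply/orP; left; apply/eqP; field; rewrite gt_eqF//.
Qed.

Lemma Int_poi r x : 0 < r -> L1 (fun y : plane => poi r (x - y)) /\
  Int (fun y : plane => poi r (x - y)) <= 2 * pi ^+ 2.
Proof.
move=> r0; have [h1 h2] := Int_hr x r0.
have b y : poi r (x - y) <= 2 * r * hr r (x - y).
  have := r_hr (x - y) r0; move=> h; have := ler_wpM2l (_ : 0 <= 2 * r) h.
  have r2 : 0 <= 2 * r by rewrite mulr_ge0// ltW.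
  by move=> /(_ r2); rewrite /poi !expr2; lra.
have m : measurable_fun setT (fun y : plane => poi r (x - y)).
  exact: (measurable_kernel x (continuous_measurable_plane (continuous_poi r0))).
have l : L1 (fun y : plane => poi r (x - y)).
  apply: (L1_le m _ (L1Z (2 * r) h1)) => y.
  by rewrite ger0_norm ?poi_ge0.
split=> //; apply: le_trans (Int_le l (L1Z (2 * r) h1) b) _.
rewrite IntZ//; apply: le_trans (ler_wpM2l _ h2) _; first by rewrite mulr_ge0// ltW.
rewrite le_eqVlt; apply/orP; left; apply/eqP; field; rewrite gt_eqF//.
Qed.

(** On the square of half-side [r] about [x] the denominator is at most 3 r^2, so the density is at
    least 2 / (9 r^2), on an area 4 r^2. *)
Lemma Int_poi_ge r x : 0 < r -> 8 / 9 <= Int (fun y : plane => poi r (x - y)).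
Proof.
move=> r0.
pose A : set plane := `[(x.1 - r), (x.1 + r)] `*` `[(x.2 - r), (x.2 + r)].
have mA : measurable A by apply: measurableX; exact: measurable_itv.
have lA : (@leb2 R A = (4 * r ^+ 2)%:E)%E.
  rewrite /leb2 product_measure1E; [|exact: measurable_itv..].
  have e (c : R) : (c + r) - (c - r) = 2 * r by ring.
  have lt (c : R) : c - r < c + r by lra.
  rewrite /= !lebesgue_measure_itv/= !lte_fin !lt -!EFinB !e -EFinM.
  by congr (_%:E); ring.
have IA : (\int[@leb2 R]_x (\1_A x)%:E = (4 * r ^+ 2)%:E)%E.
  by rewrite integral_indic// setIT; exact: lA.
pose c := 2 / 9 * (r ^+ 2)^-1.
have c0 : 0 <= c by rewrite mulr_ge0 ?invr_ge0 ?sqr_ge0//; lra.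
have l1 : L1 (fun y => c * \1_A y).
  apply: L1Z; apply: L1P; first exact: measurable_indic.
  have -> : (\int[@leb2 R]_x (`|\1_A x|)%:E = \int[@leb2 R]_x (\1_A x)%:E)%E.
    by apply: eq_integral => y _; rewrite ger0_norm.
  by rewrite IA ltry.
have i1 : L1 (\1_A : plane -> R).
  apply: L1P; first exact: measurable_indic.
  have -> : (\int[@leb2 R]_x (`|\1_A x|)%:E = \int[@leb2 R]_x (\1_A x)%:E)%E.
    by apply: eq_integral => y _; rewrite ger0_norm.
  by rewrite IA ltry.
have -> : 8 / 9 = Int (fun y => c * \1_A y).
  rewrite IntZ// (_ : Int \1_A = 4 * r ^+ 2).
    by rewrite /c; field; rewrite gt_eqF.
  by apply: EFin_inj; rewrite Int_EFin// IA.
apply: Int_le => //; first by have [] := Int_poi x r0.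
move=> y; rewrite indicE; have [|] := boolP (y \in A); last by rewrite mulr0 poi_ge0.
rewrite inE => -[]; rewrite /= !in_itv/= mulr1 => /andP[a1 a2] /andP[b1 b2].
have q (a : R) : - r <= a -> a <= r -> a ^+ 2 <= r ^+ 2.
  by move=> h1 h2; rewrite -(real_normK (num_real a)) !expr2; apply: ler_pM => //; rewrite ler_norml h1.
have q1 := q (x.1 - y.1) ltac:(lra) ltac:(lra); have q2 := q (x.2 - y.2) ltac:(lra) ltac:(lra).
have : (3 * r ^+ 2)^-1 <= kap r (x - y).
  rewrite lef_pV2 ?posrE ?den_gt0 ?mulr_gt0 ?exprn_gt0//=; lra.
have i0 : 0 <= (3 * r ^+ 2)^-1 by rewrite invr_ge0 mulr_ge0// sqr_ge0.
move=> h; have : (3 * r ^+ 2)^-1 ^+ 2 <= kap r (x - y) ^+ 2.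
  by rewrite [leLHS]expr2 [leRHS]expr2; apply: ler_pM.
move=> {}h; have := ler_wpM2l (_ : 0 <= 2 * r ^+ 2) h.
have r2 : 0 <= 2 * r ^+ 2 by rewrite mulr_ge0// sqr_ge0.
move=> /(_ r2); apply: le_trans; rewrite le_eqVlt; apply/orP; left; apply/eqP.
by rewrite /c; field; rewrite gt_eqF.
Qed.

(** Away from the origin the kernel at scale [r] is dominated by the integrable one at the fixed
    scale [d], with a factor that vanishes with [r]. *)
Lemma poi_far r d z : 0 < r -> 0 < d -> r <= d -> d <= `|z.1| \/ d <= `|z.2| ->
  poi r z <= 4 * (r ^+ 2 / d ^+ 2) * poi d z.
Proof.
move=> r0 d0 rd hz.
have dz : d ^+ 2 <= z.1 ^+ 2 + z.2 ^+ 2.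
  have q (a : R) : d <= `|a| -> d ^+ 2 <= a ^+ 2.
    by move=> h; rewrite -(real_normK (num_real a)) !expr2; apply: ler_pM => //; exact: ltW.
  case: hz => /q h; apply: le_trans h _; [by rewrite lerDl sqr_ge0|by rewrite lerDr sqr_ge0].
have k : kap r z <= 2 * kap d z.
  rewrite /kap -[2]invrK -invfM lef_pV2 ?posrE ?mulr_gt0 ?den_gt0//.
  have := sqr_ge0 r; lra.
have k0 := kap_gt0 z r0.
have : kap r z ^+ 2 <= (2 * kap d z) ^+ 2 by rewrite (expr2 (kap r z)) [leRHS]expr2; apply: ler_pM => //; exact: ltW.
move=> h; have := ler_wpM2l (_ : 0 <= 2 * r ^+ 2) h.
have r2 : 0 <= 2 * r ^+ 2 by rewrite mulr_ge0// sqr_ge0.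
move=> /(_ r2) {}h; apply: le_trans h _; rewrite le_eqVlt; apply/orP; left; apply/eqP.
by rewrite /poi; field; rewrite gt_eqF.
Qed.

(** The limit is stated with the mass as a factor, since the mass is known only up to bounds. Points
    closer than [d] are handled by the continuity of [f], the others by [poi_far]. *)
Lemma conv_poi_cvg f (M : R) x (s : nat -> R) : L1 f -> continuous f ->
  (forall y, `|f y| <= M) -> (forall n, 0 < s n) -> s @ \oo --> 0 ->
  (fun n => conv (poi (s n)) f x - Int (fun y : plane => poi (s n) (x - y)) * f x) @ \oo --> (0 : R).
Proof.
move=> fi cf fM s0 cs.
have M0 : 0 <= M by apply: le_trans (fM x).
apply/cvgrPdist_le => e e0.
pose e' := e / (4 * pi ^+ 2).
have p20 : 0 < pi ^+ 2 :> R by rewrite exprn_gt0// pi_gt0.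
have e'0 : 0 < e' by rewrite divr_gt0// mulr_gt0.
have [d d0 hd] := (continuous_ballP f x).1 (cf x) e' e'0.
have c2 : (fun n => (16 * pi ^+ 2 * M / d ^+ 2) * s n ^+ 2) @ \oo --> (16 * pi ^+ 2 * M / d ^+ 2) * 0 ^+ 2.
  by apply: cvgMr; exact: (cvgM cs cs).
rewrite expr0n mulr0 in c2.
near=> n.
have rd : s n <= d by near: n; exact: (cvgr_le _ cs).
have sm : (16 * pi ^+ 2 * M / d ^+ 2) * s n ^+ 2 <= e / 2.
  by near: n; apply: (cvgr_le _ c2); rewrite divr_gt0.
rewrite sub0r normrN.
have c0 : 0 <= 2 * M * (4 * (s n ^+ 2 / d ^+ 2)).
  by apply: mulr_ge0; [exact: mulr_ge0|apply: mulr_ge0 => //; apply: divr_ge0; exact: sqr_ge0].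
have [l1 h1] := Int_poi x (s0 n); have [l2 h2] := Int_poi x d0.
have lc : L1 (fun y => poi (s n) (x - y) * f y).
  apply: (@L1_conv _ _ _ (2 * (s n ^+ 2)^-1)) => //.
    by apply: continuous_measurable_plane; exact: continuous_poi.
  by move=> z; rewrite ger0_norm ?poi_ge0// poi_le.
have lc' : L1 (fun y : plane => f x * poi (s n) (x - y)) by exact: L1Z.
rewrite mulrC -IntZ// /conv -IntB//.
have lb := L1D (L1Z e' l1) (L1Z (2 * M * (4 * (s n ^+ 2 / d ^+ 2))) l2).
apply: le_trans (Int_abs_le (g := fun y => e' * poi (s n) (x - y) + 2 * M * (4 * (s n ^+ 2 / d ^+ 2)) * poi d (x - y)) _ lb _) _.
- exact: L1_measurable (L1B lc lc').
- move=> y; rewrite [f x * _]mulrC -mulrBr normrM ger0_norm ?poi_ge0//.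
  have [xy|xy] := pselect (ball x d y).
    apply: le_trans (_ : _ <= e' * poi (s n) (x - y)) _.
      by rewrite mulrC ler_wpM2r ?poi_ge0// distrC ltW// hd.
    by rewrite lerDl; apply: mulr_ge0 => //; exact: poi_ge0.
  have far : d <= `|(x - y).1| \/ d <= `|(x - y).2|.
    have [h|h] := leP d `|(x - y).1|; first by left.
    by right; rewrite leNgt; apply/negP => h'; apply: xy.
  have pf := poi_far (s0 n) d0 rd far.
  have ff : `|f y - f x| <= 2 * M.
    by rewrite (le_trans (ler_normB _ _))//; have := fM x; have := fM y; lra.
  apply: le_trans (_ : _ <= 2 * M * (4 * (s n ^+ 2 / d ^+ 2)) * poi d (x - y)) _.
    rewrite mulrC -mulrA; apply: ler_pM => //; exact: poi_ge0.
  by rewrite lerDr mulr_ge0 ?poi_ge0// ltW.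
- rewrite IntD; [|exact: L1Z|exact: L1Z].
  rewrite (IntZ _ l1) (IntZ _ l2).
  have := ler_wpM2l (ltW e'0) h1.
  have := ler_wpM2l c0 h2.
  have -> : 2 * M * (4 * (s n ^+ 2 / d ^+ 2)) * (2 * pi ^+ 2) = 16 * pi ^+ 2 * M / d ^+ 2 * s n ^+ 2 by ring.
  have -> : e' * (2 * pi ^+ 2) = e / 2 by rewrite /e'; move: (pi ^+ 2) p20 => p p0; field; rewrite gt_eqF.
  lra.
Unshelve. all: by end_near. Qed.

End BiotSavartKernel.

(** * Continuity, zero divergence and Serfati's estimate for the velocity *)

Section BiotSavartVelocity.
Context {R : realType}.
Local Notation plane := (R * R)%type.
Implicit Types (i j : bool) (x y z : plane).

Lemma integral_shift (G : R -> R) (c : R) : continuous G -> (forall s, 0 <= G s) ->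
  (\int[@lebesgue_measure R]_s (G (s + c))%:E = \int[@lebesgue_measure R]_s (G s)%:E)%E.
Proof.
move=> cG G0; pose F (s : R) := s + c.
have dF s : is_derive s (1 : R) F 1.
  by have := is_deriveD_val (is_derive_id s (1:R)) (is_derive_cst c s (1:R)); rewrite addr0.
have F'E : derive1 F = cst 1.
  by apply/funext => s; rewrite derive1E; have [_ ->] := dF s.
have := @increasing_ge0_integration_by_substitutionT R F G.
move=> /(_ _ _ _ _ _ _ _ cG G0) H; rewrite H.
- by apply: eq_integral => s _; rewrite F'E /= mulr1.
- by move=> s t st; rewrite /F ltrD2r.
- by rewrite F'E; exact: cst_continuous.
- by rewrite F'E; exact: is_cvg_cst.
- by rewrite F'E; exact: is_cvg_cst.
- by move=> s; have [] := dF s.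
- apply/cvgrNyPle => A; near=> s; rewrite /F -lerBrDr; near: s; apply: nbhs_ninfty_le; exact: num_real.
- apply/cvgryPge => A; near=> s; rewrite /F -lerBlDr; near: s; apply: nbhs_pinfty_ge; exact: num_real.
Unshelve. all: by end_near. Qed.

Lemma integral_plane_shift (k : plane -> R) i (c : R) : continuous k -> (forall z, 0 <= k z) ->
  (\int[@leb2 R]_z (k (shiftc i c z))%:E = \int[@leb2 R]_z (k z)%:E)%E.
Proof.
move=> ck k0.
have ck' : continuous (fun z => k (shiftc i c z)).
  by apply: (@cts_comp _ _ _ (shiftc i c) k) => //; exact: cts_shiftc.
have mk : measurable_fun setT (fun z : plane => (k z)%:E).
  by apply/measurable_EFinP; exact: continuous_measurable_plane.
have mk' : measurable_fun setT (fun z : plane => (k (shiftc i c z))%:E).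
  by apply/measurable_EFinP; exact: continuous_measurable_plane.
have k0' z : (0 <= (k z)%:E)%E by rewrite lee_fin.
have k0'' z : (0 <= (k (shiftc i c z))%:E)%E by rewrite lee_fin.
case: i ck' mk' k0'' => ck' mk' k0''.
  rewrite /leb2.
  have -> := @fubini_tonelli1 _ _ _ _ R (@lebesgue_measure R) (@lebesgue_measure R) _ mk k0'.
  have -> := @fubini_tonelli1 _ _ _ _ R (@lebesgue_measure R) (@lebesgue_measure R) _ mk' k0''.
  apply: eq_integral => a _; rewrite /fubini_F /shiftc /=.
  apply: (@integral_shift (fun s : R => k (a, s))) => //.
  refine (@cts_slice_comp R true (a, 0) k ck).
rewrite /leb2.
have -> := @fubini_tonelli2 _ _ _ _ R (@lebesgue_measure R) (@lebesgue_measure R) _ mk k0'.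
have -> := @fubini_tonelli2 _ _ _ _ R (@lebesgue_measure R) (@lebesgue_measure R) _ mk' k0''.
apply: eq_integral => a _; rewrite /fubini_G /shiftc /=.
apply: (@integral_shift (fun s : R => k (s, a))) => //.
refine (@cts_slice_comp R false (0, a) k ck).
Qed.

Definition poi_mass (r : R) : R := Int (poi r).

(** The mass does not depend on the base point, so in [serfati] it leaves the integral over the
    plane as a constant. *)
Lemma poi_massE r x : 0 < r -> Int (fun y : plane => poi r (x - y)) = poi_mass r.
Proof.
move=> r0; rewrite /poi_mass /Int /Rintegral; congr fine.
have cp := continuous_poi r0.
rewrite -(integral_plane_shift true (- x.2) cp (poi_ge0 r)).
have cp' : continuous (fun z => poi r (shiftc true (- x.2) z)).
  by apply: (@cts_comp _ _ _ (shiftc true (- x.2)) (poi r)) => //; exact: cts_shiftc.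
rewrite -(integral_plane_shift false (- x.1) cp' (fun z => poi_ge0 r _)).
apply: eq_integral => y _; congr EFin; rewrite /poi /kap /=.
by congr (_ * _^-1 ^+ 2); rewrite -[in LHS]sqrrN -[X in _ + X + _]sqrrN !opprB.
Qed.

Lemma poi_mass_bound r : 0 < r -> 8 / 9 <= poi_mass r <= 2 * pi ^+ 2.
Proof.
move=> r0; rewrite -(poi_massE 0 r0) Int_poi_ge//=.
by have [] := Int_poi 0 r0.
Qed.

(** Put om = v_x - u_y and q = v^2 - u^2. Since u_x + v_y = 0, om u = (u v)_x + q_y / 2 and om v =
    q_x / 2 - (u v)_y. Four integrations by parts move the derivatives to the gradient of [phi], and
    the symmetry of the mixed derivatives merges the two terms in q. *)
Lemma serfati_C1 (u v : plane -> R) (du dv : bool -> plane -> R)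
    (phi : plane -> R) (phi' : bool -> plane -> R) (phi'' : bool -> bool -> plane -> R) L X :
  continuous u -> continuous v -> (forall j, continuous (du j)) -> (forall j, continuous (dv j)) ->
  (forall j, D j u (du j)) -> (forall j, D j v (dv j)) -> (forall x, du false x + dv true x = 0) ->
  continuous phi -> supp L phi -> (forall i, continuous (phi' i)) ->
  (forall i j, continuous (phi'' i j)) -> (forall i, D i phi (phi' i)) ->
  (forall i j, D j (phi' i) (phi'' i j)) ->
  (forall x, phi'' true false x = phi'' false true x) ->
  (forall x, `|u x| <= X) -> (forall x, `|v x| <= X) ->
  `|Int (fun x => (dv false x - du true x) * (u x * phi' false x + v x * phi' true x))| <=
   X ^+ 2 * Int (fun x => `|phi'' false false x| + `|phi'' true true x| + 2 * `|phi'' false true x|).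
Proof.
move=> cu cv cdu cdv Du Dv div cp sp cp' cp'' dp dp' sym uX vX'.
have X0 : 0 <= X by apply: le_trans (uX 0).
have sp' i : supp L (phi' i) := D_supp (dp i) sp.
have sp'' i j : supp L (phi'' i j) := D_supp (dp' i j) (sp' i).
pose q x := v x * v x - u x * u x.
have cq : continuous q by rewrite /q; cts.
have Dq j : D j q (fun x => (dv j x * v x + v x * dv j x) - (du j x * u x + u x * du j x)).
  by apply: DB; exact: DM.
have c' i := cp' i; have c'' i j := cp'' i j.
have i1 := Int_D (ctsM (c' false) (ctsM cu cv)) _ (suppMl _ (sp' false))
  (DM (dp' false false) (DM (Du false) (Dv false))).
have i2 := Int_D (ctsM (c' false) cq) _ (suppMl _ (sp' false)) (DM (dp' false true) (Dq true)).
have i3 := Int_D (ctsM (c' true) cq) _ (suppMl _ (sp' true)) (DM (dp' true false) (Dq false)).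
have i4 := Int_D (ctsM (c' true) (ctsM cu cv)) _ (suppMl _ (sp' true))
  (DM (dp' true true) (DM (Du true) (Dv true))).
have lc (g : plane -> R) i : continuous g -> L1 (fun x => phi' i x * g x).
  by move=> cg; apply: (@L1_supp _ _ L); [cts; exact: c'|exact: suppMl].
have lc' (g : plane -> R) i j : continuous g -> L1 (fun x => phi'' i j x * g x).
  by move=> cg; apply: (@L1_supp _ _ L); [cts; exact: c''|exact: suppMl].
have tac1 j : continuous (fun x => du j x * v x + u x * dv j x).
  by cts_with ltac:(first [exact: cdu|exact: cdv]).
have tac2 j : continuous (fun x => (dv j x * v x + v x * dv j x) - (du j x * u x + u x * du j x)).
  by cts_with ltac:(first [exact: cdu|exact: cdv]).
have j1 := i1 (ctsD (ctsM (c'' false false) (ctsM cu cv)) (ctsM (c' false) (tac1 false))).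
have j2 := i2 (ctsD (ctsM (c'' false true) cq) (ctsM (c' false) (tac2 true))).
have j3 := i3 (ctsD (ctsM (c'' true false) cq) (ctsM (c' true) (tac2 false))).
have j4 := i4 (ctsD (ctsM (c'' true true) (ctsM cu cv)) (ctsM (c' true) (tac1 true))).
rewrite IntD in j1; [|by apply: lc'; exact: ctsM|exact: lc].
rewrite IntD in j2; [|exact: lc'|exact: lc].
rewrite IntD in j3; [|exact: lc'|exact: lc].
rewrite IntD in j4; [|by apply: lc'; exact: ctsM|exact: lc].
set A1 := Int (fun x => phi' false x * _) in j1.
set A2 := Int (fun x => phi' false x * _) in j2.
set A3 := Int (fun x => phi' true x * _) in j3.
set A4 := Int (fun x => phi' true x * _) in j4.
have E : Int (fun x => (dv false x - du true x) * (u x * phi' false x + v x * phi' true x)) =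
    A1 + 2^-1 * A2 + (2^-1 * A3 - A4).
  rewrite /A1 /A2 /A3 /A4 -!IntZ; [|exact: lc|exact: lc].
  rewrite -IntD; [|exact: lc|by apply: L1Z; exact: lc].
  rewrite -IntB; [|by apply: L1Z; exact: lc|exact: lc].
  rewrite -IntD; last first.
  - by apply: L1B; [apply: L1Z|]; exact: lc.
  - by apply: L1D; [|apply: L1Z]; exact: lc.
  apply: eq_Int => x.
  have -> : dv true x = - du false x by have := div x; lra.
  by rewrite /q; field.
have sE : Int (fun x => phi'' true false x * q x) = Int (fun x => phi'' false true x * q x).
  by apply: eq_Int => x; rewrite sym.
rewrite sE in j3.
have {}E : Int (fun x => (dv false x - du true x) * (u x * phi' false x + v x * phi' true x)) =
    Int (fun x => phi'' true true x * (u x * v x)) - Int (fun x => phi'' false false x * (u x * v x))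
    - Int (fun x => phi'' false true x * q x).
  rewrite E; lra.
rewrite E -IntB; [|by apply: lc'; exact: ctsM|by apply: lc'; exact: ctsM].
rewrite -IntB; [|by apply: L1B; apply: lc'; exact: ctsM|exact: lc'].
have la i j : L1 (fun x => `|phi'' i j x|) by apply/L1_abs/(@L1_supp _ _ L).
have lS : L1 (fun x => `|phi'' false false x| + `|phi'' true true x| + 2 * `|phi'' false true x|).
  by apply: L1D; [exact: L1D|exact: L1Z].
rewrite -IntZ//; apply: Int_abs_le; [|exact: L1Z|].
  by apply: L1_measurable; apply: L1B; [apply: L1B; apply: lc'; exact: ctsM|exact: lc'].
move=> x.
have uv : `|u x * v x| <= X ^+ 2 by rewrite normrM expr2 ler_pM.
have qX : `|q x| <= 2 * X ^+ 2.
  rewrite /q (le_trans (ler_normB _ _))// !normrM expr2.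
  have : `|u x| * `|u x| <= X * X by apply: ler_pM.
  have : `|v x| * `|v x| <= X * X by apply: ler_pM.
  lra.
apply: le_trans (ler_normB _ _) _; apply: le_trans (lerD (ler_normB _ _) (lexx _)) _.
rewrite !normrM.
have := ler_wpM2l (normr_ge0 (phi'' true true x)) uv.
have := ler_wpM2l (normr_ge0 (phi'' false false x)) uv.
have := ler_wpM2l (normr_ge0 (phi'' false true x)) qX.
rewrite normrM; lra.
Qed.

Variables (f : plane -> R) (M : R).
Hypotheses (cf : continuous f) (fM : forall y, `|f y| <= M) (fi : L1 f).

(** The factor 1 / (2 pi) of the Biot-Savart law is left out, so [vel] is 2 pi times the velocity;
    [BS1_vel] and [BS2_vel] restore it. *)
Definition vel i x := conv (K 0 i) f x.
Definition rvel r i x := conv (K r i) f x.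

Let M0 : 0 <= M. Proof. exact: le_trans (fM 0). Qed.

Lemma L1_Kr r i x : 0 < r -> L1 (fun y => K r i (x - y) * f y).
Proof.
move=> r0; apply: (@L1_conv _ _ _ r^-1) => //; last by move=> z; exact: K_le.
by apply: continuous_measurable_plane; exact: continuous_K.
Qed.

Lemma L1_Kdiff r i x : 0 < r -> L1 (fun y => (K r i (x - y) - K 0 i (x - y)) * f y).
Proof.
move=> r0; have [l _] := K_near i x r0.
apply: (@L1_le _ _ (fun y => M * `|K r i (x - y) - K 0 i (x - y)|)).
- apply: measurable_funM; last exact: L1_measurable.
  apply: measurable_funB.
    by apply: (measurable_kernel x); apply: continuous_measurable_plane; exact: continuous_K.
  by apply: (measurable_kernel x); exact: measurable_K0.
- by move=> y; rewrite normrM mulrC ler_wpM2r.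
- exact: L1Z.
Qed.

Lemma L1_K0 i x : L1 (fun y => K 0 i (x - y) * f y).
Proof.
have := L1B (L1_Kr i x ltr01) (L1_Kdiff i x ltr01).
by apply: eq_L1 => y; ring.
Qed.

Lemma vel_near r i x : 0 < r -> `|rvel r i x - vel i x| <= 6 * pi ^+ 2 * r * M.
Proof.
move=> r0; have [l h] := K_near i x r0.
rewrite /rvel /vel -convB; [|exact: L1_Kr|exact: L1_K0].
apply: le_trans (Int_abs_le (L1_measurable (L1_Kdiff i x r0)) (L1Z M l) _) _.
  by move=> y; rewrite normrM mulrC ler_wpM2r.
by rewrite IntZ// mulrC ler_wpM2r.
Qed.

Lemma rvel_le r i x : 0 < r -> `|rvel r i x| <= r^-1 * Int (fun y => `|f y|).
Proof.
move=> r0; rewrite -IntZ; last exact: L1_abs.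
apply: Int_abs_le; first exact: L1_measurable (L1_Kr i x r0).
  exact/L1Z/L1_abs.
by move=> y; rewrite normrM ler_wpM2r// K_le.
Qed.

(** Regularise at scale 1: the regularised kernel is bounded by 1 and pairs with the L^1 norm, and
    the rest of the kernel is integrable and pairs with the sup norm. *)
Lemma vel_le i x : `|vel i x| <= 6 * pi ^+ 2 * M + Int (fun y => `|f y|).
Proof.
have := vel_near i x ltr01; have := rvel_le i x ltr01.
rewrite invr1 mul1r mulr1 !ler_norml => /andP[h1 h2] /andP[h3 h4].
by apply/andP; split; lra.
Qed.

Lemma continuous_rvel r i : 0 < r -> continuous (rvel r i).
Proof.
move=> r0; apply: (continuous_conv (c := r^-1)) => //; first exact: continuous_K.
by move=> z; exact: K_le.
Qed.

Lemma D_rvel r i j : 0 < r -> D j (rvel r i) (conv (K' r i j) f).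
Proof.
move=> r0; apply: (@D_conv _ _ _ _ _ (r^-1 + 3 * (r ^+ 2)^-1)) => //.
- by apply: continuous_measurable_plane; exact: continuous_K.
- move=> z; rewrite (le_trans (K_le i z r0))// lerDl mulr_ge0// invr_ge0 sqr_ge0//.
- move=> z; rewrite (le_trans (K'_le i j z r0))// lerDr invr_ge0 ltW//.
- exact: D_K.
Qed.

Lemma L1_K' r i j x : 0 < r -> L1 (fun y => K' r i j (x - y) * f y).
Proof.
move=> r0; apply: (@L1_conv _ _ _ (3 * (r ^+ 2)^-1)) => //; last by move=> z; exact: K'_le.
by apply: continuous_measurable_plane; exact: continuous_K'.
Qed.

Lemma continuous_conv_K' r i j : 0 < r -> continuous (conv (K' r i j) f).
Proof.
move=> r0; apply: (continuous_conv (c := 3 * (r ^+ 2)^-1)) => //; first exact: continuous_K'.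
by move=> z; exact: K'_le.
Qed.

Lemma div_rvel r x : 0 < r -> conv (K' r false false) f x + conv (K' r true true) f x = 0.
Proof.
move=> r0; rewrite /conv -IntD; [|exact: L1_K'|exact: L1_K'].
rewrite -[RHS](@Int0 R); apply: eq_Int => y.
by rewrite -mulrDl div_K mul0r.
Qed.

Lemma curl_rvel r x : 0 < r ->
  conv (K' r true false) f x - conv (K' r false true) f x = conv (poi r) f x.
Proof.
move=> r0; rewrite /conv -IntB; [|exact: L1_K'|exact: L1_K'].
by apply: eq_Int => y; rewrite -mulrBl curl_K.
Qed.

(** [vel] is a uniform limit of the continuous [rvel r] as [r] tends to 0. The scale is chosen to
    make that error at most [e / 4], with [M + 1] guarding against [M = 0]. *)
Lemma continuous_vel i : continuous (vel i).
Proof.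
move=> x; apply/continuous_ballP => e e0.
pose r := e / (4 * (6 * pi ^+ 2 * (M + 1))).
have p0 : 0 < pi ^+ 2 :> R by rewrite exprn_gt0// pi_gt0.
have M1 : 0 < M + 1 by rewrite ltr_wpDl.
have c0 : 0 < 4 * (6 * pi ^+ 2 * (M + 1)) by rewrite mulr_gt0// mulr_gt0// mulr_gt0.
have r0 : 0 < r by rewrite divr_gt0.
have re : 6 * pi ^+ 2 * r * M <= e / 4.
  have -> : e / 4 = 6 * pi ^+ 2 * r * (M + 1).
    rewrite /r; move: (pi ^+ 2) p0 => p p0; field; rewrite gt_eqF//= gt_eqF//.
  by rewrite ler_wpM2l ?lerDl//; apply: mulr_ge0; [apply: mulr_ge0 => //|]; exact: ltW.
have [d d0 hd] := (continuous_ballP (rvel r i) x).1 (@continuous_rvel r i r0 x) (e / 2) ltac:(by rewrite divr_gt0).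
exists d => // y /hd.
have := vel_near i x r0; have := vel_near i y r0.
rewrite !ler_norml !ltr_norml => /andP[h1 h2] /andP[h3 h4] /andP[h5 h6].
by apply/andP; split; lra.
Qed.

(** The vorticity is merely continuous and [vel] need not be differentiable, so zero divergence is
    stated weakly. It is exact for [rvel r], and [r] is then sent to 0. *)
Lemma vel_divfree (psi : plane -> R) (psi' : bool -> plane -> R) L : continuous psi ->
  supp L psi -> (forall i, continuous (psi' i)) -> (forall i, D i psi (psi' i)) ->
  Int (fun x => vel false x * psi' false x + vel true x * psi' true x) = 0.
Proof.
move=> cp sp cp' dp.
have sp' i : supp L (psi' i) := D_supp (dp i) sp.
have cv := continuous_vel.
have lv i : L1 (fun x => vel i x * psi' i x).
  by apply: (@L1_supp _ _ L); [cts_with ltac:(first [exact: cv|exact: cp'])|exact: suppMr].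
have lp i : L1 (fun x => `|psi' i x|) by apply/L1_abs/(@L1_supp _ _ L).
pose B := Int (fun x => `|psi' false x| + `|psi' true x|).
have B0 : 0 <= B by apply: Int_ge0 => x; rewrite addr_ge0.
have H r : 0 < r -> `|Int (fun x => vel false x * psi' false x + vel true x * psi' true x)| <= 6 * pi ^+ 2 * r * M * B.
  move=> r0.
  have cr i := @continuous_rvel r i r0.
  have lr i : L1 (fun x => rvel r i x * psi' i x).
    by apply: (@L1_supp _ _ L); [cts_with ltac:(first [exact: cr|exact: cp'])|exact: suppMr].
  have E i : Int (fun x => rvel r i x * psi' i x) = - Int (fun x => conv (K' r i i) f x * psi x).
    exact: (Int_parts (cr i) (@continuous_conv_K' r i i r0) cp (cp' i) sp (D_rvel i i r0) (dp i)).
  have lk i : L1 (fun x => conv (K' r i i) f x * psi x).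
    by apply: (@L1_supp _ _ L); [cts_with ltac:(exact: continuous_conv_K')|exact: suppMr].
  have Z : Int (fun x => rvel r false x * psi' false x + rvel r true x * psi' true x) = 0.
    rewrite (IntD (lr false) (lr true)) !E -opprD -(IntD (lk false) (lk true)).
    apply/eqP; rewrite oppr_eq0; apply/eqP; rewrite -[RHS](@Int0 R); apply: eq_Int => x.
    by rewrite -mulrDl div_rvel// mul0r.
  rewrite -[Int _]subr0 -Z -IntB; [|exact: L1D|exact: L1D].
  rewrite /B -IntZ; last exact: L1D.
  apply: Int_abs_le.
  - by apply: L1_measurable; apply: L1B; exact: L1D.
  - by apply: L1Z; exact: L1D.
  - move=> x.
    rewrite (_ : _ - _ = - ((rvel r false x - vel false x) * psi' false x + (rvel r true x - vel true x) * psi' true x)); last by ring.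
    rewrite normrN mulrDr (le_trans (ler_normD _ _))// !normrM lerD// ler_wpM2r// vel_near//.
have p0 : 0 < pi ^+ 2 :> R by rewrite exprn_gt0// pi_gt0.
apply/eqP; rewrite -normr_le0; apply/ler_addgt0Pr => e e0; rewrite add0r.
have c0 : 0 <= 6 * pi ^+ 2 * M * B.
  by apply: mulr_ge0 => //; apply: mulr_ge0 => //; apply: mulr_ge0 => //; exact: ltW.
have c1 : 0 < 6 * pi ^+ 2 * M * B + 1 by rewrite ltr_wpDl.
apply: le_trans (H (e / (6 * pi ^+ 2 * M * B + 1)) _) _; first by rewrite divr_gt0.
rewrite (_ : _ * M * B = e * ((6 * pi ^+ 2 * M * B) / (6 * pi ^+ 2 * M * B + 1))); last by ring.
rewrite -[leRHS]mulr1 ler_pM2l// ler_pdivrMr// mul1r; lra.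
Qed.

(* Serfati's estimate: [f] is a multiple of the curl of [v = vel], and [curl v * (v . grad phi)] is, up to
   a divergence, quadratic in [v] and linear in the second derivatives of [phi]. *)
Lemma serfati (phi : plane -> R) (phi' : bool -> plane -> R) (phi'' : bool -> bool -> plane -> R) L X :
  continuous phi -> supp L phi -> (forall i, continuous (phi' i)) ->
  (forall i j, continuous (phi'' i j)) -> (forall i, D i phi (phi' i)) ->
  (forall i j, D j (phi' i) (phi'' i j)) ->
  (forall x, phi'' true false x = phi'' false true x) ->
  (forall i x, `|vel i x| <= X) ->
  `|Int (fun x => f x * (vel false x * phi' false x + vel true x * phi' true x))| <=
   2 * X ^+ 2 * Int (fun x => `|phi'' false false x| + `|phi'' true true x| + 2 * `|phi'' false true x|).
Proof.
move=> cp sp cp' cp'' dp dp' sym vX.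
have X0 : 0 <= X by apply: le_trans (vX false 0).
pose S := Int (fun x => `|phi'' false false x| + `|phi'' true true x| + 2 * `|phi'' false true x|).
rewrite -/S.
have S0 : 0 <= S by apply: Int_ge0 => x; rewrite !addr_ge0// mulr_ge0.
have sp' i : supp L (phi' i) := D_supp (dp i) sp.
have c' i := cp' i.
pose s (n : nat) : R := n.+1%:R^-1.
have s0 n : 0 < s n by rewrite invr_gt0.
have s1 n : s n <= 1 by rewrite invf_le1// ler1n.
have cs : s @ \oo --> 0 by exact: cvg_harmonic.
pose C : R := 6 * pi ^+ 2 * M.
have p0 : 0 <= pi ^+ 2 :> R by rewrite sqr_ge0.
have C0 : 0 <= C by apply: mulr_ge0 => //; exact: mulr_ge0.
have near n i x : `|rvel (s n) i x - vel i x| <= C * s n.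
  by have := vel_near i x (s0 n); rewrite /C; lra.
have rX n i x : `|rvel (s n) i x| <= X + C * s n.
  have := near n i x; have := vX i x; rewrite !ler_norml => /andP[a1 a2] /andP[b1 b2].
  by apply/andP; split; lra.
(* The integrand at scale [s n]: [conv (poi (s n)) f] is the curl of the regularised velocity, so
   [serfati_C1] applies to it exactly. *)
pose a n x := conv (poi (s n)) f x * (rvel (s n) false x * phi' false x + rvel (s n) true x * phi' true x).
pose T x := f x * (vel false x * phi' false x + vel true x * phi' true x).
have ha n : `|Int (a n)| <= (X + C * s n) ^+ 2 * S.
  have -> : Int (a n) = Int (fun x => (conv (K' (s n) true false) f x - conv (K' (s n) false true) f x) *
      (rvel (s n) false x * phi' false x + rvel (s n) true x * phi' true x)).
    by apply: eq_Int => x; rewrite curl_rvel.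
  apply: (@serfati_C1 _ _ (fun j => conv (K' (s n) false j) f) (fun j => conv (K' (s n) true j) f) phi phi' phi'' L) => //.
  - exact: continuous_rvel.
  - exact: continuous_rvel.
  - by move=> j; exact: continuous_conv_K'.
  - by move=> j; exact: continuous_conv_K'.
  - by move=> j; exact: D_rvel.
  - by move=> j; exact: D_rvel.
  - by move=> x; exact: div_rvel.
have cv := continuous_vel.
have ccp n : continuous (conv (poi (s n)) f).
  apply: (continuous_conv (c := 2 * (s n ^+ 2)^-1)) => //; first exact: continuous_poi.
  by move=> z; rewrite ger0_norm ?poi_ge0// poi_le.
have ca n : continuous (a n).
  apply: (ctsM (ccp n)); apply: ctsD; apply: ctsM; try exact: c'.
    exact: continuous_rvel.
  exact: continuous_rvel.
have cT : continuous T.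
  by apply: (ctsM cf); apply: ctsD; apply: ctsM; first [exact: cv|exact: c'].
have sa n : supp L (a n) by apply: suppMr; apply: suppD; exact: suppMr.
have sT : supp L T by apply: suppMr; apply: suppD; exact: suppMr.
have la n := L1_supp (ca n) (sa n); have lT := L1_supp cT sT.
have poiM n x : `|conv (poi (s n)) f x| <= 2 * pi ^+ 2 * M.
  have [l h] := Int_poi x (s0 n).
  apply: le_trans (Int_abs_le (g := fun y => M * poi (s n) (x - y)) _ _ _) _.
  - apply: L1_measurable; apply: (@L1_conv _ _ _ (2 * (s n ^+ 2)^-1)) => //.
      by apply: continuous_measurable_plane; exact: continuous_poi.
    by move=> z; rewrite ger0_norm ?poi_ge0// poi_le.
  - exact: L1Z.
  - by move=> y; rewrite normrM mulrC ler_pM// ger0_norm// poi_ge0.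
  - by rewrite IntZ// mulrC ler_wpM2r.
pose G x := 2 * pi ^+ 2 * M * ((X + C) * `|phi' false x| + (X + C) * `|phi' true x|)
   + 2 * pi ^+ 2 * (M * (X * `|phi' false x| + X * `|phi' true x|)).
have lG : L1 G.
  have lp i : L1 (fun x => `|phi' i x|) by apply/L1_abs/(@L1_supp _ _ L).
  by apply: L1D; [apply: L1Z; apply: L1D; exact: L1Z|do 2 apply: L1Z; apply: L1D; exact: L1Z].
pose m n := poi_mass (s n).
have mb n : 8 / 9 <= m n <= 2 * pi ^+ 2 by exact: poi_mass_bound.
clearbody C.
pose Z : plane -> R := fun=> 0.
(* The masses [m n] are only known to stay within fixed bounds, so what is shown to tend to 0 is the
   difference with [m n * T]. *)
have [_ lim] : L1 Z /\ (fun n => Int (fun x => a n x - m n * T x)) @ \oo --> Int Z.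
  apply: (@Int_dominated _ (fun n x => a n x - m n * T x) Z G) => //.
  - move=> n; apply: L1_measurable; apply: L1B => //; exact: L1Z.
  - move=> n x; rewrite (le_trans (ler_normB _ _))// !normrM lerD//.
      apply: ler_pM => //; apply: le_trans (ler_normD _ _) _; rewrite !normrM.
      have h i : `|rvel (s n) i x| <= X + C.
        by rewrite (le_trans (rX n i x))// lerD2l// ler_piMr.
      by apply: lerD; rewrite ler_wpM2r.
    have /andP[m1 m2] := mb n.
    apply: ler_pM => //; first by rewrite ger0_norm//; lra.
    apply: ler_pM => //; apply: le_trans (ler_normD _ _) _; rewrite !normrM.
    by apply: lerD; rewrite ler_wpM2r.
  - move=> x.
    have c1 : (fun n => (conv (poi (s n)) f x - m n * f x) * (vel false x * phi' false x + vel true x * phi' true x))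
        @ \oo --> 0 * (vel false x * phi' false x + vel true x * phi' true x).
      apply: cvgMl; have := conv_poi_cvg x fi cf fM s0 cs.
      by under eq_fun do rewrite poi_massE//.
    rewrite mul0r in c1.
    have c2 : (fun n => conv (poi (s n)) f x * ((rvel (s n) false x - vel false x) * phi' false x + (rvel (s n) true x - vel true x) * phi' true x)) @ \oo --> (0 : R).
      have c3 : (fun n => 2 * pi ^+ 2 * M * (C * (`|phi' false x| + `|phi' true x|)) * s n) @ \oo --> 2 * pi ^+ 2 * M * (C * (`|phi' false x| + `|phi' true x|)) * 0.
        exact: cvgMr.
      rewrite mulr0 in c3; apply: norm_cvg0.
      apply: (@squeeze_cvgr _ _ _ _ (cst 0) _ _ _ _ _ c3); last exact: cvg_cst.
      apply: nearW => n; rewrite normr_ge0 normrM /=.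
      apply: (@le_trans _ _ ((2 * pi ^+ 2 * M) * (C * s n * `|phi' false x| + C * s n * `|phi' true x|))); last first.
        by rewrite le_eqVlt; apply/orP; left; apply/eqP; ring.
      apply: ler_pM => //; apply: le_trans (ler_normD _ _) _; rewrite !normrM.
      by apply: lerD; rewrite ler_wpM2r.
    have c4 := cvgD c1 c2; rewrite addr0 in c4.
    change ((fun n : nat => a n x - m n * T x) @ \oo --> (0 : R)).
    have -> : (fun n : nat => a n x - m n * T x) = (fun n => (conv (poi (s n)) f x - m n * f x) *
        (vel false x * phi' false x + vel true x * phi' true x) + conv (poi (s n)) f x *
        ((rvel (s n) false x - vel false x) * phi' false x + (rvel (s n) true x - vel true x) * phi' true x)).
      by apply/funext => n; rewrite /a /T; ring.
    exact: c4.
have Z0 : Int Z = 0 by exact: Int0.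
rewrite Z0 in lim.
(* The lower bound 8 / 9 of the masses allows division by them; the resulting factor 9 / 8 is
   rounded up to the 2 of the statement. *)
have bound n : 8 / 9 * `|Int T| <= (X + C * s n) ^+ 2 * S + `|Int (fun x => a n x - m n * T x)|.
  have /andP[m1 m2] := mb n.
  apply: (@le_trans _ _ (`|m n * Int T|)).
    by rewrite normrM ler_wpM2r// (le_trans m1)// ler_norm.
  rewrite -IntZ// (_ : Int (fun x => m n * T x) = Int (a n) - Int (fun x => a n x - m n * T x)); last first.
    by rewrite IntB; [ring|exact: la|exact: L1Z].
  by rewrite (le_trans (ler_normB _ _))// lerD2r.
have limR : (fun n => (X + C * s n) ^+ 2 * S + `|Int (fun x => a n x - m n * T x)|) @ \oo --> (X + C * 0) ^+ 2 * S + `|0 : R|.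
  apply: cvgD; last exact: cvg_norm.
  apply: cvgMl; have c1 : (fun n => X + C * s n) @ \oo --> X + C * 0.
    by apply: cvgD; [exact: cvg_cst|exact: cvgMr].
  exact: (cvgM c1 c1).
rewrite mulr0 addr0 normr0 addr0 in limR.
have : 8 / 9 * `|Int T| <= X ^+ 2 * S.
  rewrite -(cvg_lim _ limR)//; apply: limr_ge; first by apply/cvg_ex; eexists; exact: limR.
  exact: nearW.
have : 0 <= X ^+ 2 * S by rewrite mulr_ge0// sqr_ge0.
rewrite /T; lra.
Qed.

End BiotSavartVelocity.

(** * Compactly supported truncations of the regularised kernel *)

Section TestFunctions.
Context {R : realType}.
Local Notation plane := (R * R)%type.
Implicit Types (i j : bool) (x y z : plane).

Definition sqn z : R := z.1 ^+ 2 + z.2 ^+ 2.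

Lemma sqn_ge0 z : 0 <= sqn z.
Proof. by rewrite addr_ge0// sqr_ge0. Qed.

Lemma D_sqn j : D j sqn (fun z => 2 * coord j z).
Proof. by apply: eq_D (D_den 0 j) => // z; rewrite expr0n addr0. Qed.

Section Cutoff.
Variables (L : R).
Hypothesis L0 : 0 < L.

(** A truncated power of 1 - |z|^2 / L^2. Differentiation lowers [n], so [cutoff L 3] is of class
    C^2 with derivatives in the same family. *)
Definition cutoff n z : R := pospow n (1 - sqn z / L ^+ 2).

Lemma continuous_cutoff n : continuous (cutoff n).
Proof.
apply: (@cts_comp _ _ _ (fun z : plane => 1 - sqn z / L ^+ 2) (pospow n)); last exact: continuous_pospow.
by rewrite /sqn; cts.
Qed.

Lemma D_cutoff n j : D j (cutoff n.+2)
  (fun z => 2 * coord j z * (- (n.+2%:R / L ^+ 2) * cutoff n.+1 z)).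
Proof.
have h : D j (fun z => 1 - sqn z / L ^+ 2) (fun z => 0 - (2 * coord j z * (L ^+ 2)^-1 + sqn z * 0)).
  by apply: DB; [exact: Dcst|apply: DM; [exact: D_sqn|exact: Dcst]].
apply: eq_D (Dcomp (@is_derive_pospow R n) h) => // z.
by rewrite /cutoff; ring.
Qed.

Lemma cutoff_ge0 n z : 0 <= cutoff n z.
Proof. exact: pospow_ge0. Qed.

Lemma cutoff_le1 n z : cutoff n z <= 1.
Proof.
rewrite /cutoff /pospow exprn_ile1// ?le_max ?lexx ?orbT// ge_max ler01 andbT.
by rewrite lerBlDr lerDl divr_ge0 ?sqn_ge0 ?sqr_ge0.
Qed.

Lemma cutoff_out n z : L ^+ 2 <= sqn z -> cutoff n.+1 z = 0.
Proof.
move=> h; apply: pospow0; rewrite subr_le0 ler_pdivlMr ?exprn_gt0//.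
by rewrite mul1r.
Qed.

Lemma cutoff_supp n : supp L (cutoff n.+1).
Proof.
move=> z zL; apply: cutoff_out.
have q (a : R) : L < `|a| -> L ^+ 2 <= a ^+ 2.
  by move=> h; rewrite -(real_normK (num_real a)) !expr2; apply: ler_pM => //; exact: ltW.
move: zL; rewrite negb_and -!ltNge => /orP[] /q h; apply: le_trans h _.
  by rewrite /sqn lerDl sqr_ge0.
by rewrite /sqn lerDr sqr_ge0.
Qed.

Lemma coord_cutoff n j z : `|coord j z| * cutoff n.+1 z <= L.
Proof.
have [h|h] := leP (L ^+ 2) (sqn z).
  by rewrite cutoff_out// mulr0 ltW.
apply: (@le_trans _ _ (L * 1)); last by rewrite mulr1.
apply: ler_pM => //; [exact: cutoff_ge0| |exact: cutoff_le1].
rewrite -(@ler_pXn2r _ 2)// ?nnegrE ?normr_ge0 ?(ltW L0)// real_normK ?num_real// ltW//.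
by apply: le_lt_trans h; rewrite /sqn; case: j => /=; rewrite ?lerDl ?lerDr sqr_ge0.
Qed.

End Cutoff.

Lemma cutoff_cvg (s : nat -> R) n z : (forall k, 0 < s k) -> (fun k => (s k)^-1) @ \oo --> 0 ->
  (fun k => cutoff (s k) n z) @ \oo --> (1 : R).
Proof.
move=> s0 cs.
have c1 : (fun k => 1 - sqn z * ((s k)^-1 * (s k)^-1)) @ \oo --> 1 - sqn z * (0 * 0).
  by apply: cvgB; [exact: cvg_cst|apply: cvgMr; exact: cvgM].
rewrite mulr0 mulr0 subr0 in c1.
have -> : 1 = pospow n (1 : R) by rewrite pospowE// expr1n.
have E : (fun k => cutoff (s k) n z) = pospow n \o (fun k => 1 - sqn z * ((s k)^-1 * (s k)^-1)).
  by apply/funext => k; rewrite /cutoff /= -invfM -expr2.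
by rewrite E; apply: (cvg_comp _ _ c1); exact: continuous_pospow.
Qed.

(* A smooth compactly supported approximation of the kernel: the derivatives of
   rad0, rad1 are 2 z rad1, 2 z rad2, as for functions of |z|^2. *)
Section Radial.
Variables (L r : R).
Hypotheses (r0 : 0 < r) (rL : r <= L).

Let L0 : 0 < L. Proof. exact: lt_le_trans rL. Qed.

Definition rad0 z := cutoff L 3 z * kap r z.
Definition rad1 z := - (3 / L ^+ 2) * cutoff L 2 z * kap r z - cutoff L 3 z * kap r z ^+ 2.
Definition rad2 z := 6 / L ^+ 2 / L ^+ 2 * cutoff L 1 z * kap r z
  + 6 / L ^+ 2 * cutoff L 2 z * kap r z ^+ 2 + 2 * cutoff L 3 z * kap r z ^+ 3.

Let cc n : continuous (cutoff L n). Proof. exact: continuous_cutoff. Qed.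
Let ck : continuous (kap r). Proof. exact: continuous_kap. Qed.

Lemma continuous_rad0 : continuous rad0.
Proof. by rewrite /rad0; cts_with ltac:(exact: cc). Qed.
Lemma continuous_rad1 : continuous rad1.
Proof. by rewrite /rad1; cts_with ltac:(exact: cc). Qed.
Lemma continuous_rad2 : continuous rad2.
Proof. by rewrite /rad2; cts_with ltac:(exact: cc). Qed.

Lemma D_rad0 j : D j rad0 (fun z => 2 * coord j z * rad1 z).
Proof.
apply: eq_D (DM (D_cutoff L 1 j) (D_kap j r0)) => // z.
by rewrite /rad1; ring.
Qed.

Lemma D_rad1 j : D j rad1 (fun z => 2 * coord j z * rad2 z).
Proof.
have h1 := DM (DZ (- (3 / L ^+ 2)) (D_cutoff L 0 j)) (D_kap j r0).
have h2 := DM (D_cutoff L 1 j) (DM (D_kap j r0) (D_kap j r0)).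
apply: eq_D (DB h1 h2) => z; first by rewrite /rad1 expr2.
by rewrite /rad2; ring.
Qed.

(** On the support of the cut-off |z| < L, and [r <= L], so 1 / L^2 is at most twice [kap r]. A
    derivative that falls on the cut-off is thus no worse than one that falls on the kernel, and the
    bounds below do not depend on [L]. *)
Lemma inv_L2_kap n z : cutoff L n.+1 z * (L ^+ 2)^-1 <= cutoff L n.+1 z * (2 * kap r z).
Proof.
have [h|h] := leP (L ^+ 2) (sqn z); first by rewrite cutoff_out// !mul0r.
rewrite ler_wpM2l ?cutoff_ge0// /kap -[2]invrK -invfM lef_pV2 ?posrE ?mulr_gt0 ?exprn_gt0 ?den_gt0//.
have : r ^+ 2 <= L ^+ 2 by rewrite !expr2; apply: ler_pM => //; exact: ltW.
by move: h; rewrite /sqn; lra.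
Qed.

Lemma rad1_le z : `|rad1 z| <= 7 * kap r z ^+ 2.
Proof.
have k0 := kap_gt0 z r0.
have h := ler_wpM2r (ltW k0) (inv_L2_kap 1 z).
have c2 := cutoff_le1 L 2 z; have c3 := cutoff_le1 L 3 z.
have p2 := cutoff_ge0 L 2 z; have p3 := cutoff_ge0 L 3 z.
have kk : 0 < kap r z ^+ 2 by rewrite exprn_gt0.
have a3 : cutoff L 3 z * kap r z ^+ 2 <= kap r z ^+ 2 by rewrite ler_piMl// ltW.
have b3 : 0 <= cutoff L 3 z * kap r z ^+ 2 by rewrite mulr_ge0// ltW.
have a2 : cutoff L 2 z * kap r z ^+ 2 <= kap r z ^+ 2 by rewrite ler_piMl// ltW.
have b2 : 0 <= cutoff L 2 z * (L ^+ 2)^-1 * kap r z.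
  by apply: mulr_ge0; [apply: mulr_ge0 => //; rewrite invr_ge0; exact: sqr_ge0|exact: ltW].
rewrite /rad1 ler_norml; apply/andP; split; rewrite ?expr2 in a2 a3 b3 kk h *; lra.
Qed.

(** Each 1 / L^2 is traded for [2 * kap r z]: 38 = 6 * 4 + 6 * 2 + 2. *)
Lemma rad2_le z : `|rad2 z| <= 38 * kap r z ^+ 3.
Proof.
have k0 := kap_gt0 z r0.
have i0 : 0 <= (L ^+ 2)^-1 by rewrite invr_ge0 sqr_ge0.
have h2 := inv_L2_kap 1 z; have h1 := inv_L2_kap 0 z.
have c1 := cutoff_le1 L 1 z; have c2 := cutoff_le1 L 2 z; have c3 := cutoff_le1 L 3 z.
have p1 := cutoff_ge0 L 1 z; have p2 := cutoff_ge0 L 2 z; have p3 := cutoff_ge0 L 3 z.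
have kk2 : 0 < kap r z ^+ 2 by rewrite exprn_gt0.
have kk3 : 0 < kap r z ^+ 3 by rewrite exprn_gt0.
have e1 : cutoff L 1 z * (L ^+ 2)^-1 * (L ^+ 2)^-1 <= 4 * kap r z ^+ 2.
  apply: (@le_trans _ _ (cutoff L 1 z * (2 * kap r z) * (L ^+ 2)^-1)); first by rewrite ler_wpM2r.
  rewrite mulrAC; apply: (@le_trans _ _ (cutoff L 1 z * (2 * kap r z) * (2 * kap r z))).
    by rewrite ler_wpM2r// mulr_ge0// ltW.
  rewrite [leLHS](_ : _ = cutoff L 1 z * (4 * kap r z ^+ 2)); last by ring.
  by rewrite ler_piMl// mulr_ge0// ltW.
have e1' := ler_wpM2r (ltW k0) e1.
have e2 : cutoff L 2 z * (L ^+ 2)^-1 <= 2 * kap r z.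
  by apply: le_trans h2 _; rewrite ler_piMl// mulr_ge0// ltW.
have e2' := ler_wpM2r (ltW kk2) e2.
have e3 : cutoff L 3 z * kap r z ^+ 3 <= kap r z ^+ 3 by rewrite ler_piMl// ltW.
have q1 : 0 <= cutoff L 1 z * (L ^+ 2)^-1 * (L ^+ 2)^-1 * kap r z.
  by apply: mulr_ge0; [apply: mulr_ge0 => //; exact: mulr_ge0|exact: ltW].
have q2 : 0 <= cutoff L 2 z * (L ^+ 2)^-1 * kap r z ^+ 2.
  by apply: mulr_ge0; [exact: mulr_ge0|exact: ltW].
have q3 : 0 <= cutoff L 3 z * kap r z ^+ 3 by apply: mulr_ge0 => //; exact: ltW.
rewrite /rad2 ger0_norm.
  rewrite ?exprS ?expr0 ?mulr1 in e1' e2' e3 *; lra.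
rewrite !(mulrAC _ (_^-1) (cutoff _ _ _)); lra.
Qed.

Variables (c1 c2 : R).
Hypotheses (c1_le : `|c1| <= 1) (c2_le : `|c2| <= 1) (c12 : c1 = 0 \/ c2 = 0).

(** For (c1, c2) equal to (-1, 0) or (0, 1), [lin z * kap r z] is a component of the kernel [K r] at
    the point [- z], so [tst0] is that component truncated at radius [L]. *)
Definition lin z : R := c1 * z.1 + c2 * z.2.
Definition cf j : R := if j then c2 else c1.
Definition tst0 z := lin z * rad0 z.
Definition tst1 j z := cf j * rad0 z + 2 * coord j z * lin z * rad1 z.
Definition tst2 j l z := 2 * cf j * coord l z * rad1 z + 2 * (j == l)%:R * lin z * rad1 z
  + 2 * coord j z * cf l * rad1 z + 4 * coord j z * coord l z * lin z * rad2 z.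

Lemma D_lin j : D j lin (fun=> cf j).
Proof.
case: j; [apply: eq_D (DD (DZ c1 Dfst0) (DZ c2 Dsnd))|apply: eq_D (DD (DZ c1 Dfst) (DZ c2 Dsnd0))] => // z /=; by rewrite /cf; ring.
Qed.

Lemma continuous_lin : continuous lin.
Proof. by rewrite /lin; cts. Qed.

Let cco j : continuous (@coord R j). Proof. exact: cts_coord. Qed.

Lemma continuous_tst0 : continuous tst0.
Proof. exact: (ctsM continuous_lin continuous_rad0). Qed.

Lemma continuous_tst1 j : continuous (tst1 j).
Proof.
have c0 := continuous_lin; have cr0 := continuous_rad0; have cr1 := continuous_rad1.
by rewrite /tst1; cts_with ltac:(exact: cco).
Qed.

Lemma continuous_tst2 j l : continuous (tst2 j l).
Proof.
have c0 := continuous_lin; have cr2 := continuous_rad2; have cr1 := continuous_rad1.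
by rewrite /tst2; cts_with ltac:(exact: cco).
Qed.

Lemma D_tst0 j : D j tst0 (tst1 j).
Proof.
by apply: eq_D (DM (D_lin j) (D_rad0 j)) => // z; rewrite /tst1; ring.
Qed.

Lemma D_tst1 j l : D l (tst1 j) (tst2 j l).
Proof.
have h1 := DZ (cf j) (D_rad0 l).
have h2 := DM (DM (DZ 2 (Dcoord l j)) (D_lin l)) (D_rad1 l).
apply: eq_D (DD h1 h2) => // z; rewrite /tst2 (eq_sym j l); ring.
Qed.

Lemma tst2_sym z : tst2 true false z = tst2 false true z.
Proof. by rewrite /tst2 /=; ring. Qed.

Lemma tst_supp : supp L tst0.
Proof. by move=> z zL; rewrite /tst0 /rad0 cutoff_supp// mul0r mulr0. Qed.

Lemma lin_le z : exists j, `|lin z| <= `|coord j z|.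
Proof.
rewrite /lin; case: c12 => ->; [exists true|exists false];
  by rewrite mul0r ?add0r ?addr0 normrM ler_piMl.
Qed.

Lemma tst0_le z : `|tst0 z| <= r^-1.
Proof.
have k0 := kap_gt0 z r0.
have [j hj] := lin_le z.
have := K_le (~~ j) z r0; rewrite KE negbK normrM [`|kap _ _|]gtr0_norm// normrM.
rewrite (_ : `|if ~~ j then 1 else -1| = 1) ?mul1r; last by case: (j); rewrite ?normrN normr1.
apply: le_trans; rewrite /tst0 normrM (_ : `|rad0 z| = cutoff L 3 z * kap r z); last first.
  by rewrite ger0_norm//; apply: mulr_ge0; [exact: cutoff_ge0|exact: ltW].
rewrite mulrA; apply: ler_wpM2r; first exact: ltW.
by apply: le_trans hj; rewrite ler_piMr// cutoff_le1.
Qed.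

(** Every term reduces to |z| [kap]^2, because [kap] absorbs two coordinates; 194 = 3 * 14 + 4 * 38.
    Independence of [L] lets the truncation be removed later. *)
Lemma tst2_le j l z : `|tst2 j l z| <= 194 * hr r z.
Proof.
have k0 := kap_gt0 z r0.
have kk : 0 <= kap r z ^+ 2 by rewrite exprn_ge0// ltW.
have [m hm] := lin_le z.
have b n : `|coord n z| * `|rad1 z| <= 7 * hr r z.
  apply: (@le_trans _ _ (`|coord n z| * (7 * kap r z ^+ 2))); first by rewrite ler_wpM2l// rad1_le.
  by rewrite mulrCA ler_wpM2l// coord_hr.
have cf1 n : `|cf n| <= 1 by case: n.
have h0 : 0 <= hr r z := hr_ge0 z r0.
have t1 : `|2 * cf j * coord l z * rad1 z| <= 14 * hr r z.
  rewrite !normrM ger0_norm// -mulrA; have := b l.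
  have p : 0 <= `|coord l z| * `|rad1 z| by exact: mulr_ge0.
  have := ler_wpM2r p (cf1 j); lra.
have t2 : `|2 * (j == l)%:R * lin z * rad1 z| <= 14 * hr r z.
  rewrite !normrM ger0_norm// -mulrA.
  have e1 : `|(j == l)%:R : R| <= 1 by case: (j == l); rewrite ?normr1 ?normr0.
  have p : 0 <= `|lin z| * `|rad1 z| by exact: mulr_ge0.
  have := ler_wpM2r p e1; have := ler_wpM2r (normr_ge0 (rad1 z)) hm; have := b m; lra.
have t3 : `|2 * coord j z * cf l * rad1 z| <= 14 * hr r z.
  rewrite !normrM ger0_norm//; have := b j.
  have p : 0 <= `|coord j z| * `|rad1 z| by exact: mulr_ge0.
  have := ler_wpM2r p (cf1 l); lra.
have t4 : `|4 * coord j z * coord l z * lin z * rad2 z| <= 152 * hr r z.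
  have E : 4 * coord j z * coord l z * lin z * rad2 z = 4 * ((coord j z * coord l z) * (lin z * rad2 z)) by ring.
  rewrite E normrM ger0_norm// normrM.
  have e2 : `|lin z * rad2 z| <= 38 * (`|coord m z| * kap r z ^+ 3).
    rewrite normrM mulrCA; apply: ler_pM => //; exact: rad2_le.
  have e3 := ler_wpM2l (normr_ge0 (coord j z * coord l z)) e2.
  have e4 : `|coord j z * coord l z| * (38 * (`|coord m z| * kap r z ^+ 3)) <= 38 * hr r z.
    rewrite mulrCA ler_wpM2l// exprS.
    rewrite [leLHS](_ : _ = (`|coord j z * coord l z| * kap r z) * (`|coord m z| * kap r z ^+ 2)); last by ring.
    apply: le_trans (coord_hr m z r0); rewrite ler_piMl//; last exact: coord_kap.
    by apply: mulr_ge0.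
  lra.
rewrite /tst2.
apply: le_trans (ler_normD _ _) _; apply: le_trans (lerD (ler_normD _ _) (lexx _)) _.
apply: le_trans (lerD (lerD (ler_normD _ _) (lexx _)) (lexx _)) _; lra.
Qed.

End Radial.

End TestFunctions.

(** * Boundedness of the velocity in time *)

Section ClassicalSolutions.
Context {R : realType}.
Local Notation plane := (R * R)%type.
Implicit Types (i j : bool) (x y z : plane).

Definition pd i (f : plane -> R -> R) : plane -> R -> R := if i then pd2 f else pd1 f.

Lemma continuous_at_slice (F : plane -> R -> R) (t : R) :
  (forall x, {for (x, t), continuous (fun p : plane * R => F p.1 p.2)}) ->
  continuous (fun x => F x t).
Proof.
move=> h x.
have c : continuous (fun x : plane => (x, t)) := @cts_pair plane plane R _ _ cts_id (@ctsC R plane t).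
exact (@continuous_comp plane (plane * R)%type R _ (fun p : plane * R => F p.1 p.2) x (c x) (h x)).
Qed.

Lemma is_derive_derive1 (F : R -> R) (x : R) : derivable F x 1 -> is_derive x (1 : R) F (derive1 F x).
Proof. by move=> h; split=> //; rewrite derive1E. Qed.

Section Facts.
Variables (f : plane -> R -> R) (t : R).
Hypotheses (cf : classical21 f) (t0 : 0 < t).

Lemma classical_continuous : continuous (f ^~ t).
Proof. by apply: continuous_at_slice => x; have [_ []] := cf x t0. Qed.

Lemma classical_continuous_pd i : continuous (pd i f ^~ t).
Proof.
case: i; apply: continuous_at_slice => x; have [_ [_ h1 h2 _ _]] := cf x t0; [exact h2|exact h1].
Qed.

Lemma classical_continuous_lap : continuous (lap f ^~ t).
Proof. by apply: continuous_at_slice => x; have [_ []] := cf x t0. Qed.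

Lemma classical_D i : D i (f ^~ t) (pd i f ^~ t).
Proof.
move=> x; have [[h1 h2 _ _ _] _] := cf x t0.
case: i; [exact (is_derive_derive1 h2)|exact (is_derive_derive1 h1)].
Qed.

Lemma classical_DD i : D i (pd i f ^~ t) (pd i (pd i f) ^~ t).
Proof.
move=> x; have [[_ _ h1 h2 _] _] := cf x t0.
case: i; [exact (is_derive_derive1 h2)|exact (is_derive_derive1 h1)].
Qed.

Lemma classical_pdt x : is_derive t (1 : R) (f x) (pdt f x t).
Proof. by have [[_ _ _ _ h] _] := cf x t0; exact: is_derive_derive1. Qed.

End Facts.

Lemma is_derive_Int_time (g g' : plane -> R -> R) (L t : R) : 0 < t ->
  (forall y (s : R), 0 < s -> is_derive s (1 : R) (g y) (g' y s)) ->
  (forall y (s : R), 0 < s -> {for (y, s), continuous (fun p : plane * R => g' p.1 p.2)}) ->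
  (forall s, 0 < s -> continuous (g ^~ s)) -> (forall s, 0 < s -> supp L (g ^~ s)) ->
  is_derive t (1 : R) (fun s => Int (g ^~ s)) (Int (g' ^~ t)).
Proof.
move=> t0 dg cg' cg sg.
have t20 : 0 < t / 2 by rewrite divr_gt0.
pose A : set (plane * R) := [set x : plane | inbox L x] `*` `[t / 2, 3 * t / 2].
have cA : compact A by apply: compact_setX; [exact: compact_inbox|exact: segment_compact].
have cwA : {within A, continuous (fun p : plane * R => g' p.1 p.2)}.
  apply: continuous_in_subspaceT => p; rewrite inE => -[_]; rewrite /= in_itv/= => /andP[h _].
  by have := cg' p.1 p.2 (lt_le_trans t20 h); rewrite -surjective_pairing.
have [C C0 hC] := compact_bounded_fun cA cwA.
have near0 s : `|s - t| < t / 2 -> 0 < s by rewrite ltr_norml => /andP[h1 h2]; lra.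
have sg' y s : 0 < s -> ~~ inbox L y -> g' y s = 0.
  move=> s0 yL; have H : \forall r \near s, (fun=> 0) r = g y r.
    by have := lt_nbhsr s0; apply: filterS => r r0; rewrite (sg r r0 y yL).
  have h0 := is_derive_near H (is_derive_cst (0:R) s (1:R)).
  by have [_ <-] := dg y s s0; have [_ <-] := h0.
pose G y := if inbox L y then C else 0.
have lG : L1 G.
  apply: (@L1_box _ C L).
  - rewrite /G; apply: measurable_fun_ifT => //.
    apply: (measurable_fun_bool true).
    rewrite setTI (_ : _ @^-1` _ = [set x : plane | inbox L x]); first exact: measurable_inbox.
    by apply/seteqP; split.
  - by move=> x; rewrite /G; case: ifP; rewrite ?normr0// ger0_norm.
  - by move=> x /negPf h; rewrite /G h.
apply: (@is_derive_Int _ (fun s y => g y s) (fun s y => g' y s) G t (t / 2)) => //.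
- by move=> s /near0 s0; exact: L1_supp (cg s s0) (sg s s0).
- by move=> s y /near0 s0; exact: dg.
- move=> s y st; rewrite /G; case: ifPn => yL; last by rewrite sg' ?normr0// near0.
  apply: (hC (y, s)); split=> //=; rewrite in_itv/=.
  by move: st; rewrite ltr_norml => /andP[h1 h2]; apply/andP; split; lra.
Qed.

End ClassicalSolutions.

(** * Time increments of the velocity *)

Section VelocityIncrements.
Context {R : realType}.
Local Notation plane := (R * R)%type.
Implicit Types (i j : bool) (x y z : plane).

Lemma cts_translate (f : plane -> R) (a : plane) : continuous f -> continuous (fun y => f (y - a)).
Proof.
move=> cf; apply: (@cts_comp _ _ _ (fun y : plane => y - a) f) => //.
rewrite (_ : (fun y : plane => y - a) = fun y : plane => (y.1 - a.1, y.2 - a.2)); last by apply/funext => -[].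
by apply: cts_pair; apply: ctsB; [exact: cts_fst|exact: ctsC|exact: cts_snd|exact: ctsC].
Qed.

Lemma D_translate i (f g : plane -> R) (a : plane) :
  D i f g -> D i (fun y => f (y - a)) (fun y => g (y - a)).
Proof.
move=> h y; have {h} := h (y - a); case: i => h.
- exact: (@is_derive_shift_val _ (fun s => f (y.1 - a.1, s)) _ _ (- a.2)).
- exact: (@is_derive_shift_val _ (fun s => f (s, y.2 - a.2)) _ _ (- a.1)).
Qed.

Lemma supp_translate L (f : plane -> R) (a : plane) :
  supp L f -> supp (L + (`|a.1| + `|a.2|)) (fun y => f (y - a)).
Proof.
move=> h y; rewrite /inbox negb_and -!ltNge => Hy; apply: h.
rewrite /inbox negb_and -!ltNge /=.
case/orP: Hy => Hy; apply/orP; [left|right].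
- have := ler_normB (y.1 - a.1) (- a.1); rewrite normrN opprK subrK.
  have := normr_ge0 a.2; lra.
- have := ler_normB (y.2 - a.2) (- a.2); rewrite normrN opprK subrK.
  have := normr_ge0 a.1; lra.
Qed.

Lemma dist_lim_le (a_ b_ : nat -> R) (a b c : R) : a_ @ \oo --> a -> b_ @ \oo --> b ->
  (forall n, `|a_ n - b_ n| <= c) -> `|a - b| <= c.
Proof.
move=> ha hb h.
have C : (fun n => `|a_ n - b_ n|) @ \oo --> `|a - b| by apply: cvg_norm; exact: cvgB.
by apply: (ler_cvg_to C (@cvg_cst _ c nat \oo _)); apply: nearW => n; exact: h.
Qed.

Lemma hr_even r x y : hr r (y - x) = hr r (x - y) :> R.
Proof. by rewrite /hr /kap/= -(sqrrN (y.1 - x.1)) -(sqrrN (y.2 - x.2)) !opprB. Qed.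

Lemma kap_even r x y : kap r (y - x) = kap r (x - y) :> R.
Proof. by rewrite /kap/= -(sqrrN (y.1 - x.1)) -(sqrrN (y.2 - x.2)) !opprB. Qed.

(** [vel_divfree] applied to [eta * F], which is C^1 with compact support. *)
Lemma vel_parts (f : plane -> R) M (F eta : plane -> R) (F' eta' : bool -> plane -> R) L :
  continuous f -> (forall y, `|f y| <= M) -> L1 f ->
  continuous F -> (forall i, continuous (F' i)) -> (forall i, D i F (F' i)) ->
  continuous eta -> supp L eta -> (forall i, continuous (eta' i)) -> (forall i, D i eta (eta' i)) ->
  Int (fun x => eta x * (vel f false x * F' false x + vel f true x * F' true x)) =
  - Int (fun x => F x * (vel f false x * eta' false x + vel f true x * eta' true x)).
Proof.
move=> cf fM fi cF cF' dF ce se ce' de.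
have cv i : continuous (vel f i) := @continuous_vel _ f M fM fi i.
have se' i : supp L (eta' i) := D_supp (de i) se.
pose psi' i x := eta' i x * F x + eta x * F' i x.
have c1 : continuous (fun x => vel f false x * F' false x + vel f true x * F' true x).
  exact (ctsD (ctsM (cv false) (cF' false)) (ctsM (cv true) (cF' true))).
have c2 : continuous (fun x => vel f false x * eta' false x + vel f true x * eta' true x).
  exact (ctsD (ctsM (cv false) (ce' false)) (ctsM (cv true) (ce' true))).
have l1 : L1 (fun x => eta x * (vel f false x * F' false x + vel f true x * F' true x)).
  apply: (@L1_supp _ _ L (ctsM ce c1)); exact: suppMl.
have l2 : L1 (fun x => F x * (vel f false x * eta' false x + vel f true x * eta' true x)).
  apply: (@L1_supp _ _ L (ctsM cF c2)); apply: suppMr.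
  by move=> x xL; rewrite !se'// !mulr0 addr0.
have Z : Int (fun x => vel f false x * psi' false x + vel f true x * psi' true x) = 0.
  apply: (@vel_divfree _ f M fM fi (fun x => eta x * F x) psi' L).
  - exact (ctsM ce cF).
  - exact: suppMl.
  - by move=> i; exact (ctsD (ctsM (ce' i) cF) (ctsM ce (cF' i))).
  - by move=> i; exact: DM.
apply/eqP; rewrite -addr_eq0 -(IntD l1 l2); apply/eqP; rewrite -[RHS]Z; apply: eq_Int => x.
rewrite /psi'; ring.
Qed.

Lemma BS1_vel (om : plane -> R -> R) x t : BS1 om x t = (2 * pi)^-1 * vel (om ^~ t) false x.
Proof.
rewrite /BS1; congr (_ * _); apply: eq_Int => y.
by rewrite /K /kap/= expr0n/= addr0.
Qed.

Lemma BS2_vel (om : plane -> R -> R) x t : BS2 om x t = (2 * pi)^-1 * vel (om ^~ t) true x.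
Proof.
rewrite /BS2; congr (_ * _); apply: eq_Int => y.
by rewrite /K /kap/= expr0n/= addr0.
Qed.

Section Vorticity.
Variables (nu M : R) (om : plane -> R -> R).
Hypotheses (nu0 : 0 < nu) (co : classical21 om) (eo : adv_diff_eq nu (BS1 om) (BS2 om) om).
Hypotheses (oM : forall x t, 0 < t -> `|om x t| <= M) (oi : forall t, 0 < t -> L1 (om ^~ t)).

Let M0 : 0 <= M. Proof. exact: le_trans (oM 0 ltr01). Qed.

(** All derivatives are moved to [phi]: the diffusion by [Int_lap_parts], the transport by
    [vel_parts]. What the latter leaves is the integral that [serfati] bounds without any L^1 norm
    of the vorticity. *)
Lemma pairing_derive_bound (phi : plane -> R) (phi' : bool -> plane -> R)
    (phi'' : bool -> bool -> plane -> R) L X t : 0 < t ->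
  continuous phi -> supp L phi -> (forall i, continuous (phi' i)) ->
  (forall i j, continuous (phi'' i j)) -> (forall i, D i phi (phi' i)) ->
  (forall i j, D j (phi' i) (phi'' i j)) ->
  (forall x, phi'' true false x = phi'' false true x) ->
  (forall i x, `|vel (om ^~ t) i x| <= X) ->
  `|Int (fun x => phi x * pdt om x t)| <= (nu * M + X ^+ 2) *
   Int (fun x => `|phi'' false false x| + `|phi'' true true x| + 2 * `|phi'' false true x|).
Proof.
move=> t0 cp sp cp' cp'' dp dp' sym vX.
set S := Int (fun x => `|phi'' false false x| + `|phi'' true true x| + 2 * `|phi'' false true x|).
have co_t := classical_continuous co t0.
have cv i : continuous (vel (om ^~ t) i) := @continuous_vel _ _ M (fun y => oM y t0) (oi t0) i.
have cpd i := @classical_continuous_pd _ om t co t0 i.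
have cl := classical_continuous_lap co t0.
have sp' i : supp L (phi' i) := D_supp (dp i) sp.
have sp'' i j : supp L (phi'' i j) := D_supp (dp' i j) (sp' i).
have [E1 _] := @Int_lap_parts _ L (om ^~ t) (lap om ^~ t) (fun i => pd i om ^~ t)
  (fun i => pd i (pd i om) ^~ t) phi phi' (fun i => phi'' i i) co_t cpd cl
  (fun i => conj (classical_D co t0 i) (classical_DD co t0 i)) (fun=> erefl)
  cp sp cp' (fun i => cp'' i i) (fun i => conj (dp i) (dp' i i)).
have E2 := @vel_parts (om ^~ t) M (om ^~ t) phi (fun i => pd i om ^~ t) phi' L
  co_t (fun y => oM y t0) (oi t0) co_t cpd (classical_D co t0) cp sp cp' dp.
have l1 : L1 (fun x => phi x * lap om x t).
  by apply: (@L1_supp _ _ L (ctsM cp cl)); exact: suppMl.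
have c2 : continuous (fun x => vel (om ^~ t) false x * pd1 om x t + vel (om ^~ t) true x * pd2 om x t).
  exact (ctsD (ctsM (cv false) (cpd false)) (ctsM (cv true) (cpd true))).
have l2 : L1 (fun x => phi x * (vel (om ^~ t) false x * pd1 om x t + vel (om ^~ t) true x * pd2 om x t)).
  by apply: (@L1_supp _ _ L (ctsM cp c2)); exact: suppMl.
have -> : Int (fun x => phi x * pdt om x t) =
    nu * Int (fun x => om x t * (phi'' false false x + phi'' true true x)) +
    (2 * pi)^-1 * Int (fun x => om x t * (vel (om ^~ t) false x * phi' false x + vel (om ^~ t) true x * phi' true x)).
  rewrite -E1 -[X in _ + _ * X]opprK -E2 mulrN -(IntZ _ l1) -(IntZ _ l2) -(IntB (L1Z _ l1) (L1Z _ l2)).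
  apply: eq_Int => x; rewrite (eo x t0) BS1_vel BS2_vel; ring.
have lS : L1 (fun x => `|phi'' false false x| + `|phi'' true true x| + 2 * `|phi'' false true x|).
  have l i j : L1 (fun x => `|phi'' i j x|) := L1_abs (L1_supp (cp'' i j) (sp'' i j)).
  by apply: L1D; [exact: L1D|exact: L1Z].
have S0 : 0 <= S by apply: Int_ge0 => x; rewrite !addr_ge0// mulr_ge0.
rewrite [leRHS]mulrDl; apply: le_trans (ler_normD _ _) _; apply: lerD.
  rewrite normrM (gtr0_norm nu0) -mulrA; apply: ler_wpM2l; first exact: ltW.
  rewrite /S -(IntZ _ lS); apply: Int_abs_le; last 1 first.
  - move=> x; rewrite normrM; apply: ler_pM => //; first exact: oM.
    apply: le_trans (ler_normD _ _) _; rewrite lerDl; apply: mulr_ge0 => //.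
  - apply: continuous_measurable_plane; exact (ctsM co_t (ctsD (cp'' false false) (cp'' true true))).
  - exact: L1Z.
have H := serfati co_t (fun y => oM y t0) (oi t0) cp sp cp' cp'' dp dp' sym vX.
(* The 2 of [serfati] is absorbed by the factor 1 / (2 pi) of the Biot-Savart law. *)
rewrite normrM; have p1 : 2 <= 2 * pi :> R by have := pi_ge2 R; lra.
rewrite gtr0_norm ?invr_gt0; last lra.
rewrite ler_pdivrMl; last lra.
apply: le_trans H _; rewrite -/S -mulrA; apply: ler_wpM2r => //.
by apply: mulr_ge0 => //; exact: sqr_ge0.
Qed.

Lemma pairing_increment (phi : plane -> R) L s t B : continuous phi -> supp L phi -> 0 < s -> s < t ->
  (forall tau, s < tau < t -> `|Int (fun x => phi x * pdt om x tau)| <= B) ->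
  `|Int (fun x => phi x * om x t) - Int (fun x => phi x * om x s)| <= B * (t - s).
Proof.
move=> cp sp s0 st hB.
have dI (tau : R) : 0 < tau -> is_derive tau (1 : R) (fun u => Int (fun y => phi y * om y u))
    (Int (fun y => phi y * pdt om y tau)).
  move=> tau0.
  apply: (@is_derive_Int_time _ (fun y u => phi y * om y u) (fun y u => phi y * pdt om y u) L tau tau0).
  - move=> y u u0; have := is_deriveM_val (is_derive_cst (phi y) u (1 : R)) (classical_pdt co u0 y).
    by rewrite mul0r add0r.
  - move=> y u u0; have [_ [_ _ _ _ c]] := co y u0.
    apply: cvgM; last exact c.
    exact (@continuous_comp _ _ _ (@fst plane R) phi (y, u) (@cts_fst plane R (y, u)) (cp y)).
  - by move=> u u0; exact (ctsM cp (classical_continuous co u0)).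
  - by move=> u u0; exact: suppMl.
have [tau] : exists2 c, c \in `]s, t[ &
    Int (fun y => phi y * om y t) - Int (fun y => phi y * om y s) =
    Int (fun y => phi y * pdt om y c) * (t - s).
  apply: (@MVT _ (fun u => Int (fun y => phi y * om y u)) _ s t st).
    by move=> u; rewrite in_itv/= => /andP[su _]; apply: dI; exact: lt_trans su.
  apply: derivable_within_continuous => u; rewrite in_itv/= => /andP[su _].
  by have [] := dI u (lt_le_trans s0 su).
rewrite in_itv/= => stau ->.
rewrite normrM (gtr0_norm (x := t - s)) ?subr_gt0// ler_pM2r ?subr_gt0//.
exact: hB.
Qed.

(** The equation is tested with the kernel truncated at radius [L] about [x]; the bounds do not
    depend on [L]. The constant is 776 = 4 * 194, as the second derivatives enter with total weight
    1 + 1 + 2. *)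
Lemma rvel_increment r i x s t X : 0 < r -> 0 < s -> s < t ->
  (forall tau, s < tau < t -> forall j y, `|vel (om ^~ tau) j y| <= X) ->
  `|rvel (om ^~ t) r i x - rvel (om ^~ s) r i x| <=
    (nu * M + X ^+ 2) * (776 * pi ^+ 2 / r) * (t - s).
Proof.
move=> r0 s0 st vX.
have t0 : 0 < t := lt_trans s0 st.
pose c1 : R := if i then -1 else 0. pose c2 : R := if i then 0 else 1.
have h1 : `|c1| <= 1 by rewrite /c1; case: (i); rewrite ?normrN1 ?normr0.
have h2 : `|c2| <= 1 by rewrite /c2; case: (i); rewrite ?normr1 ?normr0.
have h12 : c1 = 0 \/ c2 = 0 by rewrite /c1 /c2; case: (i); [right|left].
have B0 : 0 <= nu * M + X ^+ 2 by rewrite addr_ge0 ?sqr_ge0// mulr_ge0// ltW.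
pose phi L y := tst0 L r c1 c2 (y - x).
have H L : r <= L -> `|Int (fun y => phi L y * om y t) - Int (fun y => phi L y * om y s)| <=
    (nu * M + X ^+ 2) * (776 * pi ^+ 2 / r) * (t - s).
  move=> rL.
  pose phi' j y := tst1 L r c1 c2 j (y - x).
  pose phi'' j l y := tst2 L r c1 c2 j l (y - x).
  pose L' := L + (`|x.1| + `|x.2|).
  have cp : continuous (phi L) := @cts_translate (tst0 L r c1 c2) x (@continuous_tst0 _ L r r0 c1 c2).
  have sp : supp L' (phi L) := @supp_translate L (tst0 L r c1 c2) x (tst_supp r0 rL c1 c2).
  have cp' j : continuous (phi' j) := @cts_translate (tst1 L r c1 c2 j) x (@continuous_tst1 _ L r r0 c1 c2 j).
  have cp'' j l : continuous (phi'' j l) := @cts_translate (tst2 L r c1 c2 j l) x (@continuous_tst2 _ L r r0 c1 c2 j l).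
  have dp j : D j (phi L) (phi' j) := D_translate x (D_tst0 L r0 c1 c2 j).
  have dp' j l : D l (phi' j) (phi'' j l) := D_translate x (D_tst1 L r0 c1 c2 j l).
  have sym y : phi'' true false y = phi'' false true y by exact: tst2_sym.
  have S : Int (fun y => `|phi'' false false y| + `|phi'' true true y| + 2 * `|phi'' false true y|) <=
      776 * pi ^+ 2 / r.
    have [lh hh] := Int_hr x r0.
    have b j l y : `|phi'' j l y| <= 194 * hr r (x - y) by rewrite -hr_even; exact: tst2_le.
    have hc (c : R) : 0 <= c -> Int (fun y => c * hr r (x - y)) <= c * pi ^+ 2 / r.
      by move=> c0; rewrite (IntZ _ lh) -mulrA; exact: ler_wpM2l.
    apply: le_trans (hc 776 (ler0n _ _)).
    have sp'' j l : supp L' (phi'' j l) := D_supp (dp' j l) (D_supp (dp j) sp).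
    have l j k : L1 (fun x => `|phi'' j k x|) := L1_abs (L1_supp (cp'' j k) (sp'' j k)).
    apply: Int_le; [by apply: L1D; [exact: L1D|exact: L1Z]|exact: L1Z|].
    move=> y; have := b false false y; have := b true true y; have := b false true y; lra.
  apply: (pairing_increment cp sp s0 st) => tau stau.
  have tau0 : 0 < tau by case/andP: stau => s1 _; exact: lt_trans s0 s1.
  apply: le_trans (pairing_derive_bound tau0 cp sp cp' cp'' dp dp' sym (vX tau stau)) _.
  exact: ler_wpM2l.
(* The truncation radius tends to infinity along [r + n]. At each fixed time the vorticity is
   integrable and the test functions are bounded by 1 / r, so convergence is dominated. *)
have cvg (u : R) : 0 < u -> (fun n : nat => Int (fun y => phi (r + n%:R) y * om y u)) @ \oo --> rvel (om ^~ u) r i x.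
  move=> u0; have rn (n : nat) : r <= r + n%:R by rewrite lerDl.
  have cn n : continuous (phi (r + n%:R)) := @cts_translate (tst0 _ r c1 c2) x (@continuous_tst0 _ _ r r0 c1 c2).
  refine (proj2 (@Int_dominated _ (fun n y => phi (r + n%:R) y * om y u)
    (fun y => K r i (x - y) * om y u) (fun y => r^-1 * `|om y u|) _ _ _ _)).
  - by move=> n; apply: continuous_measurable_plane; exact (ctsM (cn n) (classical_continuous co u0)).
  - exact (L1Z _ (L1_abs (oi u0))).
  - by move=> n y; rewrite normrM ler_wpM2r//; exact: tst0_le.
  - move=> y; apply: cvgM; last exact: cvg_cst.
    have -> : K r i (x - y) = lin c1 c2 (y - x) * (1 * kap r (y - x)).
      by rewrite kap_even /lin /K /c1 /c2 /=; case: (i); ring.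
    apply: cvgM; first exact: cvg_cst.
    apply: cvgM; last exact: cvg_cst.
    apply: cutoff_cvg => [k|]; first by rewrite (lt_le_trans r0 (rn k)).
    apply/gtr0_cvgV0.
      by apply: nearW => k; rewrite (lt_le_trans r0 (rn k)).
    have /cvgryPge h := @cvgr_idn R; apply/cvgryPge => A; apply: filterS (h A) => k; lra.
by apply: (dist_lim_le (cvg t t0) (cvg s s0)) => n; apply: H; rewrite lerDl.
Qed.

(** The regularisation error is paid once at each end, 12 = 2 * 6. The scale [r] stays free, to be
    matched with [X] in the bootstrap. *)
Lemma vel_increment r i x s t X : 0 < r -> 0 < s -> s < t ->
  (forall tau, s < tau < t -> forall j y, `|vel (om ^~ tau) j y| <= X) ->
  `|vel (om ^~ t) i x - vel (om ^~ s) i x| <=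
    12 * pi ^+ 2 * r * M + (nu * M + X ^+ 2) * (776 * pi ^+ 2 / r) * (t - s).
Proof.
move=> r0 s0 st vX.
have t0 : 0 < t := lt_trans s0 st.
have h1 := rvel_increment i x r0 s0 st vX.
have h2 := vel_near (fun y => oM y t0) (oi t0) i x r0.
have h3 := vel_near (fun y => oM y s0) (oi s0) i x r0.
set B := (nu * M + X ^+ 2) * _ * _ in h1 *.
move: h1 h2 h3; set a := rvel _ _ _ _; set b := rvel _ _ _ _; set c := vel _ _ _; set d := vel _ _ _.
rewrite (_ : 12 * pi ^+ 2 * r * M = 2 * (6 * pi ^+ 2 * r * M)); last by ring.
set e := 6 * pi ^+ 2 * r * M.
rewrite !ler_norml => /andP[p1 p2] /andP[p3 p4] /andP[p5 p6]; apply/andP; split; lra.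
Qed.

End Vorticity.
End VelocityIncrements.

(** * Propagation of bounds in time, abstractly *)

Section LocalBoundedness.
Context {R : realType}.
Implicit Types (V : R -> R -> Prop) (a b s t h X Y : R).

(** [V t X] reads: [X] is a bound at time [t]. A relation avoids taking suprema over the plane, and
    [A] is the set of times under consideration. *)
Definition locally_bounded V (A : set R) t :=
  exists d X, 0 < d /\ forall s, A s -> `|s - t| < d -> V s X.

Lemma locally_bounded_near V (A : set R) t : locally_bounded V A t ->
  exists2 d, 0 < d & forall s, `|s - t| < d -> locally_bounded V A s.
Proof.
move=> [d [X [d0 h]]]; exists d => // s sd; exists (d - `|s - t|), X; split; first by rewrite subr_gt0.
move=> u Au ud; apply: h => //.
have := ler_normD (u - s) (s - t); rewrite addrA subrK; lra.
Qed.

(** Otherwise there are times [t_ n] at which [n] is not a bound; they cluster at a point of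
    [[a, b]], near which a single bound holds. *)
Lemma locally_bounded_compact V (A : set R) a b :
  (forall t X Y, X <= Y -> V t X -> V t Y) -> `[a, b] `<=` A ->
  (forall t, a <= t <= b -> locally_bounded V A t) ->
  exists X, forall t, a <= t <= b -> V t X.
Proof.
move=> Vm abA lb; apply: contrapT => H.
have h (n : nat) : exists t, a <= t <= b /\ ~ V t n%:R.
  apply: contrapT => H'; apply: H; exists n%:R => t tab.
  by apply: contrapT => nV; apply: H'; exists t.
have {h} [t_ ht] := choice h.
have tF : (t_ @ \oo) [set` `[a, b]] by exists 0%N => // n _; have [h' _] := ht n; rewrite /= in_itv/=.
have [t [tab ct]] := @segment_compact R a b (t_ @ \oo) _ tF.
move: tab; rewrite /= in_itv/= => tab.
have [d [X [d0 hd]]] := lb t tab.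
have [n nX] : exists n : nat, X <= n%:R.
  by exists (Num.truncn X).+1; apply: ltW; exact: truncnS_gt.
have F : (t_ @ \oo) [set t_ k | k in [set k | (n <= k)%N]].
  by exists n => // k /= nk; exists k.
have B : nbhs t (ball t d) by apply: nbhsx_ballx.
have [_ [[k /= nk <-] tk]] := ct _ _ F B.
have [tkab nV] := ht k; apply: nV.
apply: (Vm _ X); first by apply: le_trans nX _; rewrite ler_nat.
by apply: hd; [apply: abA; rewrite /= in_itv/=|rewrite distrC].
Qed.

(* The set of bad points is closed; from the last bad point [c] before [h], go to [h] through
   the doubling estimate started at [h], which bounds [V] on [(c, h]] by some constant, and then
   through the doubling estimate started at [c]. *)
Lemma doubling_bound V H Y0 : 0 <= H -> 1 <= Y0 ->
  (forall t X Y, X <= Y -> V t X -> V t Y) ->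
  (forall t, 0 <= t <= H -> exists2 Y, 1 <= Y & V t Y) ->
  (forall a b X, 0 <= a -> a < b -> b <= H -> (forall s, a < s < b -> V s X) ->
    forall s t Y, a <= s <= b -> a <= t <= b -> 1 <= Y -> V s Y -> V t (2 * Y)) ->
  (forall t, 0 <= t <= H -> ~ locally_bounded V `[0, H] t -> V t Y0) -> V 0 Y0 ->
  forall h, 0 <= h <= H -> V h (2 * Y0).
Proof.
move=> H0 Y01 Vm Vex gap bad V0 h /andP[h0 hH].
have Y02 : Y0 <= 2 * Y0 by lra.
pose lb := locally_bounded V `[0, H].
have [lbh|] := pselect (lb h); last by move/bad => h'; apply: (Vm _ Y0) => //; apply: h'; rewrite h0.
(* 0 is included by hand: it makes [E] nonempty, and [Y0] is assumed to be a bound there just as at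
   bad points. *)
pose E := [set s | 0 <= s <= h /\ (s = 0 \/ ~ lb s)].
have E0 : E 0 by split; [rewrite lexx|left].
have hE : has_sup E by split; [exists 0|exists h => s [/andP[]]].
pose c := sup E.
have c0 : 0 <= c by apply: ub_le_sup => //; case: hE.
have ch : c <= h by apply: ge_sup; [exists 0|move=> s [/andP[]]].
(* Being locally bounded is an open condition, so points of [E] cannot accumulate at a good point
   other than 0. *)
have Ec : c = 0 \/ ~ lb c.
  have [->|cn0] := eqVneq c 0; first by left.
  right => lbc; have [d d0 hd] := locally_bounded_near lbc.
  have cp : 0 < c by rewrite lt_neqAle eq_sym cn0.
  have e0 : 0 < Num.min d c by rewrite lt_min d0.
  have [s [s0h sE] cs] := sup_adherent e0 hE.
  have sc : s <= c by apply: ub_le_sup; [case: hE|split].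
  move: cs; rewrite -/c ltrBlDr -ltrBlDl lt_min => /andP[s1 s2].
  case: sE => [s00|]; first by move: s2; rewrite s00 subr0 ltxx.
  by apply; apply: hd; rewrite distrC ger0_norm ?subr_ge0.
have Vc : V c Y0.
  case: Ec => [->//|nl]; apply: bad => //.
  by rewrite c0 (le_trans ch).
have [<-|cnh] := eqVneq c h; first exact: Vm Vc.
have cltk : c < h by rewrite lt_neqAle cnh.
have lbs s : c < s -> s <= h -> lb s.
  move=> cs sh; apply: contrapT => nl; have : s <= c; last by rewrite leNgt cs.
  by apply: ub_le_sup; [case: hE|split; [rewrite sh (le_trans c0 (ltW cs))|right]].
have [Yh Yh1 VYh] := Vex h (introT andP (conj h0 hH)).
have B s : c < s < h -> V s (2 * Yh).
  move=> /andP[cs sh].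
  have s0 : 0 <= s := le_trans c0 (ltW cs).
  have [X hX] : exists X, forall t, s <= t <= h -> V t X.
    apply: (locally_bounded_compact (A := `[0, H])) => //.
    - by move=> t; rewrite /= !in_itv/= => /andP[h1 h2]; rewrite (le_trans s0 h1) (le_trans h2 hH).
    - by move=> t /andP[h1 h2]; apply: lbs => //; exact: lt_le_trans cs h1.
  apply: (gap s h X s0 sh hH _ h s Yh) => //; [|by rewrite lexx (ltW sh)..].
  by move=> t /andP[h1 h2]; apply: hX; rewrite (ltW h1) (ltW h2).
apply: (gap c h _ c0 cltk hH B c h Y0) => //; by rewrite lexx (ltW cltk).
Qed.

End LocalBoundedness.

(** * From the increment estimate to bounds on the velocity *)

Section Bootstrap.
Context {R : realType}.
Variables (ub : R -> R -> Prop) (N : R -> R) (A a b c : R).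
Hypotheses (a0 : 0 <= a) (b0 : 0 <= b) (c0 : 0 <= c) (A0 : 0 <= A) (N0 : forall t, 0 <= N t).
Hypothesis ub_mono : forall t X Y, X <= Y -> ub t X -> ub t Y.
Hypothesis ub_N : forall t, 0 < t -> ub t (A + N t).
(** [a * r] is the cost of regularising at scale [r], the other term the variation of the
    regularised velocity. Both time directions occur because the doubling argument runs to either
    side of a bad time. *)
Hypothesis ub_inc : forall r s t X, 0 < r -> 0 < s -> s < t ->
  (forall tau, s < tau < t -> ub tau X) -> forall Y,
  (ub s Y -> ub t (Y + (a * r + (b + X ^+ 2) * (c / r) * (t - s)))) /\
  (ub t Y -> ub s (Y + (a * r + (b + X ^+ 2) * (c / r) * (t - s)))).
Hypothesis N_lsc : forall t C, 0 < t -> C < N t ->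
  exists2 d, 0 < d & forall s, 0 < s -> `|s - t| < d -> C < N s.

(** With r = X / (8 (a + 1)), both terms of the increment are at most X / 8 over a time [tau0], for
    every [X >= 1]. The 64 collects two factors 8, one from [r] and one from the target X / 8. *)
Let tau0 : R := (64 * ((b + 1) * c * (a + 1)) + 1)^-1.

Let tau0_gt0 : 0 < tau0.
Proof.
rewrite invr_gt0 ltr_wpDl// !mulr_ge0 ?addr_ge0//.
Qed.

Let quarter s t X Y : 0 < s -> 0 < t -> `|t - s| <= tau0 -> 1 <= X ->
  (forall tau, s < tau < t -> ub tau X) -> (forall tau, t < tau < s -> ub tau X) ->
  ub s Y -> ub t (Y + X / 4).
Proof.
move=> s0 t0 st X1 h1 h2 us.
have X0 : 0 < X by lra.
have a1 : 0 < a + 1 by rewrite ltr_wpDl.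
pose r := X / (8 * (a + 1)).
have r0 : 0 < r by rewrite divr_gt0// mulr_gt0.
have ar : a * r <= X / 8.
  rewrite /r invfM [X / 8]mulrC (_ : a * (X * (8^-1 * (a + 1)^-1)) = 8^-1 * X * (a / (a + 1))); last by ring.
  by rewrite -[leRHS]mulr1 ler_wpM2l ?mulr_ge0 ?(ltW X0)// ler_pdivrMr// mul1r; lra.
(* [X >= 1] gives b + X^2 <= (b + 1) X^2; one power of [X] cancels against [r], which leaves a
   quantity linear in [X]. *)
have br d : 0 <= d <= tau0 -> (b + X ^+ 2) * (c / r) * d <= X / 8.
  move=> /andP[d0 dt].
  have bX : b + X ^+ 2 <= (b + 1) * X ^+ 2.
    rewrite mulrDl mul1r lerD2r -[leLHS]mulr1 ler_wpM2l//.
    by rewrite expr2; have := ler_pM ler01 ler01 X1 X1; rewrite mulr1.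
  have E : c / r = c * 8 * (a + 1) / X by rewrite /r invf_div; ring.
  have cr0 : 0 <= c / r by rewrite divr_ge0// ltW.
  apply: le_trans (_ : (b + 1) * X ^+ 2 * (c / r) * tau0 <= _).
    apply: ler_pM => //.
      by apply: mulr_ge0 => //; rewrite addr_ge0 ?sqr_ge0.
    by apply: ler_wpM2r.
  rewrite E (_ : _ * tau0 = X / 8 * ((64 * ((b + 1) * c * (a + 1))) * tau0)); last first.
    by field; lra.
  rewrite -[leRHS]mulr1 ler_wpM2l ?divr_ge0 ?(ltW X0)//.
  rewrite /tau0 ler_pdivrMr; first by rewrite mul1r; lra.
  by rewrite -invr_gt0.
have Q d : 0 <= d <= tau0 -> Y + (a * r + (b + X ^+ 2) * (c / r) * d) <= Y + X / 4.
  by move=> /br; lra.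
have [st'|ts|<-] := ltgtP s t.
- have [h _] := ub_inc r0 s0 st' h1 Y.
  apply: ub_mono (h us); apply: Q.
  by move: st; rewrite gtr0_norm ?subr_gt0// => ->; rewrite subr_ge0 ltW.
- have [_ h] := ub_inc r0 t0 ts h2 Y.
  apply: ub_mono (h us); apply: Q.
  by move: st; rewrite distrC gtr0_norm ?subr_gt0// => ->; rewrite subr_ge0 ltW.
- by apply: ub_mono us; lra.
Qed.

(** Any finite bound Z on the open interval improves to Y + Z / 4. Iterating contracts towards 4 Y /
    3, so finitely many steps bring it below [2 * Y], however large [X] was. *)
Let gap p q X : 0 < p -> p < q -> q - p <= tau0 -> (forall s, p < s < q -> ub s X) ->
  forall s t Y, p <= s <= q -> p <= t <= q -> 1 <= Y -> ub s Y -> ub t (2 * Y).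
Proof.
move=> p0 pq pqt hX s t Y sI tI Y1 us.
have dst u : p <= u <= q -> `|u - s| <= tau0.
  move=> /andP[u1 u2]; case/andP: sI => s1 s2; rewrite ler_norml; apply/andP; split; lra.
have pos u : p <= u <= q -> 0 < u by move=> /andP[h _]; exact: lt_le_trans p0 h.
have step Z u : 1 <= Z -> (forall v, p < v < q -> ub v Z) -> p <= u <= q -> ub u (Y + Z / 4).
  move=> Z1 hZ uI; case/andP: (uI) (sI) => u1 u2 /andP[s1 s2].
  apply: (@quarter s u Z Y) => //; [exact: pos|exact: pos|exact: dst| |].
  - by move=> v /andP[v1 v2]; apply: hZ; rewrite (le_lt_trans s1 v1) (lt_le_trans v2 u2).
  - by move=> v /andP[v1 v2]; apply: hZ; rewrite (le_lt_trans u1 v1) (lt_le_trans v2 s2).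
(* The excess of Z over [2 * Y] is counted in halves. Since [Y >= 1], each improvement removes at
   least one of them until Z is at most [2 * Y]. *)
have iter (n : nat) : forall Z, 1 <= Z -> Z <= 2 * Y + n%:R / 2 -> (forall v, p < v < q -> ub v Z) ->
    forall u, p <= u <= q -> ub u (2 * Y).
  elim: n => [|n IH] Z Z1 ZY hZ u uI.
    by apply: ub_mono (step Z u Z1 hZ uI); lra.
  apply: (IH (Y + Z / 4)) => //; first by lra.
  - by rewrite -[n.+1%:R]natr1 in ZY; have : 0 <= n%:R :> R by []; lra.
  - by move=> v /andP[v1 v2]; apply: step => //; rewrite !ltW.
pose Z := Num.max X 1.
have [n hn] : exists n : nat, Z <= 2 * Y + n%:R / 2.
  exists (Num.truncn (2 * Z)).+1; have := truncnS_gt (2 * Z); lra.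
apply: (iter n Z) => //; first by rewrite le_max lexx orbT.
by move=> v vI; apply: ub_mono (hX v vI); rewrite le_max lexx.
Qed.

Let posR : set R := [set t | 0 < t].
Let bad t := 0 < t /\ ~ locally_bounded ub posR t.

(* Baire's argument: were [N] unbounded on the bad points of every interval, nested intervals would
   lead to a point where [N] is infinite. *)
Let bad_portion z : bad z -> exists z' d C, [/\ bad z', 0 < d, d < z' &
  forall t, bad t -> `|t - z'| < d -> N t <= C].
Proof.
move=> bz; apply: contrapT => H.
pose ok (p : R * R) := [/\ bad p.1, 0 < p.2 & p.2 < p.1].
(* A pair is a centre and a radius. [ok p] sits inside the statement so that the choice of a
   successor is total. Lower semicontinuity spreads the bound [n < N] from a bad time to a closed
   interval around it. *)
have stp (n : nat) (p : R * R) : exists q, ok p -> [/\ ok q,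
    forall t, `|t - q.1| <= q.2 -> `|t - p.1| <= p.2 & forall t, `|t - q.1| <= q.2 -> n%:R < N t].
  have [[b1 p2 p12]|] := pselect (ok p); last by move=> nok; exists p.
  have [t [bt td Nt]] : exists t, [/\ bad t, `|t - p.1| < p.2 & n%:R < N t].
    apply: contrapT => H'; apply: H; exists p.1, p.2, n%:R; split => // t bt td.
    by rewrite leNgt; apply/negP => Nt; apply: H'; exists t.
  have t0 : 0 < t by case: bt.
  have [d d0 hd] := N_lsc t0 Nt.
  have e0 : 0 < p.2 - `|t - p.1| by rewrite subr_gt0.
  pose e := Num.min (d / 2) (Num.min (t / 2) ((p.2 - `|t - p.1|) / 2)).
  have [e1 e2 e3] : [/\ e <= d / 2, e <= t / 2 & e <= (p.2 - `|t - p.1|) / 2].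
    by rewrite /e !ge_min !lexx ?orbT.
  have ep : 0 < e by rewrite /e !lt_min !divr_gt0.
  exists (t, e) => _; split => /=.
  - by split => //=; lra.
  - move=> u ut; have := ler_normD (u - t) (t - p.1); rewrite addrA subrK; lra.
  - move=> u ut; apply: hd; last by lra.
    by move: ut; rewrite ler_norml => /andP[]; lra.
pose step n p := projT1 (cid (stp n p)).
pose fix seq n := if n is k.+1 then step k (seq k) else (z, z / 2).
have z0 : 0 < z by case: bz.
have okS n : ok (seq n).
  elim: n => [|n IH]; first by split => //=; lra.
  by have [] := projT2 (cid (stp n (seq n))) IH.
have nest n t : `|t - (seq n.+1).1| <= (seq n.+1).2 -> `|t - (seq n).1| <= (seq n).2 /\ n%:R < N t.
  move=> h; have [_ h1 h2] := projT2 (cid (stp n (seq n))) (okS n).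
  by split; [exact: h1|exact: h2].
have nest2 n m t : (n <= m)%N -> `|t - (seq m).1| <= (seq m).2 -> `|t - (seq n).1| <= (seq n).2.
  move=> /subnK <-; elim: (m - n)%N => [//|k IH] h; apply: IH.
  by rewrite addSn in h; have [] := nest _ _ h.
pose lo n := (seq n).1 - (seq n).2. pose hi n := (seq n).1 + (seq n).2.
have lohi n m : lo n <= hi m.
  have pn n' : `|lo n' - (seq n').1| <= (seq n').2 /\ `|hi n' - (seq n').1| <= (seq n').2.
    have [_ p2 _] := okS n'; rewrite /lo /hi; split.
    - by rewrite addrAC subrr add0r normrN gtr0_norm.
    - by rewrite addrAC subrr add0r gtr0_norm.
  have [nm|/ltnW mn] := leqP n m.
  - have [_ h] := pn m; have := nest2 _ _ _ nm h.
    by rewrite /lo ler_norml => /andP[]; lra.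
  - have [h _] := pn n; have := nest2 _ _ _ mn h.
    by rewrite /hi ler_norml => /andP[]; lra.
pose E := range lo.
have hE : has_sup E by split; [exists (lo 0%N), 0%N|exists (hi 0%N) => _ [n _ <-]; exact: lohi].
(* The supremum of the left ends belongs to every nested interval, so [N x] exceeds every
   integer. *)
pose x := sup E.
have xin n : `|x - (seq n).1| <= (seq n).2.
  have h1 : lo n <= x by apply: ub_le_sup; [case: hE|exists n].
  have h2 : x <= hi n by apply: ge_sup; [exists (lo 0%N), 0%N|move=> _ [m _ <-]; exact: lohi].
  by rewrite /lo in h1; rewrite /hi in h2; rewrite ler_norml; apply/andP; split; lra.
have [_ ] := nest (Num.truncn (N x)).+1 x (xin _).
by rewrite ltNge (ltW (truncnS_gt _)).
Qed.

(** If a bad time existed, [bad_portion] would give a bad [z] near which all bad times have mass at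
    most [C], hence the common bound [A + C]. Doubling from [z] in both directions then bounds every
    nearby time, and [z] is not bad after all. *)
Lemma bootstrap_locally_bounded t : 0 < t -> locally_bounded ub posR t.
Proof.
move=> t0; apply: contrapT => nt.
have [z [d [C [[z0 bz] d0 dz hC]]]] := bad_portion (conj t0 nt).
apply: (bz).
(* [d / 2] stays in the portion where bad times are controlled and, as [d < z], among positive
   times; [tau0 / 2] allows [gap] on every subinterval. *)
pose H := Num.min (d / 2) (tau0 / 2).
have [H1 H2] : H <= d / 2 /\ H <= tau0 / 2 by rewrite /H !ge_min !lexx orbT.
have Hp : 0 < H by rewrite /H lt_min !divr_gt0.
pose Y0 := Num.max 1 (A + C).
have Y01 : 1 <= Y0 by rewrite le_max lexx.
have Vbad u : bad u -> `|u - z| < d -> ub u Y0.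
  move=> bu ud; have [u0 _] := bu; apply: ub_mono (ub_N u0).
  by rewrite le_max lerD2l hC ?orbT.
(* The sign [sg] treats the future and the past of [z] together. *)
have key (sg : R) : `|sg| = 1 -> forall h, 0 <= h <= H -> ub (z + sg * h) (2 * Y0).
  move=> sg1.
  have pos h : 0 <= h <= H -> 0 < z + sg * h /\ `|z + sg * h - z| <= H.
    move=> /andP[h0 hH].
    have n : `|sg * h| <= H by rewrite normrM sg1 mul1r ger0_norm.
    rewrite addrAC subrr add0r; split => //.
    by move: n; rewrite ler_norml => /andP[]; lra.
  apply: (@doubling_bound R (fun h => ub (z + sg * h)) H Y0) => //.
  - exact: ltW.
  - by move=> u X Y; exact: ub_mono.
  - move=> u uI; have [u0 _] := pos u uI; exists (1 + (A + N (z + sg * u))).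
      by rewrite lerDl addr_ge0.
    by apply: ub_mono (ub_N u0); rewrite lerDr.
  - move=> p q X p0 pq qH hX s u Y sI uI Y1.
    have [sg_|sg_] : sg = 1 \/ sg = -1.
      have [s0|s0] := leP 0 sg; first by left; rewrite -sg1 ger0_norm.
      by right; rewrite -sg1 ltr0_norm// opprK.
    + rewrite sg_ !mul1r; apply: (@gap (z + p) (z + q) X); try lra.
      by move=> v /andP[v1 v2]; have := hX (v - z); rewrite sg_ mul1r [z + _]addrC subrK; apply; apply/andP; split; lra.
    + rewrite sg_ !mulN1r; apply: (@gap (z - q) (z - p) X); try lra.
      by move=> v /andP[v1 v2]; have := hX (z - v); rewrite sg_ mulN1r subKr; apply; apply/andP; split; lra.
  - move=> u uI nl; have [u0 uz] := pos u uI; apply: Vbad; last by lra.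
    split=> // -[e [X [e0 he]]]; apply: nl; exists e, X; split => // s.
    rewrite /= in_itv/= => sI se; apply: he; first by have [] := pos s sI.
    by rewrite opprD addrACA subrr add0r -mulrBr normrM sg1 mul1r.
  - by rewrite mulr0 addr0; apply: Vbad; [split|rewrite subrr normr0].
exists H, (2 * Y0); split => // s s0 sH.
have [zs|sz] := leP z s.
- have := key 1 (normr1 _) (s - z); rewrite mul1r [z + _]addrC subrK; apply.
  by move: sH; rewrite subr_ge0 zs/= ger0_norm ?subr_ge0//; exact: ltW.
- have := key (-1) (normrN1 _) (z - s); rewrite mulN1r subKr; apply.
  by move: sH; rewrite subr_ge0 (ltW sz)/= distrC gtr0_norm ?subr_gt0//; exact: ltW.
Qed.

(** Compactness covers [[t1 / 2, T]]; below [t1] the bound [A + N t] is already uniform. *)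
Lemma bootstrap_bounded t1 C T : 0 < t1 -> (forall t, 0 < t -> t < t1 -> N t <= C) ->
  exists U, forall t, 0 < t -> t <= T -> ub t U.
Proof.
move=> t10 hC.
have [X hX] : exists X, forall t, t1 / 2 <= t <= T -> ub t X.
  apply: (locally_bounded_compact (A := posR)) => //.
  - by move=> t; rewrite /= in_itv/= => /andP[h _]; rewrite /posR/=; lra.
  - by move=> t /andP[h _]; apply: bootstrap_locally_bounded; lra.
exists (Num.max X (A + C)) => t t0 tT.
have [h|h] := leP (t1 / 2) t.
- by apply: ub_mono (hX t _); [rewrite le_max lexx|rewrite h].
- apply: ub_mono (ub_N t0); rewrite le_max lerD2l hC ?orbT//; lra.
Qed.

End Bootstrap.

(** * The bootstrap applied to the vorticity *)

Section VorticityVelocity.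
Context {R : realType}.
Local Notation plane := (R * R)%type.
Implicit Types (i j : bool) (x y z : plane).
Variables (nu M : R) (om0 : plane -> R) (om : plane -> R -> R).
Hypotheses (nu0 : 0 < nu) (co : classical21 om) (eo : adv_diff_eq nu (BS1 om) (BS2 om) om).
Hypotheses (oM : forall x t, 0 < t -> `|om x t| <= M) (oi : forall t, 0 < t -> L1 (om ^~ t)).
Hypotheses (mom0 : measurable_fun setT om0).
Hypothesis om_cvg : (fun t => \int[@leb2 R]_x (`|om x t - om0 x|)%:E)%E @ (0 : R)^'+ --> 0%E.

Let N t := Int (fun x => `|om x t|).

(** Fatou's lemma along a sequence of times, since the vorticity is continuous in time at each
    point. *)
Lemma vorticity_mass_lsc (t C : R) : 0 < t -> C < N t ->
  exists2 d : R, 0 < d & forall s, 0 < s -> `|s - t| < d -> C < N s.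
Proof.
move=> t0 CN; apply: contrapT => H.
have h (n : nat) : exists s, [/\ 0 < s, `|s - t| < n.+1%:R^-1 & N s <= C].
  apply: contrapT => H'; apply: H; exists n.+1%:R^-1; first by rewrite invr_gt0.
  by move=> s s0 st; rewrite ltNge; apply/negP => Ns; apply: H'; exists s.
have {h} [s_ hs] := choice h.
have cs : s_ @ \oo --> t.
  apply/cvgrPdist_lt => e e0.
  have [k _ hk] := near_infty_natSinv_lt (PosNum e0).
  exists k => // n /= kn; have [_ h _] := hs n.
  by rewrite distrC; apply: lt_trans h _; exact: hk.
suff [_] : L1 (fun x => `|om x t|) /\ Int (fun x => `|om x t|) <= C by rewrite leNgt CN.
apply: (@Int_fatou _ (fun n x => `|om x (s_ n)|)) => //.
- by move=> n; have [sn _ _] := hs n; exact: L1_measurable (L1_abs (oi sn)).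
- by move=> n; have [sn _ _] := hs n; exact: L1_abs (oi sn).
- by move=> n; have [_ _] := hs n.
move=> x; apply: cvg_norm.
have [dx _] := classical_pdt co t0 x.
have cx : {for t, continuous (om x)} := differentiable_continuous (iffLR (derivable1_diffP _ _) dx).
exact (cvg_comp _ _ cs cx).
Qed.

(** The comparison is with the vorticity at the positive time [d / 2], which is integrable by
    hypothesis; both differences with [om0] have mass at most 1. *)
Lemma vorticity_mass_near0 : exists t1 C : R, 0 < t1 /\ forall t, 0 < t -> t < t1 -> N t <= C.
Proof.
have n1 : ereal_nbhs (0%E : \bar R) (fun u => (u < 1)%E) by apply: open_ereal_lt'; rewrite lte_fin.
have [d /= d0 hd] := om_cvg n1.
have h t : 0 < t -> t < d -> L1 (fun x => `|om x t - om0 x|) /\ Int (fun x => `|om x t - om0 x|) <= 1.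
  move=> t0 td; apply: Int_fine_le => //.
    apply: measurableT_comp => //; apply: measurable_funB => //.
    exact: L1_measurable (oi t0).
  by apply: ltW; apply: hd => //; rewrite /ball_/= sub0r normrN gtr0_norm.
have d20 : 0 < d / 2 by rewrite divr_gt0.
have [l1 h1] := h (d / 2) d20 ltac:(lra).
exists d, (N (d / 2) + 2); split=> // t t0 td.
have [l2 h2] := h t t0 td.
have la := L1_abs (oi d20).
have l3 := L1D la (L1D l1 l2).
have : N t <= Int (fun x => `|om x (d / 2)| + (`|om x (d / 2) - om0 x| + `|om x t - om0 x|)).
  apply: Int_le => //; first exact: L1_abs (oi t0).
  move=> x.
  have := ler_normD (om x (d / 2)) (om x t - om x (d / 2)); rewrite addrC subrK.
  have := ler_normD (om x t - om0 x) (om0 x - om x (d / 2)); rewrite addrA subrK.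
  rewrite (distrC (om0 x)); lra.
rewrite (IntD la (L1D l1 l2)) (IntD l1 l2) /N; lra.
Qed.

Lemma vorticity_velocity_bounded (T : R) : exists U, forall t, 0 < t -> t <= T ->
  forall i x, `|vel (om ^~ t) i x| <= U.
Proof.
have M0 : 0 <= M by exact: le_trans (oM 0 ltr01).
have p0 : 0 <= pi ^+ 2 :> R by exact: sqr_ge0.
have [t1 [C [t10 hC]]] := vorticity_mass_near0.
have [c cE] : exists c : R, c = 776 * pi ^+ 2 by exists (776 * pi ^+ 2).
have c0 : 0 <= c by rewrite cE; exact (mulr_ge0 (ler0n _ _) p0).
have [a aE] : exists a : R, a = 12 * pi ^+ 2 * M by exists (12 * pi ^+ 2 * M).
have a0 : 0 <= a by rewrite aE; exact (mulr_ge0 (mulr_ge0 (ler0n _ _) p0) M0).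
have [A AE] : exists A : R, A = 6 * pi ^+ 2 * M by exists (6 * pi ^+ 2 * M).
have A0 : 0 <= A by rewrite AE; exact (mulr_ge0 (mulr_ge0 (ler0n _ _) p0) M0).
have b0 : 0 <= nu * M by apply: mulr_ge0 => //; exact: ltW.
have N0 t : 0 <= N t by exact: Int_ge0.
refine (@bootstrap_bounded R (fun t Y => forall i x, `|vel (om ^~ t) i x| <= Y) N
  A a (nu * M) c a0 b0 c0 A0 N0 _ _ _ _ t1 C T t10 hC).
- by move=> t X Y XY h i x; exact: le_trans (h i x) XY.
- by move=> t t0 i x; rewrite AE; exact: vel_le (fun y => oM y t0) (oi t0) i x.
- move=> r s t X r0 s0 st hX Y.
  have inc i x : `|vel (om ^~ t) i x - vel (om ^~ s) i x| <=
      a * r + (nu * M + X ^+ 2) * (c / r) * (t - s).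
    by rewrite aE cE (mulrAC _ M r); exact: (vel_increment nu0 co eo oM oi i x r0 s0 st hX).
  split=> h i x; apply: le_trans (lerD (h i x) (inc i x)).
  - by rewrite addrC -{1}(subrK (vel (om ^~ s) i x) (vel (om ^~ t) i x)); exact: ler_normD.
  - rewrite -{1}(subKr (vel (om ^~ t) i x) (vel (om ^~ s) i x)); exact: ler_normB.
- exact: vorticity_mass_lsc.
Qed.

End VorticityVelocity.

(** * The weighted energy *)

Section GaussianWeight.
Context {R : realType}.
Local Notation plane := (R * R)%type.
Implicit Types (i j : bool) (x y z : plane).

Section FixedTime.
Variables (k m L : R).
Hypotheses (k0 : 0 < k) (m0 : 0 < m) (L0 : 0 < L).

(* [exp (2 * wexp)] is a bounded increasing approximation of [exp (2 * k * |y|^2 / m)]; with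
   [m = 2 * k * lam^2] this is the Gaussian weight [exp (|y|^2 / lam^2)]. *)
Definition wden y : R := (m + sqn y)^-1.
Definition wexp y : R := k * sqn y * wden y.
Definition wgrad j y : R := 2 * (k * m) * coord j y * wden y ^+ 2.
Definition wcut j y : R := 2 * coord j y * (- (2 / L ^+ 2) * cutoff L 1 y).
(** The weight is built as a square, so that completing the square in the energy estimate involves
    the gradient of its root. *)
Definition wroot y : R := expR (wexp y) * cutoff L 2 y.
Definition wroot' j y : R := wroot y * wgrad j y + expR (wexp y) * wcut j y.
Definition wght y : R := wroot y ^+ 2.
Definition wght' j y : R := 2 * (wroot y * wroot' j y).

Lemma wden_pos y : 0 < m + sqn y. Proof. by rewrite ltr_wpDr ?sqn_ge0. Qed.

Lemma wden_gt0 y : 0 < wden y. Proof. by rewrite invr_gt0 wden_pos. Qed.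

Lemma wdenK y : wden y * (m + sqn y) = 1. Proof. by rewrite mulVf// gt_eqF// wden_pos. Qed.

Lemma wden_le1 y : sqn y * wden y <= 1.
Proof. by rewrite -(wdenK y) mulrC ler_pM2l ?wden_gt0// lerDr ltW. Qed.

Lemma mden_le1 y : m * wden y <= 1.
Proof. by rewrite -(wdenK y) mulrC ler_pM2l ?wden_gt0// lerDl sqn_ge0. Qed.

Lemma wexp_le y : wexp y <= k.
Proof. by rewrite /wexp -mulrA -[leRHS]mulr1 ler_pM2l// wden_le1. Qed.

Lemma wexp_le_quad y : wexp y <= k * sqn y / m.
Proof.
apply: ler_wpM2l; first by apply: mulr_ge0; [exact: ltW|exact: sqn_ge0].
by rewrite lef_pV2 ?posrE ?wden_pos// lerDl sqn_ge0.
Qed.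

Lemma wgrad_le mm j y : 0 < mm -> mm <= m -> `|wgrad j y| <= 2 * k * (mm^-1 + 1).
Proof.
move=> mm0 mmm.
have v0 := wden_gt0 y.
have cj : `|coord j y| <= 1 + sqn y.
  have h : `|coord j y| <= 1 + coord j y ^+ 2.
    by rewrite -(real_normK (num_real (coord j y))); have := sqr_ge0 (`|coord j y| - 1); rewrite sqrrB1; have := normr_ge0 (coord j y); nra.
  apply: le_trans h _; rewrite lerD2l /sqn; case: (j) => /=; [rewrite lerDr|rewrite lerDl]; exact: sqr_ge0.
have vm : wden y <= mm^-1.
  apply: le_trans (_ : m^-1 <= _); first by rewrite lef_pV2 ?posrE ?wden_pos// lerDl sqn_ge0.
  by rewrite lef_pV2 ?posrE.
have q1 := wden_le1 y. have q2 := mden_le1 y.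
have -> : `|wgrad j y| = 2 * k * ((m * wden y) * (`|coord j y| * wden y)).
  rewrite /wgrad expr2 !normrM (gtr0_norm v0) (gtr0_norm k0) (gtr0_norm m0) gtr0_norm//; ring.
apply: ler_wpM2l; first by apply: mulr_ge0 => //; exact: ltW.
apply: le_trans (_ : 1 * (`|coord j y| * wden y) <= _).
  by apply: ler_wpM2r => //; apply: mulr_ge0 => //; exact: ltW.
rewrite mul1r; apply: le_trans (_ : (1 + sqn y) * wden y <= _); first by apply: ler_wpM2r => //; exact: ltW.
by rewrite mulrDl mul1r; exact: lerD.
Qed.

Lemma continuous_sqn : continuous (@sqn R).
Proof.
exact (ctsD (@ctsX R plane _ 2 cts_fst) (@ctsX R plane _ 2 cts_snd)).
Qed.

Lemma continuous_wden : continuous wden.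
Proof.
apply: ctsV; first by move=> y; rewrite gt_eqF// wden_pos.
exact (ctsD (@ctsC _ _ m) continuous_sqn).
Qed.

Lemma continuous_wexp : continuous wexp.
Proof. exact (ctsM (ctsM (@ctsC _ _ k) continuous_sqn) continuous_wden). Qed.

Lemma continuous_expwexp : continuous (fun y => expR (wexp y)).
Proof. exact (@cts_comp _ _ _ wexp expR continuous_wexp (@continuous_expR R)). Qed.

Lemma continuous_wgrad j : continuous (wgrad j).
Proof.
exact (ctsM (ctsM (@ctsC _ _ (2 * (k * m))) (@cts_coord R j)) (@ctsX _ _ _ 2 continuous_wden)).
Qed.

Lemma continuous_wroot : continuous wroot.
Proof. exact (ctsM continuous_expwexp (@continuous_cutoff _ L 2)). Qed.

Lemma D_wden j : D j wden (fun y => - (wden y ^+ 2) * (2 * coord j y)).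
Proof.
have h : D j (fun y => m + sqn y) (fun y => 0 + 2 * coord j y) := DD (Dcst j m) (D_sqn j).
have n y : m + sqn y != 0 by rewrite gt_eqF// wden_pos.
apply: eq_D (DV n h) => y //.
by rewrite /wden add0r exprVn.
Qed.

Lemma D_wexp j : D j wexp (wgrad j).
Proof.
have h := DM (DZ k (D_sqn j)) (D_wden j).
apply: eq_D h => y //.
have := wdenK y; set v := wden y; set q := sqn y => E.
rewrite /wgrad -/v; set c := coord j y.
have -> : k * (2 * c) * v + k * q * (- v ^+ 2 * (2 * c)) = k * (2 * c) * (v * 1 - q * v ^+ 2) by ring.
by rewrite -E; ring.
Qed.

Lemma D_expwexp j : D j (fun y => expR (wexp y)) (fun y => expR (wexp y) * wgrad j y).
Proof. exact: (Dcomp (@is_derive_expR R) (D_wexp j)). Qed.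

Lemma D_wroot j : D j wroot (wroot' j).
Proof.
have h := DM (D_expwexp j) (D_cutoff L 0 j).
by apply: eq_D h => y //; rewrite /wroot' /wroot /wcut; ring.
Qed.

Lemma D_wght j : D j wght (wght' j).
Proof.
have h := DM (D_wroot j) (D_wroot j).
by apply: eq_D h => y; rewrite /wght' /wght ?expr2//; ring.
Qed.

(** [wroot] contains [cutoff L 2] and is only C^1, but the weight contains its square [cutoff L 4].
    This form of the gradient, with [cutoff L 4] and [cutoff L 3], can be differentiated once
    more. *)
Lemma wght'E j y : wght' j y =
  expR (wexp y) ^+ 2 * (2 * wgrad j y * cutoff L 4 y - 8 / L ^+ 2 * coord j y * cutoff L 3 y).
Proof.
have E4 : cutoff L 4 y = cutoff L 2 y ^+ 2 by rewrite /cutoff /pospow -exprM.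
have E3 : cutoff L 3 y = cutoff L 2 y * cutoff L 1 y by rewrite /cutoff /pospow -exprD.
rewrite E4 E3 /wght' /wroot' /wroot /wcut; ring.
Qed.

Lemma continuous_wght : continuous wght.
Proof. exact: (@ctsX _ _ _ 2 continuous_wroot). Qed.

Lemma continuous_wght' j : continuous (wght' j).
Proof.
have -> : wght' j = fun y => expR (wexp y) ^+ 2 *
  (2 * wgrad j y * cutoff L 4 y - 8 / L ^+ 2 * coord j y * cutoff L 3 y) by apply/funext => y; exact: wght'E.
exact (ctsM (@ctsX _ _ _ 2 continuous_expwexp) (ctsB (ctsM (ctsM (@ctsC _ _ 2) (@continuous_wgrad j)) (@continuous_cutoff _ L 4))
  (ctsM (ctsM (@ctsC _ _ (8 / L ^+ 2)) (@cts_coord R j)) (@continuous_cutoff _ L 3)))).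
Qed.

Lemma D_wght' j : exists2 g, continuous g & D j (wght' j) g.
Proof.
have dE := DM (D_expwexp j) (D_expwexp j).
have dg := DM (DM (Dcst j (2 * (k * m))) (Dcoord j j)) (DM (D_wden j) (D_wden j)).
have dI := DB (DM (DM (Dcst j (2 : R)) dg) (D_cutoff L 2 j))
  (DM (DM (Dcst j (8 / L ^+ 2)) (Dcoord j j)) (D_cutoff L 1 j)).
have h := DM dE dI; eexists; last first.
  by apply: eq_D h => y //; rewrite wght'E /wgrad !expr2.
have ce := continuous_expwexp. have cg := @continuous_wgrad j. have cc := @cts_coord R j.
have ck n := @continuous_cutoff R L n. have cv := continuous_wden.
by cts_with ltac:(first [exact ce|exact cg|exact cc|exact cv|exact: ck]).
Qed.

Lemma wght_ge0 y : 0 <= wght y. Proof. exact: sqr_ge0. Qed.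

Lemma wroot_ge0 y : 0 <= wroot y.
Proof. by apply: mulr_ge0; [exact: expR_ge0|exact: cutoff_ge0]. Qed.

Lemma wght_le y : wght y <= expR (2 * wexp y).
Proof.
rewrite expRM_natl ler_sqr ?nnegrE ?wroot_ge0 ?expR_ge0//.
by rewrite -[leRHS]mulr1 ler_wpM2l ?expR_ge0// cutoff_le1.
Qed.

Lemma wght_supp : supp L wght.
Proof. by move=> y h; rewrite /wght /wroot cutoff_supp// mulr0 expr0n. Qed.

Lemma wcut_le j y : `|wcut j y| <= 4 / L.
Proof.
have L2 : 0 < 4 / L ^+ 2 by rewrite divr_gt0// exprn_gt0.
have -> : wcut j y = - (4 / L ^+ 2) * (coord j y * cutoff L 1 y) by rewrite /wcut; ring.
rewrite normrM normrN (gtr0_norm L2) normrM (ger0_norm (cutoff_ge0 _ _ _)).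
have -> : 4 / L = 4 / L ^+ 2 * L by rewrite expr2 invfM mulrA mulfVK// gt_eqF.
by rewrite ler_pM2l//; exact: coord_cutoff.
Qed.

(* With [m = 2 * k * s] and [ds/dt = 4 * nu], the factor of the first [wght y] is [d/dt log wght]. *)
Lemma wght_inequality (nu s U mm : R) (u : bool -> R) y : 0 < nu -> 0 < s -> m = 2 * k * s ->
  0 < mm -> mm <= m -> 1 <= L -> (forall j, `|u j| <= U) ->
  wght y * (2 * (- (k * sqn y * wden y ^+ 2 * (8 * k * nu)))) +
   2 * nu * (wroot' false y ^+ 2 + wroot' true y ^+ 2) +
   2 * wroot y * (u false * wroot' false y + u true * wroot' true y)
  <= U ^+ 2 / nu * wght y +
     2 * expR k ^+ 2 * (16 * nu * (2 * k * (mm^-1 + 1)) + 32 * nu + 8 * U) / L.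
Proof.
move=> nu0 s0 ms mm0 mmm L1 hu.
have U0 : 0 <= U by exact: le_trans (hu false).
have nu0' := ltW nu0.
set G := 2 * k * (mm^-1 + 1).
have G0 : 0 <= G by rewrite /G mulr_ge0 ?addr_ge0 ?invr_ge0 ?mulr_ge0// ltW.
set p := wroot y; set f := expR (wexp y).
set al := k * m * wden y ^+ 2.
have p0 : 0 <= p := wroot_ge0 y.
have f0 : 0 <= f := expR_ge0 _.
have fk : f <= expR k by rewrite ler_expR wexp_le.
have pf : p <= expR k.
  by apply: le_trans fk; rewrite /p /wroot -[leRHS]mulr1 ler_wpM2l// cutoff_le1.
have al0 : 0 <= al by rewrite /al mulr_ge0 ?sqr_ge0// mulr_ge0// ltW.
(* Equality would hold for the exact Gaussian; the bounded exponent only lowers [al]. *)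
have als : 2 * s * al <= 1.
  have -> : 2 * s * al = (m * wden y) * (m * wden y) by rewrite /al {2}ms; ring.
  have h := mden_le1 y; have h0 : 0 <= m * wden y by apply: mulr_ge0; [exact: ltW|exact/ltW/wden_gt0].
  by rewrite -[leRHS]mulr1; exact: ler_pM.
have gE j : wgrad j y = 2 * al * coord j y by rewrite /wgrad /al; ring.
have tE : 2 * (- (k * sqn y * wden y ^+ 2 * (8 * k * nu))) = - (8 * nu / s) * (al * sqn y).
  by rewrite /al ms; field; exact: lt0r_neq0.
have gL j : `|wgrad j y| <= G by exact: wgrad_le.
(* Separates the gradient of the exponent from that of the cut-off; each term with the latter has a
   factor 1 / L. *)
have errj j : 2 * nu * wroot' j y ^+ 2 + 2 * p * (u j * wroot' j y) <=
   p ^+ 2 * (2 * nu * wgrad j y ^+ 2 + 2 * u j * wgrad j y) +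
   expR k ^+ 2 * (16 * nu * G + 32 * nu + 8 * U) / L.
  rewrite /wroot' -/p -/f.
  have cl := wcut_le j y; set c := wcut j y in cl *; set g := wgrad j y.
  have -> : 2 * nu * (p * g + f * c) ^+ 2 + 2 * p * (u j * (p * g + f * c)) =
    p ^+ 2 * (2 * nu * g ^+ 2 + 2 * u j * g) + (4 * nu * (p * f) * (g * c) + 2 * nu * f ^+ 2 * c ^+ 2 + 2 * (p * f) * (u j * c)) by ring.
  rewrite lerD2l.
  have Li : 0 < L^-1 by rewrite invr_gt0.
  have Li1 : L^-1 <= 1 by rewrite invf_le1.
  have pfK : 0 <= p * f <= expR k ^+ 2.
    by rewrite mulr_ge0//= expr2 ler_pM.
  have ffK : f ^+ 2 <= expR k ^+ 2 by rewrite ler_sqr ?nnegrE ?expR_ge0.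
  case/andP: pfK => pf0 pfK.
  have K0 : 0 <= expR k ^+ 2 := sqr_ge0 _.
  have n4 : 0 <= 4 * nu := mulr_ge0 (ler0n _ _) nu0'.
  have n2 : 0 <= 2 * nu := mulr_ge0 (ler0n _ _) nu0'.
  have n0 : 0 <= (2 : R) := ler0n _ _.
  have Lc : 0 <= 4 / L := divr_ge0 (ler0n _ _) (ltW L0).
  have t1 : 4 * nu * (p * f) * (g * c) <= 4 * nu * expR k ^+ 2 * (G * (4 / L)).
    apply: le_trans (ler_norm _) _; rewrite normrM (ger0_norm (mulr_ge0 n4 pf0)).
    apply: ler_pM => //; [exact (mulr_ge0 n4 pf0)|exact (ler_wpM2l n4 pfK)|].
    by rewrite normrM; apply: ler_pM => //; exact: gL.
  have t2 : 2 * nu * f ^+ 2 * c ^+ 2 <= 2 * nu * expR k ^+ 2 * (16 * L^-1).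
    apply: ler_pM; [exact (mulr_ge0 n2 (sqr_ge0 _))|exact: sqr_ge0|exact (ler_wpM2l n2 ffK)|].
    rewrite -(real_normK (num_real c)); apply: le_trans (_ : (4 / L) ^+ 2 <= _).
      by rewrite ler_sqr ?nnegrE.
    have -> : (4 / L) ^+ 2 = 16 * (L^-1 * L^-1) by ring.
    by rewrite ler_pM2l// -[leRHS]mulr1 ler_pM2l.
  have t3 : 2 * (p * f) * (u j * c) <= 2 * expR k ^+ 2 * (U * (4 / L)).
    apply: le_trans (ler_norm _) _; rewrite normrM (ger0_norm (mulr_ge0 n0 pf0)).
    apply: ler_pM => //; [exact (mulr_ge0 n0 pf0)|exact (ler_wpM2l n0 pfK)|].
    by rewrite normrM; apply: ler_pM.
  apply: le_trans (lerD (lerD t1 t2) t3) _.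
  by rewrite le_eqVlt; apply/orP; left; apply/eqP; ring.
(* The gain [8 * nu / s * al * |y|^2] of the time derivative is split evenly: one half covers the
   squared gradient, the other the transport term by Young's inequality. Each component costs U^2 /
   (2 nu). *)
have young j : 2 * nu * wgrad j y ^+ 2 + 2 * u j * wgrad j y <=
   8 * nu / s * (al * coord j y ^+ 2) + U ^+ 2 / (2 * nu).
  rewrite gE; set c := coord j y.
  have h1 : 2 * nu * (2 * al * c) ^+ 2 <= 4 * nu / s * (al * c ^+ 2).
    have -> : 2 * nu * (2 * al * c) ^+ 2 = 4 * nu / s * (al * c ^+ 2) * (2 * s * al).
      by field; exact: lt0r_neq0.
    rewrite -[leRHS]mulr1; apply: ler_wpM2l => //.
    apply: mulr_ge0; last exact (mulr_ge0 al0 (sqr_ge0 _)).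
    exact (divr_ge0 (mulr_ge0 (ler0n _ _) nu0') (ltW s0)).
  have uU : u j ^+ 2 <= U ^+ 2 by rewrite -(real_normK (num_real (u j))) ler_sqr ?nnegrE.
  have h2 : 2 * u j * (2 * al * c) <= 4 * nu / s * (al * c ^+ 2) + (2 * s * al) * (u j ^+ 2 / (2 * nu)).
    rewrite -subr_ge0.
    have -> : 4 * nu / s * (al * c ^+ 2) + (2 * s * al) * (u j ^+ 2 / (2 * nu)) - 2 * u j * (2 * al * c) =
      al * s / nu * (2 * nu / s * c - u j) ^+ 2.
      by field; rewrite !lt0r_neq0.
    exact (mulr_ge0 (divr_ge0 (mulr_ge0 al0 (ltW s0)) nu0') (sqr_ge0 _)).
  have h3 : (2 * s * al) * (u j ^+ 2 / (2 * nu)) <= U ^+ 2 / (2 * nu).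
    have n2 : 0 <= (2 * nu)^-1 by rewrite invr_ge0; exact (mulr_ge0 (ler0n _ _) nu0').
    rewrite -[leRHS]mul1r; apply: ler_pM => //.
    - exact (mulr_ge0 (mulr_ge0 (ler0n _ _) (ltW s0)) al0).
    - exact (mulr_ge0 (sqr_ge0 _) n2).
    - exact: ler_wpM2r.
  apply: le_trans (lerD h1 h2) _; rewrite [leRHS](_ : _ = 4 * nu / s * (al * c ^+ 2) + (4 * nu / s * (al * c ^+ 2) + U ^+ 2 / (2 * nu))); last by ring.
  by rewrite !lerD2l.
have p20 : 0 <= p ^+ 2 := sqr_ge0 _.
have e1 := errj false; have e2 := errj true.
have y1 := ler_wpM2l p20 (young false); have y2 := ler_wpM2l p20 (young true).
rewrite tE /wght -/p.
have sq : sqn y = coord false y ^+ 2 + coord true y ^+ 2 by [].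
have n2 : U ^+ 2 / nu = U ^+ 2 / (2 * nu) + U ^+ 2 / (2 * nu) by field; exact: lt0r_neq0.
rewrite sq n2.
set X1 := 2 * nu * wgrad false y ^+ 2 + _ in e1 y1; set X2 := 2 * nu * wgrad true y ^+ 2 + _ in e2 y2.
set Er := expR k ^+ 2 * _ / L in e1 e2.
rewrite (_ : 2 * expR k ^+ 2 * _ / L = Er + Er); last by rewrite /Er; ring.
set W := U ^+ 2 / (2 * nu) in y1 y2 *; set B := 8 * nu / s in y1 y2 *.
set c1 := coord false y in y1 *; set c2 := coord true y in y2 *.
have -> : p ^+ 2 * (- B * (al * (c1 ^+ 2 + c2 ^+ 2))) = - (p ^+ 2 * (B * (al * c1 ^+ 2))) - (p ^+ 2 * (B * (al * c2 ^+ 2))) by ring.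
clearbody X1 X2 Er W B c1 c2.
rewrite (mulrDr (p ^+ 2)) in y1; rewrite (mulrDr (p ^+ 2)) in y2; lra.
Qed.

End FixedTime.
End GaussianWeight.

(** * The differential inequality for the truncated energy *)

Section EnergyInequality.
Context {R : realType}.
Local Notation plane := (R * R)%type.
Implicit Types (i j : bool) (x y z : plane).

Lemma gronwall (F F' : R -> R) (a b T t0 : R) : 0 <= a -> 0 <= b -> 0 < t0 -> t0 < T ->
  (forall t : R, 0 < t -> is_derive t (1 : R) F (F' t)) ->
  (forall t, 0 < t -> t <= T -> F' t <= a * F t + b) -> 0 <= F t0 ->
  F T <= expR (a * T) * (F t0 + b * T).
Proof.
move=> a0 b0 t00 t0T dF hF F0.
pose G t := F t * expR (- a * t) + - b * t.
pose G' t := (F' t * expR (- a * t) + F t * (expR (- a * t) * (- a * 1))) + - b * 1.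
have dZ (c t : R) : is_derive t (1 : R) (fun s => c * s) (c * 1).
  have := is_deriveM_val (is_derive_cst c t (1 : R)) (is_derive_id t (1 : R)).
  by rewrite mul0r add0r.
have dG (t : R) : 0 < t -> is_derive t (1 : R) G (G' t).
  move=> tp.
  have de := is_derive_comp_val (dZ (- a) t) (is_derive_expR (- a * t)).
  exact (is_deriveD_val (is_deriveM_val (dF t tp) de) (dZ (- b) t)).
have [c cI E] : exists2 c, c \in `]t0, T[ & G T - G t0 = G' c * (T - t0).
  apply: (@MVT _ G G' t0 T t0T).
    by move=> u; rewrite in_itv/= => /andP[h _]; apply: dG; exact: lt_trans h.
  apply: derivable_within_continuous => u; rewrite in_itv/= => /andP[h _].
  by have [] := dG u (lt_le_trans t00 h).
move: cI; rewrite in_itv/= => /andP[c1 c2].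
have cp : 0 < c := lt_trans t00 c1.
have T0 : 0 < T := lt_trans t00 t0T.
have ex t : 0 < t -> 0 < expR (- a * t) <= 1.
  by move=> tp; rewrite expR_gt0/= -expR0 ler_expR mulNr oppr_le0 mulr_ge0// ltW.
have Gc : G' c <= 0.
  have := hF c cp (ltW c2); have /andP[e0 e1] := ex c cp.
  rewrite /G'; set e := expR _ in e0 e1 *; move=> h.
  have : e * F' c <= e * (a * F c + b) by rewrite ler_pM2l.
  have : b * e <= b * 1 by exact: ler_wpM2l.
  rewrite !mulr1; nra.
have GT : G T <= G t0 by rewrite -subr_le0 E; apply: mulr_le0_ge0 => //; rewrite subr_ge0 ltW.
rewrite -ler_pdivrMl ?expR_gt0// -expRN -mulNr mulrC.
have /andP[e0 e1] := ex t0 t00.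
have : F t0 * expR (- a * t0) <= F t0 * 1 by exact: ler_wpM2l.
move: GT; rewrite /G !mulNr mulr1.
have : 0 <= b * t0 by rewrite mulr_ge0// ltW.
lra.
Qed.

Lemma inv_2pi_le1 : 0 <= (2 * pi : R)^-1 <= 1.
Proof.
have p2 : 2 <= pi :> R := pi_ge2 R.
by rewrite invr_ge0 mulr_ge0 ?pi_ge0//= invf_le1; lra.
Qed.

Variables (nu lam0 M U C T : R) (om w : plane -> R -> R).
Hypotheses (nu0 : 0 < nu) (lam00 : 0 < lam0) (T0 : 0 < T).
Hypotheses (co : classical21 om) (oM : forall x t, 0 < t -> `|om x t| <= M) (oi : forall t, 0 < t -> L1 (om ^~ t)).
Hypotheses (cw : classical21 w) (ew : adv_diff_eq nu (BS1 om) (BS2 om) w).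
Hypothesis (velU : forall t, 0 < t -> t <= T -> forall i x, `|vel (om ^~ t) i x| <= U).
Hypothesis (wC : forall t, 0 < t -> t <= T -> L1 (fun x => w x t ^+ 2) /\ Int (fun x => w x t ^+ 2) <= C).

Definition lamsq (t : R) : R := lam0 ^+ 2 + 4 * nu * t.

Let lamsq_gt0 t : 0 < t -> 0 < lamsq t.
Proof. by move=> tp; rewrite /lamsq addr_gt0 ?exprn_gt0// !mulr_gt0. Qed.

Section Truncated.
Variables (k L : R).
Hypotheses (k0 : 0 < k) (L1' : 1 <= L).

Let L0 : 0 < L. Proof. exact: lt_le_trans L1'. Qed.

Definition tden (t : R) : R := 2 * k * lamsq t.
Definition eta y (t : R) : R := wght k (tden t) L y.
Definition eta_t y (t : R) : R :=
  wght k (tden t) L y * (2 * (- (k * sqn y * wden (tden t) y ^+ 2 * (8 * k * nu)))).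

Let tden_gt0 t : 0 < t -> 0 < tden t.
Proof. by move=> tp; rewrite /tden mulr_gt0 ?lamsq_gt0// mulr_gt0. Qed.

Lemma is_derive_eta y (t : R) : 0 < t -> is_derive t (1 : R) (eta y) (eta_t y t).
Proof.
move=> tp.
have dm : is_derive t (1 : R) (fun s => tden s + sqn y) (8 * k * nu).
  have -> : (fun s => tden s + sqn y) = fun s => 8 * k * nu * s + (2 * k * lam0 ^+ 2 + sqn y).
    by apply/funext => s; rewrite /tden /lamsq; ring.
  have := is_deriveD_val (is_deriveM_val (is_derive_cst (8 * k * nu) t (1 : R)) (is_derive_id t (1 : R)))
    (is_derive_cst (2 * k * lam0 ^+ 2 + sqn y) t (1 : R)).
  by rewrite mul0r add0r addr0 mulr1.
have n0 : tden t + sqn y != 0 by rewrite gt_eqF// wden_pos// tden_gt0.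
have dv := @is_derive_inv R (fun s => tden s + sqn y) t _ n0 dm.
have dr : is_derive t (1 : R) (fun s => wroot k (tden s) L y)
    (wroot k (tden t) L y * (- (k * sqn y * wden (tden t) y ^+ 2 * (8 * k * nu)))).
  have de := is_derive_comp_val (is_deriveM_val (is_derive_cst (k * sqn y) t (1 : R)) dv) (is_derive_expR _).
  have := is_deriveM_val de (is_derive_cst (cutoff L 2 y) t (1 : R)).
  rewrite mulr0 addr0 mul0r add0r => h.
  rewrite /wroot /wexp /wden exprVn.
  set A := (X in is_derive _ _ _ X) in h; set B := (X in is_derive _ _ _ X).
  by have <- : A = B by rewrite /A /B /cst; ring.
have := is_deriveM_val dr dr.
move=> h; rewrite /eta_t /wght; set A := (X in is_derive _ _ _ X) in h; set B := (X in is_derive _ _ _ X).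
have <- : A = B by rewrite /A /B; ring.
have -> // : eta y = fun s => wroot k (tden s) L y * wroot k (tden s) L y.
by apply/funext => s; rewrite /eta /wght expr2.
Qed.

Lemma continuous_eta_time y t : 0 < t ->
  {for (y, t), continuous (fun p : plane * R => eta p.1 p.2)} /\
  {for (y, t), continuous (fun p : plane * R => eta_t p.1 p.2)}.
Proof.
move=> tp.
have cq : continuous (fun p : plane * R => sqn p.1).
  exact (@cts_comp _ _ _ (@fst plane R) (@sqn R) cts_fst (@continuous_sqn R)).
have cm : continuous (fun p : plane * R => tden p.2 + sqn p.1).
  apply: ctsD cq.
  exact (ctsM (@ctsC _ _ (2 * k)) (ctsD (@ctsC _ _ (lam0 ^+ 2)) (ctsM (@ctsC _ _ (4 * nu)) (@cts_snd plane R)))).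
have n0 : tden t + sqn y != 0 by rewrite gt_eqF// wden_pos// tden_gt0.
have cv : {for (y, t), continuous (fun p : plane * R => wden (tden p.2) p.1)}.
  exact (cvgV n0 (cm (y, t))).
have ce : {for (y, t), continuous (fun p : plane * R => expR (wexp k (tden p.2) p.1))}.
  apply: (@continuous_comp _ _ _ (fun p : plane * R => wexp k (tden p.2) p.1) (@expR R)); last exact: continuous_expR.
  have ckq : continuous (fun p : plane * R => k * sqn p.1) := ctsM (@ctsC _ _ k) cq.
  exact (cvgM (ckq (y, t)) cv).
have cc : {for (y, t), continuous (fun p : plane * R => cutoff L 2 p.1)}.
  have h : continuous (fun p : plane * R => cutoff L 2 p.1).
    exact (@cts_comp _ _ _ (@fst plane R) (cutoff L 2) cts_fst (@continuous_cutoff R L 2)).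
  exact (h (y, t)).
have cr : {for (y, t), continuous (fun p : plane * R => wroot k (tden p.2) L p.1)} by exact (cvgM ce cc).
have ch : {for (y, t), continuous (fun p : plane * R => eta p.1 p.2)}.
  have -> : (fun p : plane * R => eta p.1 p.2) = fun p => wroot k (tden p.2) L p.1 * wroot k (tden p.2) L p.1.
    by apply/funext => p; rewrite /eta /wght expr2.
  exact (cvgM cr cr).
split=> //.
have -> : (fun p : plane * R => eta_t p.1 p.2) = fun p => eta p.1 p.2 *
    (-2 * (8 * k * nu) * k * sqn p.1 * (wden (tden p.2) p.1 * wden (tden p.2) p.1)).
  by apply/funext => p; rewrite /eta_t /eta; ring.
have cc2 : continuous (fun p : plane * R => -2 * (8 * k * nu) * k * sqn p.1).
  exact (ctsM (@ctsC _ _ (-2 * (8 * k * nu) * k)) cq).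
exact (cvgM ch (cvgM (cc2 (y, t)) (cvgM cv cv))).
Qed.

(** The cut-off error of [wght_inequality], with the value of [tden] at time 0 as a lower bound for
    all later ones; hence it does not depend on time. *)
Definition err : R := 2 * expR k ^+ 2 *
  (16 * nu * (2 * k * ((2 * k * lam0 ^+ 2)^-1 + 1)) + 32 * nu + 8 * U) / L.

Lemma err_ge0 : 0 <= U -> 0 <= err.
Proof.
move=> U0; have k0' := ltW k0; have nu0' := ltW nu0.
rewrite /err; apply: divr_ge0; last exact: ltW.
apply: mulr_ge0; first exact (mulr_ge0 (ler0n _ _) (sqr_ge0 _)).
apply: addr_ge0; last exact (mulr_ge0 (ler0n _ _) U0).
apply: addr_ge0; last exact (mulr_ge0 (ler0n _ _) nu0').
apply: mulr_ge0; first exact (mulr_ge0 (ler0n _ _) nu0').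
apply: mulr_ge0; first exact (mulr_ge0 (ler0n _ _) k0').
apply: addr_ge0 => //; rewrite invr_ge0; apply: mulr_ge0; last exact: sqr_ge0.
exact (mulr_ge0 (ler0n _ _) k0').
Qed.

(** With h = p^2, the diffusion produces -2 nu p^2 |grad w|^2 - 4 nu p w grad p . grad w, that is -2
    nu |p grad w + w grad p|^2 + 2 nu w^2 |grad p|^2. The square is dropped, and the rest is [w ^ 2]
    times the left-hand side of [wght_inequality]. *)
Lemma energy_derivative_le t : 0 < t -> t <= T ->
  Int (fun x => eta_t x t * w x t ^+ 2 + eta x t * (2 * w x t * pdt w x t)) <=
  U ^+ 2 / nu * Int (fun x => eta x t * w x t ^+ 2) + err * C.
Proof.
move=> tp tT.
have m0 := tden_gt0 tp; set m := tden t in m0.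
have s0 := lamsq_gt0 tp.
have U0 : 0 <= U by exact: le_trans (velU tp tT false 0).
have cwt := classical_continuous cw tp.
have cpd i : continuous (pd i w ^~ t) := @classical_continuous_pd _ w t cw tp i.
have clw := classical_continuous_lap cw tp.
have cpt : continuous (pdt w ^~ t).
  by apply: continuous_at_slice => x; have [_ []] := cw x tp.
have cv i : continuous (vel (om ^~ t) i) := @continuous_vel _ _ M (fun y => oM y tp) (oi tp) i.
have [l2 hC] := wC tp tT.
pose h := wght k m L. pose h' := wght' k m L.
have ch : continuous h := @continuous_wght R k m L m0.
have ch' i : continuous (h' i) := @continuous_wght' R k m L m0 i.
have [g0 cg0 dg0] := @D_wght' R k m L m0 false.
have [g1 cg1 dg1] := @D_wght' R k m L m0 true.
pose h'' i := if i then g1 else g0.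
have ch'' i : continuous (h'' i) by case: i.
have dh i : D i h (h' i) := D_wght k L m0 i.
have dh' i : D i (h' i) (h'' i) by case: i.
have sh : supp L h := @wght_supp R k m L L0.
have sh' i : supp L (h' i) := D_supp (dh i) sh.
pose f x := w x t ^+ 2.
pose f' i x := 2 * w x t * pd i w x t.
pose f'' i x := 2 * pd i w x t ^+ 2 + 2 * w x t * pd i (pd i w) x t.
pose lf x := 2 * (pd1 w x t ^+ 2 + pd2 w x t ^+ 2) + 2 * w x t * lap w x t.
have cf : continuous f := @ctsX _ _ _ 2 cwt.
have cf' i : continuous (f' i) := ctsM (ctsM (@ctsC _ _ 2) cwt) (cpd i).
have clf : continuous lf.
  exact (ctsD (ctsM (@ctsC _ _ 2) (ctsD (@ctsX _ _ _ 2 (cpd false)) (@ctsX _ _ _ 2 (cpd true))))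
    (ctsM (ctsM (@ctsC _ _ 2) cwt) clw)).
have dw i := classical_D cw tp i.
have ddw i := classical_DD cw tp i.
have df i : D i f (f' i).
  by apply: eq_D (DM (dw i) (dw i)) => x; rewrite /f ?expr2// /f'; ring.
have df' i : D i (f' i) (f'' i).
  by apply: eq_D (DM (DZ 2 (dw i)) (ddw i)) => x //; rewrite /f''; ring.
have lfE x : lf x = f'' false x + f'' true x by rewrite /lf /f'' /lap /=; ring.
have [_ P1] := @Int_lap_parts R L f lf f' f'' h h' h'' cf cf' clf
  (fun i => conj (df i) (df' i)) lfE ch sh ch' ch'' (fun i => conj (dh i) (dh' i)).
have P2 := @vel_parts R (om ^~ t) M f h f' h' L (classical_continuous co tp) (fun y => oM y tp) (oi tp)
  cf cf' df ch sh ch' dh.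
pose c := (2 * pi)^-1 : R.
pose u i x := c * vel (om ^~ t) i x.
have cht : continuous (fun x => eta_t x t).
  have hq := @continuous_sqn R.
  have hv : continuous (wden m) := continuous_wden m0.
  exact (ctsM ch (ctsM (@ctsC _ _ 2) (ctsN (ctsM (ctsM (ctsM (@ctsC _ _ k) hq) (@ctsX _ _ _ 2 hv)) (@ctsC _ _ (8 * k * nu)))))).
have sht : supp L (fun x => eta_t x t) by apply: suppMl.
have l_t : L1 (fun x => eta_t x t * f x).
  by apply: (@L1_supp _ _ L (ctsM cht cf)); exact: suppMl.
have l_lap : L1 (fun x => h x * lf x) by apply: (@L1_supp _ _ L (ctsM ch clf)); exact: suppMl.
have cgr : continuous (fun x => pd1 w x t ^+ 2 + pd2 w x t ^+ 2).
  exact (ctsD (@ctsX _ _ _ 2 (cpd false)) (@ctsX _ _ _ 2 (cpd true))).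
have l_gr : L1 (fun x => h x * (pd1 w x t ^+ 2 + pd2 w x t ^+ 2)).
  by apply: (@L1_supp _ _ L (ctsM ch cgr)); exact: suppMl.
have cadv : continuous (fun x => vel (om ^~ t) false x * f' false x + vel (om ^~ t) true x * f' true x).
  exact (ctsD (ctsM (cv false) (cf' false)) (ctsM (cv true) (cf' true))).
have l_adv : L1 (fun x => h x * (vel (om ^~ t) false x * f' false x + vel (om ^~ t) true x * f' true x)).
  by apply: (@L1_supp _ _ L (ctsM ch cadv)); exact: suppMl.
have cdot : continuous (fun x => h' false x * f' false x + h' true x * f' true x).
  exact (ctsD (ctsM (ch' false) (cf' false)) (ctsM (ch' true) (cf' true))).
have l_dot : L1 (fun x => h' false x * f' false x + h' true x * f' true x).
  by apply: (@L1_supp _ _ L cdot) => x xL; rewrite !sh'// !mul0r addr0.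
have cadv' : continuous (fun x => vel (om ^~ t) false x * h' false x + vel (om ^~ t) true x * h' true x).
  exact (ctsD (ctsM (cv false) (ch' false)) (ctsM (cv true) (ch' true))).
have l_adv' : L1 (fun x => f x * (vel (om ^~ t) false x * h' false x + vel (om ^~ t) true x * h' true x)).
  by apply: (@L1_supp _ _ L (ctsM cf cadv')); apply: suppMr => x xL; rewrite !sh'// !mulr0 addr0.
(* 2 w lap w = lap (w^2) - 2 |grad w|^2 brings in [lf], the Laplacian of [f], to which
   [Int_lap_parts] applies. *)
have E1 : Int (fun x => eta_t x t * w x t ^+ 2 + eta x t * (2 * w x t * pdt w x t)) =
  Int (fun x => eta_t x t * f x) + nu * Int (fun x => h x * lf x) +
  (- (2 * nu)) * Int (fun x => h x * (pd1 w x t ^+ 2 + pd2 w x t ^+ 2)) +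
  (- c) * Int (fun x => h x * (vel (om ^~ t) false x * f' false x + vel (om ^~ t) true x * f' true x)).
  rewrite -(IntZ _ l_lap) -(IntZ _ l_gr) -(IntZ _ l_adv).
  have l12 := L1D l_t (L1Z nu l_lap).
  have l123 := L1D l12 (L1Z (- (2 * nu)) l_gr).
  rewrite -(IntD l_t (L1Z nu l_lap)) -(IntD l12 (L1Z (- (2 * nu)) l_gr)) -(IntD l123 (L1Z (- c) l_adv)).
  apply: eq_Int => x; rewrite (ew x tp) BS1_vel BS2_vel -/c.
  rewrite /f' /lf /f /pd /eta -/m -/(h x); ring.
have E2 : Int (fun x => eta_t x t * w x t ^+ 2 + eta x t * (2 * w x t * pdt w x t)) =
  Int (fun x => eta_t x t * f x + (- nu) * (h' false x * f' false x + h' true x * f' true x) +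
    (- (2 * nu)) * (h x * (pd1 w x t ^+ 2 + pd2 w x t ^+ 2)) +
    c * (f x * (vel (om ^~ t) false x * h' false x + vel (om ^~ t) true x * h' true x))).
  have l12 := L1D l_t (L1Z (- nu) l_dot).
  have l123 := L1D l12 (L1Z (- (2 * nu)) l_gr).
  rewrite (IntD l123 (L1Z c l_adv')) (IntD l12 (L1Z (- (2 * nu)) l_gr)) (IntD l_t (L1Z (- nu) l_dot)).
  by rewrite (IntZ _ l_dot) (IntZ _ l_gr) (IntZ _ l_adv') E1 P1 P2; ring.
have le : L1 (fun x => h x * f x) by apply: (@L1_supp _ _ L (ctsM ch cf)); exact: suppMl.
have e0 := err_ge0 U0.
rewrite E2; apply: le_trans (_ : Int (fun x => U ^+ 2 / nu * (h x * f x) + err * f x) <= _); last first.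
  rewrite (IntD (L1Z _ le) (L1Z _ l2)) (IntZ _ le) (IntZ _ l2) lerD2l.
  exact: ler_wpM2l.
apply: Int_le.
- exact (L1D (L1D (L1D l_t (L1Z (- nu) l_dot)) (L1Z (- (2 * nu)) l_gr)) (L1Z c l_adv')).
- exact (L1D (L1Z _ le) (L1Z _ l2)).
move=> x.
have hu j : `|u j x| <= U.
  have /andP[c0 c1] := inv_2pi_le1; rewrite /u normrM (ger0_norm c0) -[leRHS]mul1r.
  by apply: ler_pM => //; exact: velU.
have mm0 : 0 < 2 * k * lam0 ^+ 2 by rewrite mulr_gt0 ?exprn_gt0// mulr_gt0.
have mmm : 2 * k * lam0 ^+ 2 <= m.
  rewrite /m /tden; apply: ler_wpM2l; first by rewrite mulr_ge0// ltW.
  by rewrite /lamsq lerDl !mulr_ge0// ltW.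
have W := @wght_inequality R k m L k0 m0 L0 nu (lamsq t) U _ (fun j => u j x) x nu0 s0 erefl mm0 mmm L1' hu.
rewrite -/err in W.
have W2 := ler_wpM2l (sqr_ge0 (w x t)) W.
apply: le_trans (_ : w x t ^+ 2 * (U ^+ 2 / nu * wght k m L x + err) <= _); last first.
  by rewrite /f /h mulrDr le_eqVlt; apply/orP; left; apply/eqP; ring.
apply: le_trans W2.
rewrite /eta_t -/m /f /f' /h /h' /wght' /u /pd /wght.
set p := wroot k m L x; set p0 := wroot' k m L false x; set p1 := wroot' k m L true x.
set v0 := vel _ false x; set v1 := vel _ true x; set a := w x t; set a1 := pd1 w x t; set a2 := pd2 w x t.
set Z := 2 * _.
clearbody p p0 p1 v0 v1 a a1 a2 Z.
rewrite -subr_ge0.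
(* The difference between the two integrands is the dropped square. *)
set D := (X in 0 <= X).
have -> : D = 2 * nu * ((p * a1 + a * p0) ^+ 2 + (p * a2 + a * p1) ^+ 2) by rewrite /D; ring.
by rewrite mulr_ge0 ?addr_ge0 ?sqr_ge0// mulr_ge0// ltW.
Qed.

Lemma is_derive_energy (t : R) : 0 < t ->
  is_derive t (1 : R) (fun s => Int (fun x => eta x s * w x s ^+ 2))
    (Int (fun x => eta_t x t * w x t ^+ 2 + eta x t * (2 * w x t * pdt w x t))).
Proof.
move=> tp.
apply: (@is_derive_Int_time _ (fun x s => eta x s * w x s ^+ 2)
  (fun x s => eta_t x s * w x s ^+ 2 + eta x s * (2 * w x s * pdt w x s)) L t tp).
- move=> y s sp.
  have dw := classical_pdt cw sp y.
  have := is_deriveM_val (is_derive_eta y sp) (is_deriveM_val dw dw).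
  have -> : eta_t y s * (w y s * w y s) + eta y s * (pdt w y s * w y s + w y s * pdt w y s) =
    eta_t y s * w y s ^+ 2 + eta y s * (2 * w y s * pdt w y s) by ring.
  by [].
- move=> y s sp; have [ch cht] := continuous_eta_time y sp.
  have [_ [c1 _ _ _ c2]] := cw y sp.
  have -> : (fun p : plane * R => eta_t p.1 p.2 * w p.1 p.2 ^+ 2 + eta p.1 p.2 * (2 * w p.1 p.2 * pdt w p.1 p.2)) =
    fun p => eta_t p.1 p.2 * (w p.1 p.2 * w p.1 p.2) + eta p.1 p.2 * (w p.1 p.2 * pdt w p.1 p.2 + w p.1 p.2 * pdt w p.1 p.2).
    by apply/funext => p; ring.
  exact (cvgD (cvgM cht (cvgM c1 c1)) (cvgM ch (cvgD (cvgM c1 c2) (cvgM c1 c2)))).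
- move=> s sp; exact (ctsM (continuous_wght (tden_gt0 sp)) (@ctsX _ _ _ 2 (classical_continuous cw sp))).
- by move=> s sp; apply: suppMl; exact: wght_supp.
Qed.

End Truncated.
End EnergyInequality.

(** * Removal of the truncations *)

Section WeightedEnergy.
Context {R : realType}.
Local Notation plane := (R * R)%type.
Implicit Types (i j : bool) (x y z : plane).

Lemma Phi_inv (lam : R) x : 0 < lam ->
  (Phi lam x)^-1 = pi * lam ^+ 2 * expR (sqn x / lam ^+ 2).
Proof. by move=> l0; rewrite /Phi invfM invrK -expRN -/(sqn x) mulNr opprK. Qed.

Lemma wenergy_L1 (lam : R) (f : plane -> R) : 0 < lam -> measurable_fun setT f ->
  (wenergy lam f < +oo)%E <-> L1 (fun x => expR (sqn x / lam ^+ 2) * f x ^+ 2).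
Proof.
move=> l0 mf; have c0 : 0 < pi * lam ^+ 2 by rewrite mulr_gt0 ?pi_gt0// exprn_gt0.
have E x : (Phi lam x)^-1 * f x ^+ 2 = pi * lam ^+ 2 * (expR (sqn x / lam ^+ 2) * f x ^+ 2).
  by rewrite Phi_inv// mulrA.
have g0 x : 0 <= expR (sqn x / lam ^+ 2) * f x ^+ 2 by rewrite mulr_ge0 ?expR_ge0 ?sqr_ge0.
rewrite /wenergy; under eq_integral do rewrite E.
split=> [h|l].
- have mg : measurable_fun setT (fun x => expR (sqn x / lam ^+ 2) * f x ^+ 2).
    apply: measurable_funM; last exact: measurable_funX.
    apply: continuous_measurable_plane.
    exact (@cts_comp _ _ _ (fun x : plane => sqn x / lam ^+ 2) (@expR R)
      (ctsM (@continuous_sqn R) (@ctsC _ _ (lam ^+ 2)^-1)) (@continuous_expR R)).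
  have lg : L1 (fun x => pi * lam ^+ 2 * (expR (sqn x / lam ^+ 2) * f x ^+ 2)).
    apply: L1P; first by apply: measurable_funM.
    under eq_integral => x _ do rewrite ger0_norm ?(mulr_ge0 (ltW c0) (g0 x))//.
    exact: h.
  apply: eq_L1 (L1Z (pi * lam ^+ 2)^-1 lg) => x.
  by rewrite mulKf// gt_eqF.
- have lc := L1Z (pi * lam ^+ 2) l.
  by rewrite -(Int_EFin lc) ltry.
Qed.

(** With k = n + 1 the exponent is |y|^2 / (2 S + |y|^2 / k), which tends to |y|^2 / (2 S); squaring
    the root doubles it. *)
Lemma wght_cvg (S : R) (L : nat -> R) y : 0 < S -> (forall n, n.+1%:R <= L n) ->
  (fun n => wght n.+1%:R (2 * n.+1%:R * S) (L n) y) @ \oo --> expR (sqn y / S).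
Proof.
move=> S0 hL.
have ck : (fun n : nat => n.+1%:R^-1 : R) @ \oo --> 0.
  by have := @cvg_harmonic R.
have cL : (fun n => cutoff (L n) 2 y) @ \oo --> (1 : R).
  apply: cutoff_cvg => [n|]; first by apply: lt_le_trans (hL n).
  apply: (@squeeze_cvgr _ _ _ _ (fun=> 0) (fun n : nat => n.+1%:R^-1 : R)) => //; last exact: cvg_cst.
  apply: nearW => n; have Ln : 0 < L n by apply: lt_le_trans (hL n).
  by rewrite invr_ge0 (ltW Ln)/= lef_pV2 ?posrE.
have cw : (fun n : nat => wexp n.+1%:R (2 * n.+1%:R * S) y) @ \oo --> sqn y / (2 * S).
  have -> : (fun n : nat => wexp n.+1%:R (2 * n.+1%:R * S) y) =
      fun n : nat => sqn y * (2 * S + sqn y * n.+1%:R^-1)^-1.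
    apply/funext => n; rewrite /wexp /wden; have k0 : 0 < n.+1%:R :> R by [].
    have q0 := sqn_ge0 y.
    have d1 : 0 < 2 * n.+1%:R * S + sqn y by rewrite ltr_wpDr// !mulr_gt0.
    have -> : 2 * S + sqn y * n.+1%:R^-1 = (2 * n.+1%:R * S + sqn y) * n.+1%:R^-1.
      by field; rewrite gt_eqF.
    by rewrite invfM invrK; ring.
  apply: cvgM; first exact: cvg_cst.
  apply: cvgV; first by rewrite gt_eqF// mulr_gt0.
  rewrite -[X in _ --> X]addr0 -(mulr0 (sqn y)).
  by apply: cvgD; [exact: cvg_cst|apply: cvgM => //; exact: cvg_cst].
have cr : (fun n => wroot n.+1%:R (2 * n.+1%:R * S) (L n) y) @ \oo --> expR (sqn y / (2 * S)) * 1.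
  apply: cvgM cL; exact (cvg_comp _ _ cw (@continuous_expR R _)).
have <- : expR (sqn y / (2 * S)) * 1 * (expR (sqn y / (2 * S)) * 1) = expR (sqn y / S).
  by rewrite !mulr1 -expRD; congr expR; field; rewrite gt_eqF.
have -> : (fun n => wght n.+1%:R (2 * n.+1%:R * S) (L n) y) = fun n =>
    wroot n.+1%:R (2 * n.+1%:R * S) (L n) y * wroot n.+1%:R (2 * n.+1%:R * S) (L n) y.
  by apply/funext => n; rewrite /wght expr2.
exact (cvgM cr cr).
Qed.

Variables (nu lam0 M U C T : R) (om w : plane -> R -> R) (w0 : plane -> R).
Hypotheses (nu0 : 0 < nu) (lam00 : 0 < lam0) (T0 : 0 < T).
Hypotheses (co : classical21 om) (oM : forall x t, 0 < t -> `|om x t| <= M) (oi : forall t, 0 < t -> L1 (om ^~ t)).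
Hypotheses (cw : classical21 w) (ew : adv_diff_eq nu (BS1 om) (BS2 om) w).
Hypothesis (velU : forall t, 0 < t -> t <= T -> forall i x, `|vel (om ^~ t) i x| <= U).
Hypothesis (wC : forall t, 0 < t -> t <= T -> L1 (fun x => w x t ^+ 2) /\ Int (fun x => w x t ^+ 2) <= C).
Hypothesis mw0 : measurable_fun setT w0.
Hypothesis w0E : L1 (fun x => expR (sqn x / lam0 ^+ 2) * w0 x ^+ 2).
Hypothesis w_cvg : (fun t => \int[@leb2 R]_x ((w x t - w0 x) ^+ 2)%:E)%E @ (0 : R)^'+ --> 0%E.

Let E0 := Int (fun x => expR (sqn x / lam0 ^+ 2) * w0 x ^+ 2).

(** w^2 <= 2 (w - w_0)^2 + 2 w_0^2. On the first part the weight is at most exp(2 k) and L^2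
    convergence wins; on the second it is at most the Gaussian of width [lam0], because lambda
    grows. The time [t0] depends on [k], the bound does not. *)
Lemma initial_energy_le (k L : R) : 0 < k -> 1 <= L -> exists t0, [/\ 0 < t0, t0 < T &
  Int (fun x => eta nu lam0 k L x t0 * w x t0 ^+ 2) <= 2 * E0 + 1].
Proof.
move=> k0 L1'.
have L0 : 0 < L := lt_le_trans ltr01 L1'.
(* The bound of the weight times the 2 of the previous splitting; [t0] is small enough for the
   squared L^2 distance to be at most 1 / K. *)
pose K := 2 * expR (2 * k).
have K0 : 0 < K by rewrite mulr_gt0 ?expR_gt0.
have n1 : ereal_nbhs (0%E : \bar R) (fun u => (u < (K^-1)%:E)%E).
  by apply: open_ereal_lt'; rewrite lte_fin invr_gt0.
have [d /= d0 hd] := w_cvg n1.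
pose t0 := Num.min (d / 2) (T / 2).
have [td tT] : t0 <= d / 2 /\ t0 <= T / 2 by rewrite /t0 !ge_min !lexx orbT.
have tp : 0 < t0 by rewrite /t0 lt_min !divr_gt0.
have t0T : t0 < T by lra.
have mwt : measurable_fun setT (w ^~ t0) := continuous_measurable_plane (classical_continuous cw tp).
have [ld hd'] : L1 (fun x => (w x t0 - w0 x) ^+ 2) /\ Int (fun x => (w x t0 - w0 x) ^+ 2) <= K^-1.
  apply: Int_fine_le.
  - by move=> x; exact: sqr_ge0.
  - by apply: measurable_funX; apply: measurable_funB.
  - by apply: ltW; apply: hd => //; rewrite /ball_/= sub0r normrN gtr0_norm//; lra.
exists t0; split => //.
have m0 : 0 < 2 * k * lamsq nu lam0 t0.
  by rewrite mulr_gt0 ?mulr_gt0// /lamsq addr_gt0 ?exprn_gt0// !mulr_gt0.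
apply: le_trans (_ : Int (fun x => K * (w x t0 - w0 x) ^+ 2 + 2 * (expR (sqn x / lam0 ^+ 2) * w0 x ^+ 2)) <= _).
  apply: Int_le.
  - apply: (@L1_supp _ _ L); last by apply: suppMl; exact: wght_supp.
    exact (ctsM (continuous_wght m0) (@ctsX _ _ _ 2 (classical_continuous cw tp))).
  - exact (L1D (L1Z _ ld) (L1Z _ w0E)).
  - move=> x.
    have e0 : 0 <= eta nu lam0 k L x t0 := wght_ge0 _ _ _ _.
    have e1 : eta nu lam0 k L x t0 <= expR (2 * k).
      apply: le_trans (wght_le _ _ _ _) _.
      by rewrite ler_expR ler_pM2l//; exact: wexp_le.
    have e2 : eta nu lam0 k L x t0 <= expR (sqn x / lam0 ^+ 2).
      apply: le_trans (wght_le _ _ _ _) _.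
      rewrite ler_expR; apply: le_trans (_ : 2 * (k * sqn x / (2 * k * lamsq nu lam0 t0)) <= _).
        by rewrite ler_pM2l//; exact: wexp_le_quad.
      have l0 : 0 < lam0 ^+ 2 by rewrite exprn_gt0.
      have l1 : lam0 ^+ 2 <= lamsq nu lam0 t0 by rewrite /lamsq lerDl !mulr_ge0// ltW.
      have -> : 2 * (k * sqn x / (2 * k * lamsq nu lam0 t0)) = sqn x / lamsq nu lam0 t0.
        by field; rewrite !gt_eqF//; exact: lt_le_trans l1.
      apply: ler_wpM2l; first exact: sqn_ge0.
      by rewrite lef_pV2 ?posrE//; exact: lt_le_trans l1.
    have p : w x t0 ^+ 2 <= 2 * (w x t0 - w0 x) ^+ 2 + 2 * w0 x ^+ 2.
      rewrite -subr_ge0 (_ : _ - _ = (w x t0 - 2 * w0 x) ^+ 2); last by ring.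
      exact: sqr_ge0.
    apply: le_trans (ler_wpM2l e0 p) _; rewrite mulrDr; apply: lerD.
    + rewrite mulrCA mulrA /K; apply: ler_wpM2r; first exact: sqr_ge0.
      exact: ler_wpM2l.
    + rewrite mulrCA; apply: ler_wpM2l => //; apply: ler_wpM2r => //; exact: sqr_ge0.
rewrite (IntD (L1Z K ld) (L1Z 2 w0E)) (IntZ _ ld) (IntZ _ w0E) addrC lerD2l.
by rewrite -(mulfV (lt0r_neq0 K0)); apply: ler_wpM2l => //; exact: ltW.
Qed.

Lemma truncated_energy_le (k : R) : 0 < k -> exists2 L, k <= L &
  Int (fun x => eta nu lam0 k L x T * w x T ^+ 2) <= expR (U ^+ 2 / nu * T) * (2 * E0 + 2).
Proof.
move=> k0.
have U0 : 0 <= U by exact: le_trans (velU T0 (lexx T) false 0).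
have C0 : 0 <= C by have [_] := wC T0 (lexx T); apply: le_trans; apply: Int_ge0 => x; exact: sqr_ge0.
have [e e0 eE] : exists2 e, 0 <= e & forall L, err nu lam0 U k L = e / L.
  by exists (err nu lam0 U k 1); [exact: err_ge0|move=> L; rewrite /err divr1].
have eCT : 0 <= e * C * T := mulr_ge0 (mulr_ge0 e0 C0) (ltW T0).
(* [1 <= L] is required by the inequalities, [k <= L] sends [L] to infinity with [k], and the last
   term makes the accumulated cut-off error at most 1. *)
pose L := 1 + k + e * C * T.
have [L1' kL eL] : [/\ 1 <= L, k <= L & e * C * T <= L] by rewrite /L; split; lra.
have L0 : 0 < L := lt_le_trans ltr01 L1'.
exists L => //.
have [t0 [t00 t0T h0]] := initial_energy_le k0 L1'.
have b0 : 0 <= err nu lam0 U k L * C by rewrite eE; exact (mulr_ge0 (divr_ge0 e0 (ltW L0)) C0).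
have a0 : 0 <= U ^+ 2 / nu by rewrite divr_ge0 ?sqr_ge0// ltW.
have F0 : 0 <= Int (fun x => eta nu lam0 k L x t0 * w x t0 ^+ 2).
  by apply: Int_ge0 => x; rewrite mulr_ge0 ?sqr_ge0//; exact: wght_ge0.
have G := gronwall a0 b0 t00 t0T
  (is_derive_energy nu0 lam00 cw k0 L1')
  (energy_derivative_le nu0 lam00 co oM oi cw ew velU wC k0 L1') F0.
apply: le_trans G _; apply: ler_wpM2l; first exact: expR_ge0.
have : err nu lam0 U k L * C * T <= 1.
  rewrite eE (_ : e / L * C * T = e * C * T / L); last by ring.
  by rewrite ler_pdivrMr// mul1r.
move: h0; lra.
Qed.

(** The bound on the truncated energies does not depend on [k], so Fatou's lemma along k = n + 1
    gives the full Gaussian weight. *)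
Lemma weighted_energy_finite : (wenergy (lam_t nu lam0 T) (fun x => w x T) < +oo)%E.
Proof.
have S0 : 0 < lamsq nu lam0 T by rewrite /lamsq addr_gt0 ?exprn_gt0// !mulr_gt0.
have l0 : 0 < lam_t nu lam0 T by rewrite /lam_t sqrtr_gt0.
have lE : lam_t nu lam0 T ^+ 2 = lamsq nu lam0 T by rewrite /lam_t sqr_sqrtr// ltW.
have cwT := classical_continuous cw T0.
apply/(wenergy_L1 l0 (continuous_measurable_plane cwT)); rewrite lE.
have h (n : nat) : exists L, n.+1%:R <= L /\
    Int (fun x => eta nu lam0 n.+1%:R L x T * w x T ^+ 2) <= expR (U ^+ 2 / nu * T) * (2 * E0 + 2).
  by have [L h1 h2] := truncated_energy_le (ltr0Sn R n); exists L.
have {h} [L hL] := choice h.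
have Lp n : 0 < L n by have [h _] := hL n; exact: lt_le_trans (ltr0Sn R n) h.
have m0 (n : nat) : 0 < 2 * n.+1%:R * lamsq nu lam0 T by rewrite !mulr_gt0.
have ce n : continuous (fun x => eta nu lam0 n.+1%:R (L n) x T * w x T ^+ 2).
  exact (ctsM (continuous_wght (m0 n)) (@ctsX _ _ _ 2 cwT)).
apply: (proj1 (@Int_fatou _ (fun n x => eta nu lam0 n.+1%:R (L n) x T * w x T ^+ 2) _
  (expR (U ^+ 2 / nu * T) * (2 * E0 + 2)) _ _ _ _ _)).
- by move=> n; exact: continuous_measurable_plane.
- by move=> n x; rewrite mulr_ge0 ?sqr_ge0//; exact: wght_ge0.
- by move=> n; apply: (@L1_supp _ _ (L n) (ce n)); apply: suppMl; exact: wght_supp.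
- by move=> n; have [] := hL n.
- move=> x; apply: cvgM; last exact: cvg_cst.
  by apply: wght_cvg => // n; have [] := hL n.
Qed.

End WeightedEnergy.

Theorem mainTheorem2 (R : realType) (nu lam0 : R) (N : nat)
  (w0 : 'I_N -> R * R -> R) (om0 : R * R -> R)
  (om : R * R -> R -> R) (w : 'I_N -> R * R -> R -> R) :
  0 < nu -> 0 < lam0 -> (1 <= N)%N ->
  (forall j, measurable_fun setT (w0 j)) ->
  (forall x, om0 x = \sum_(j < N) w0 j x) ->
  (exists M : R, {ae @leb2 R, forall x, `|om0 x| <= M}) ->
  (forall j, (wenergy lam0 (w0 j) < +oo)%E) ->
  vorticity_solution nu om0 om ->
  (forall j, linear_solution nu (BS1 om) (BS2 om) (w0 j) (w j)) ->
  forall (j : 'I_N) (t : R), 0 < t ->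
    (wenergy (lam_t nu lam0 t) (fun x => w j x t) < +oo)%E.
Proof.
move=> nu0 lam00 _ mw0 om0E _ w0E [co eo [M oM] oint om_cvg] lin j T T0.
have oi t : 0 < t -> L1 (om ^~ t).
  move=> t0; apply: L1P; last exact: oint.
  exact: continuous_measurable_plane (classical_continuous co t0).
have mom0 : measurable_fun setT om0.
  have -> : om0 = fun x => \sum_(j < N) w0 j x by apply/funext.
  exact: measurable_sum.
have [U velU] := vorticity_velocity_bounded nu0 co eo oM oi mom0 om_cvg T.
have [cw ew wT w_cvg] := lin j.
(* The L^2 bound, uniform on (0, T], is what the cut-off error is multiplied by. *)
have [C hC] := wT T T0.
have wC t : 0 < t -> t <= T -> L1 (fun x => w j x t ^+ 2) /\ Int (fun x => w j x t ^+ 2) <= C.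
  move=> t0 tT; apply: Int_fine_le; [by move=> x; exact: sqr_ge0| |exact: hC].
  apply: measurable_funX; exact: continuous_measurable_plane (classical_continuous cw t0).
have w0L := (wenergy_L1 lam00 (mw0 j)).1 (w0E j).
exact: (weighted_energy_finite nu0 lam00 T0 co oM oi cw ew velU wC (mw0 j) w0L w_cvg).
Qed.
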